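(* Let $n\ge1$, $k>0$, let $f$ be a smooth function on $\mathbb{R}^{n+1}$ and, for $\lambda\in\mathbb{R}^{n+1}$, let $f_\lambda(\nu_1,\dots,\nu_n)=f\big(\nu_1,\dots,\nu_n,\sum_{i=1}^{n+1}\lambda_i-\sum_{i=1}^{n}\nu_i\big)$. Then for every $\lambda\in\mathfrak a^+$, $$V_k(f)(\lambda)=\frac{c_{n,k}}{\pi(\lambda)^{2k}}\int_{\lambda_{n+1}}^{\lambda_n}\cdots\int_{\lambda_2}^{\lambda_1}\sum_{w\in S_n}\epsilon(w)\,Q(\lambda,w\nu)\,\widetilde V_k(f_\lambda)(w\nu)\,W_k(\lambda,\nu)\,d\nu_1\cdots d\nu_n.$$
   Context: Root system $A_n$ on $\mathbb{R}^{n+1}$ (no normalization $\sum x_i=0$), constant multiplicity $k>0$, Dunkl operators $T_jf(\lambda)=\partial_{\lambda_j}f(\lambda)+k\sum_{i\neq j}\frac{f(\lambda)-f((i,j)\lambda)}{\lambda_j-\lambda_i}$, $(i,j)$ the transposition of coordinates. The intertwining operator $V_k$ is the unique linear operator on polynomials with $T_jV_k=V_k\partial_j$ for all $j$, $V_k$ preserving each space of homogeneous polynomials of degree $m$, and $V_k1=1$; it is given by $V_kf(\lambda)=\int f\,d\mu_\lambda$ for a (compactly supported) positive probability measure $\mu_\lambda$, which defines $V_kf$ for smooth $f$. $\widetilde V_k$ is the corresponding operator for $A_{n-1}$ on $\mathbb{R}^n$ with the same $k$ (for $n=1$, $\widetilde V_k$ is the identity). $\mathfrak a^+=\{\lambda:\lambda_1>\dots>\lambda_{n+1}\}$,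 $\pi(\lambda)=\prod_{i<j}(\lambda_i-\lambda_j)$, $c_{n,k}=\frac{(n+1)\Gamma((n+1)k)}{\Gamma(k)^{n+1}}$, $(w\nu)_i=\nu_{w(i)}$, $\epsilon(w)$ the sign, $Q(\lambda,\nu)=\prod_{r=1}^{n+1}\big[\prod_{s=r+1}^{n}(\lambda_r-\nu_s)\prod_{s=1}^{r-1}(\nu_s-\lambda_r)\big]$, $W_k(\lambda,\nu)=\Big(\prod_{r=1}^{n+1}\big[\prod_{s=r}^{n}(\lambda_r-\nu_s)\prod_{s=1}^{r-1}(\nu_s-\lambda_r)\big]\Big)^{k-1}$. *)

(* Defs.v *)
From HB Require Import structures.
From mathcomp Require Import all_boot all_order all_algebra all_fingroup.
From mathcomp Require Import all_classical all_reals all_analysis.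
Set Implicit Arguments. Unset Strict Implicit. Unset Printing Implicit Defensive.
Import Order.TTheory GRing.Theory Num.Theory.
Import numFieldNormedType.Exports.
Local Open Scope classical_set_scope.
Local Open Scope ring_scope.

Section Defs.
Variable R : realType.

(* ---------- points of R^N are row vectors; measures live on N.-tuple R ---- *)
Definition tup2rV (N : nat) (t : N.-tuple R) : 'rV[R]_N := \row_i tnth t i.

Definition monom (N : nat) (a : 'I_N -> nat) (x : 'rV[R]_N) : R :=
  \prod_(i < N) x 0 i ^+ a i.

Definition is_poly (N : nat) (p : 'rV[R]_N -> R) : Prop :=
  exists s : seq (('I_N -> nat) * R),
    forall x, p x = \sum_(c <- s) c.2 * monom c.1 x.

Definition is_hpoly (N m : nat) (p : 'rV[R]_N -> R) : Prop :=
  exists s : seq (('I_N -> nat) * R),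
    all (fun c => (\sum_(i < N) c.1 i == m)%N) s /\
    forall x, p x = \sum_(c <- s) c.2 * monom c.1 x.

Definition pd (N : nat) (j : 'I_N) (g : 'rV[R]_N -> R) : 'rV[R]_N -> R :=
  fun x => 'D_(delta_mx 0 j) g x.

Fixpoint itpd (N : nat) (s : seq 'I_N) (g : 'rV[R]_N -> R) : 'rV[R]_N -> R :=
  if s is j :: s' then pd j (itpd s' g) else g.

Definition smooth (N : nat) (f : 'rV[R]_N -> R) : Prop :=
  forall s : seq 'I_N, continuous (itpd s f) /\
    forall (j : 'I_N) x, derivable (itpd s f) x (delta_mx 0 j).

Definition swapc (N : nat) (i j : 'I_N) (x : 'rV[R]_N) : 'rV[R]_N :=
  \row_l x 0 (tperm i j l).

Definition Vop (N : nat) (mu : 'rV[R]_N -> probability (N.-tuple R) R)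
  (g : 'rV[R]_N -> R) (lam : 'rV[R]_N) : R :=
  Rintegral (mu lam) setT (fun t => g (tup2rV t)).

Definition distinct_coords (N : nat) (x : 'rV[R]_N) : Prop :=
  forall i j : 'I_N, i != j -> x 0 i != x 0 j.

(* mu is the family of representing measures of the intertwining operator
   V_k of the root system A_{N-1} on R^N (multiplicity k):
   - each mu lam is a compactly supported probability measure;
   - V := (p |-> (lam |-> int p dmu_lam)) maps homogeneous polynomials of
     degree m to homogeneous polynomials of degree m (linearity and V 1 = 1
     are automatic);
   - T_j V = V d_j on polynomials (checked at points with distinct
     coordinates, where the Dunkl operator is given by the displayed
     formula; both sides are polynomials, so this is equality). *)
Definition is_Vk_measures (N : nat) (k : R)
  (mu : 'rV[R]_N -> probability (N.-tuple R) R) : Prop :=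
  [/\ (forall lam, exists M : R,
          mu lam [set t : N.-tuple R | exists i, M < `|tnth t i|] = 0%E),
      (forall (m : nat) (p : 'rV[R]_N -> R), is_hpoly m p -> is_hpoly m (Vop mu p))
    & (forall (p : 'rV[R]_N -> R) (j : 'I_N) (lam : 'rV[R]_N),
          is_poly p -> distinct_coords lam ->
          pd j (Vop mu p) lam
          + k * \sum_(i < N | i != j)
                  (Vop mu p lam - Vop mu p (swapc i j lam)) / (lam 0 j - lam 0 i)
          = Vop mu (pd j p) lam)].

Definition GammaF (x : R) : R :=
  Rintegral lebesgue_measure `]0, +oo[%classic
    (fun t => powR t (x - 1) * expR (- t)).

Definition cnk (n : nat) (k : R) : R :=
  n.+1%:R * GammaF (n.+1%:R * k) / GammaF k ^+ n.+1.

Definition in_chamber (N : nat) (lam : 'rV[R]_N) : Prop :=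
  forall i j : 'I_N, (i < j)%N -> lam 0 j < lam 0 i.

Definition piA (N : nat) (lam : 'rV[R]_N) : R :=
  \prod_(i < N) \prod_(j < N | (i < j)%N) (lam 0 i - lam 0 j).

Definition permrow (n : nat) (w : 'S_n) (nu : 'rV[R]_n) : 'rV[R]_n :=
  \row_i nu 0 (w i).

Definition sgn (n : nat) (w : 'S_n) : R := (-1) ^+ odd_perm w.

(* 0-based indices: r <-> r+1, s <-> s+1 in the paper *)
Definition Qf (n : nat) (lam : 'rV[R]_n.+1) (nu : 'rV[R]_n) : R :=
  \prod_(r < n.+1)
    ((\prod_(s < n | (r < s)%N) (lam 0 r - nu 0 s)) *
     (\prod_(s < n | (s < r)%N) (nu 0 s - lam 0 r))).

Definition Wk (n : nat) (k : R) (lam : 'rV[R]_n.+1) (nu : 'rV[R]_n) : R :=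
  powR (\prod_(r < n.+1)
    ((\prod_(s < n | (r <= s)%N) (lam 0 r - nu 0 s)) *
     (\prod_(s < n | (s < r)%N) (nu 0 s - lam 0 r)))) (k - 1).

Definition flam (n : nat) (f : 'rV[R]_n.+1 -> R) (lam : 'rV[R]_n.+1)
  (nu : 'rV[R]_n) : R :=
  f (\row_(i < n.+1) match unlift ord_max i with
                     | Some j => nu 0 j
                     | None => \sum_(l < n.+1) lam 0 l - \sum_(l < n) nu 0 l
                     end).

(* iterated integral  int_{a (m-1)}^{b (m-1)} ... int_{a 0}^{b 0} g(nu) dnu_0 ... dnu_(m-1)
   (variable nu_0 innermost) *)
Fixpoint iint (m : nat) (a b : nat -> R) (g : (nat -> R) -> R) : R :=
  if m is m'.+1 then
    Rintegral lebesgue_measure `[a m', b m']%classic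
      (fun x => iint m' a b (fun nu => g (fun i => if i == m' then x else nu i)))
  else g (fun _ => 0).

End Defs.
Arguments sgn {R n} w.

(* Main.v *)
(* Write v_a(x) for V_k applied to the monomial x^a.  Euler's identity and the
   intertwining relations give, on the orbit of lambda under S_{n+1},
     |a| v_a + k/2 sum_{i <> j} (v_a - v_a o (i,j)) = sum_j x_j a_j v_{a - e_j},
   and a maximum principle on this finite orbit shows that v_a is determined by v_0; it
   also bounds the supports of the representing measures, uniformly on the cell of
   interlacing nu.  Up to the sign of the permutation acting on lambda, the integral
   satisfies the same recursion: with Phi(x) = prod_r (x - lambda_r) the weight W_k is
   prod_s |Phi(nu_s)|^(k-1) on the cell, and the two sides of the recursion differ by
   the integral of a sum of derivatives of multiples of Phi |Phi|^(k-1), which vanishes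
   at the lambda_r.  For constant f the integral is a determinant of one-dimensional
   moments int (x - lambda_{n+1})^m q_s(x) |Phi(x)|^(k-1) dx, at m = 0, where
   q_s(x) = prod_{r <> s} (x - lambda_r).  Integration by parts relates m to m + 1
   through a matrix with explicit determinant, and for large m the moments are given by
   Watson's lemma and Euler's limit formula for Gamma.
   Bernstein polynomials extend the formula from polynomials to continuous functions. *)
Require Import Defs.
From HB Require Import structures.
From mathcomp Require Import all_boot all_order all_algebra all_fingroup.
From mathcomp Require Import all_classical all_reals all_analysis.
From mathcomp Require Import measurable_realfun.
From mathcomp Require Import ring lra zify.
Set Implicit Arguments. Unset Strict Implicit. Unset Printing Implicit Defensive.
Import Order.TTheory GRing.Theory Num.Theory.
Import numFieldNormedType.Exports.
Local Open Scope classical_set_scope.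
Local Open Scope ring_scope.

(** * Polynomial functions *)

Section PolynomialFunctions.
Variable R : realType.

(** The integrand contains the operator in n variables, whose Dunkl relations bring reflection terms
    that have to disappear. The alternating sum over w achieves this: reindexing by a transposition
    moves a divided difference from the function to the kernel, where it cancels the one produced by
    the k Phi' part of the integration by parts. A monomial restricted to the hyperplane of fixed
    coordinate sum is not homogeneous, so the recursion of the integral is derived for the field
    sum_j (nu_j - x_j) d_j, which lifts to y - x on that hyperplane. No regularity of the measures
    in nu is assumed, and the weight is unbounded for k < 1. Iterated integrals are therefore
    computed only for finite sums of products of one-variable functions; other integrands are
    reached by approximation relative to the weight, which also gives the measurability of the inner
    integrals. *)

Definition decr N (j : 'I_N) (a : 'I_N -> nat) : 'I_N -> nat :=
  fun i => if i == j then (a i).-1 else a i.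

Lemma sum_decr N (j : 'I_N) (a : 'I_N -> nat) : (0 < a j)%N ->
  (\sum_i decr j a i = (\sum_i a i).-1)%N.
Proof.
move=> aj; rewrite (bigD1 j)//= [in RHS](bigD1 j)//= /decr eqxx.
rewrite (eq_bigr a) => [|i /negPf->//]; lia.
Qed.

Lemma is_derive_sum_seq (V : normedModType R) (I : Type) (s : seq I)
    (f : I -> V -> R) (df : I -> R) (x v : V) :
  (forall i, is_derive x v (f i) (df i)) ->
  is_derive x v (fun y => \sum_(i <- s) f i y) (\sum_(i <- s) df i).
Proof.
move=> fd; elim: s => [|i s IH].
  rewrite big_nil (_ : (fun y => _) = cst 0); last first.
    by apply/funext => y; rewrite big_nil.
  exact: is_derive_cst.
rewrite big_cons (_ : (fun y => _) = f i + (fun y => \sum_(i <- s) f i y)).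
  exact: is_deriveD.
by apply/funext => y; rewrite big_cons.
Qed.

Lemma is_derive_coord N (i : 'I_N) (x v : 'rV[R]_N) :
  is_derive x v (fun y : 'rV[R]_N => y 0 i) (v 0 i).
Proof.

have H : (fun h : R => h^-1 *: (((fun y : 'rV[R]_N => y 0 i) \o shift x) (h *: v) -
    x 0 i)) @ 0^' --> v 0 i.
  apply: cvg_near_cst; near=> h; rewrite /= !mxE addrK.
  have h0 : h != 0 by near: h; exact: nbhs_dnbhs_neq.
  by rewrite /GRing.scale/= mulKf.
by constructor; [apply: cvgP H|exact: cvg_lim H].
Unshelve. all: by end_near. Qed.

Lemma is_derive_prod_seq (V : normedModType R) (I : eqType) (s : seq I)
    (f : I -> V -> R) (df : I -> R) (x v : V) : uniq s ->
  (forall i, is_derive x v (f i) (df i)) ->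
  is_derive x v (fun y => \prod_(i <- s) f i y)
    (\sum_(i <- s) df i * \prod_(j <- s | j != i) f j x).
Proof.
move=> us fd; elim: s us => [_|i s IH /= /andP[nis us]].
  rewrite big_nil (_ : (fun y => _) = cst 1); last first.
    by apply/funext => y; rewrite big_nil.
  exact: is_derive_cst.
rewrite (_ : (fun y => _) = f i * (fun y => \prod_(i <- s) f i y)); last first.
  by apply/funext => y; rewrite big_cons.
apply: (is_derive_eq (is_deriveM (fd i) (IH us))).
rewrite big_cons big_cons eqxx/= addrC; congr (_ + _).
  rewrite /GRing.scale/= mulrC; congr (_ * _).
  rewrite big_seq [RHS]big_seq_cond; apply: eq_bigl => j.
  by case: (boolP (j \in s)) => //= js; apply/esym; apply: contraNneq nis => <-.
rewrite /GRing.scale/= mulr_sumr; apply: eq_big_seq => j js.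
have ij : i != j by apply: contraNneq nis => ->.
by rewrite big_cons ij mulrCA.
Qed.

Lemma is_derive_monom_comp (V : normedModType R) N (a : 'I_N -> nat)
    (L : V -> 'rV[R]_N) (dL : 'I_N -> R) (x v : V) :
  (forall i, is_derive x v (fun y => L y 0 i) (dL i)) ->
  is_derive x v (fun y => monom a (L y))
    (\sum_i dL i * ((a i)%:R * monom (decr i a) (L x))).
Proof.
move=> Ld; have fd i : is_derive x v (fun y => L y 0 i ^+ a i)
    (((a i)%:R * L x 0 i ^+ (a i).-1) * dL i).
  have -> : (fun y => L y 0 i ^+ a i) = (fun y => L y 0 i) ^+ a i.
    by apply/funext => y; rewrite exprfctE.
  exact: (is_deriveX (a i) (Ld i)).
apply: (is_derive_eq (is_derive_prod_seq (index_enum_uniq 'I_N) fd)); apply: eq_bigr => i _; rewrite /monom.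
rewrite [in RHS](bigD1 i)//= /decr eqxx.
rewrite [in RHS](eq_bigr (fun j => L x 0 j ^+ a j)); last by move=> j /negPf ->.
by ring.
Qed.

Lemma is_derive_monom N (a : 'I_N -> nat) (j : 'I_N) (x : 'rV[R]_N) :
  is_derive x (delta_mx 0 j) (monom a) ((a j)%:R * monom (decr j a) x).
Proof.
apply: (is_derive_eq (@is_derive_monom_comp _ _ a id _ x (delta_mx 0 j)
  (fun i => is_derive_coord i x (delta_mx 0 j)))); rewrite (bigD1 j)//= mxE !eqxx mul1r big1 ?addr0//.
by move=> i /negPf ij; rewrite mxE eqxx ij mul0r.
Qed.

Lemma is_derive_poly_fun N (s : seq (('I_N -> nat) * R)) (p : 'rV[R]_N -> R) j x :
  (forall x, p x = \sum_(c <- s) c.2 * monom c.1 x) ->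
  is_derive x (delta_mx 0 j) p
    (\sum_(c <- s) c.2 * ((c.1 j)%:R * monom (decr j c.1) x)).
Proof.
move=> /funext ->; apply: is_derive_sum_seq => c.
exact: (is_deriveZ c.2 (is_derive_monom c.1 j x)).
Qed.

Lemma pdE N (s : seq (('I_N -> nat) * R)) (p : 'rV[R]_N -> R) j x :
  (forall x, p x = \sum_(c <- s) c.2 * monom c.1 x) ->
  pd j p x = \sum_(c <- s) c.2 * ((c.1 j)%:R * monom (decr j c.1) x).
Proof. by move=> ps; case: (is_derive_poly_fun j x ps). Qed.

Lemma pd_monom N (a : 'I_N -> nat) j :
  pd j (monom a) = fun x : 'rV[R]_N => (a j)%:R * monom (decr j a) x.
Proof. by apply/funext => x; case: (is_derive_monom a j x). Qed.

Lemma euler_monom N (a : 'I_N -> nat) (x : 'rV[R]_N) :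
  \sum_j x 0 j * ((a j)%:R * monom (decr j a) x) = (\sum_j a j)%:R * monom a x.
Proof.
rewrite natr_sum mulr_suml; apply: eq_bigr => j _; rewrite mulrCA.
case: (posnP (a j)) => [->|aj]; first by rewrite !mul0r.
congr (_ * _); rewrite /monom (bigD1 j)//= [in RHS](bigD1 j)//= /decr eqxx.
rewrite mulrA -exprS prednK//; congr (_ * _).
by apply: eq_bigr => i /negPf ->.
Qed.

Lemma euler_hpoly N m (p : 'rV[R]_N -> R) (x : 'rV[R]_N) : is_hpoly m p ->
  \sum_j x 0 j * pd j p x = m%:R * p x.
Proof.
case=> s [/allP sm ps].
under eq_bigr do rewrite (pdE _ _ ps) mulr_sumr.
rewrite exchange_big ps mulr_sumr /=; apply: eq_big_seq => c cs.
under eq_bigr do rewrite mulrCA.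
by rewrite -mulr_sumr euler_monom (eqP (sm _ cs)) mulrCA.
Qed.

Lemma is_hpoly_poly N m (p : 'rV[R]_N -> R) : is_hpoly m p -> is_poly p.
Proof. by case=> s [_ ps]; exists s. Qed.

Lemma is_hpoly_monom N (a : 'I_N -> nat) : is_hpoly (\sum_i a i) (@monom R N a).
Proof.
exists [:: (a, 1)]; split; first by rewrite /= eqxx.
by move=> x; rewrite big_seq1 mul1r.
Qed.

Lemma is_poly_monom N (a : 'I_N -> nat) : is_poly (@monom R N a).
Proof. exact: is_hpoly_poly (is_hpoly_monom a). Qed.

Lemma is_polyD N (p q : 'rV[R]_N -> R) :
  is_poly p -> is_poly q -> is_poly (fun x => p x + q x).
Proof.
by move=> [s ps] [t qt]; exists (s ++ t) => x; rewrite big_cat/= ps qt.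
Qed.

Lemma is_polyZ N c (p : 'rV[R]_N -> R) : is_poly p -> is_poly (fun x => c * p x).
Proof.
move=> [s ps]; exists [seq (t.1, c * t.2) | t <- s] => x.
by rewrite big_map ps mulr_sumr; apply: eq_bigr => t _; rewrite /= mulrA.
Qed.

Lemma is_poly_cst N c : is_poly (fun _ : 'rV[R]_N => c).
Proof.
exists [:: (fun=> 0%N, c)] => x; by rewrite big_seq1 /monom big1 ?mulr1.
Qed.

Lemma is_poly_coord N (i : 'I_N) : is_poly (fun x : 'rV[R]_N => x 0 i).
Proof.
exists [:: (fun j => (j == i)%N : nat, 1)] => x.
rewrite big_seq1 mul1r /monom (bigD1 i)//= eqxx expr1 big1 ?mulr1//.
by move=> j /negPf ->.
Qed.

Lemma is_polyM N (p q : 'rV[R]_N -> R) :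
  is_poly p -> is_poly q -> is_poly (fun x => p x * q x).
Proof.
move=> [s ps] [t qt].
exists [seq ((fun i => u.1 i + v.1 i)%N, u.2 * v.2) | u <- s, v <- t] => x.
rewrite big_allpairs_dep ps qt mulr_suml; apply: eq_bigr => u _.
rewrite mulr_sumr; apply: eq_bigr => v _ /=.
rewrite mulrACA; congr (_ * _); rewrite /monom -big_split/=.
by apply: eq_bigr => i _; rewrite exprD.
Qed.

Lemma is_poly_sum N (I : Type) (r : seq I) (P : pred I) (p : I -> 'rV[R]_N -> R) :
  (forall i, P i -> is_poly (p i)) -> is_poly (fun x => \sum_(i <- r | P i) p i x).
Proof.
move=> ip; elim: r => [|i r IH].
  under [X in is_poly X]eq_fun do rewrite big_nil; exact: is_poly_cst.
under [X in is_poly X]eq_fun do rewrite big_cons.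
case Pi: (P i) => //; apply: is_polyD => //; exact: ip.
Qed.

Lemma is_poly_prod N (I : Type) (r : seq I) (P : pred I) (p : I -> 'rV[R]_N -> R) :
  (forall i, P i -> is_poly (p i)) -> is_poly (fun x => \prod_(i <- r | P i) p i x).
Proof.
move=> ip; elim: r => [|i r IH].
  under [X in is_poly X]eq_fun do rewrite big_nil; exact: is_poly_cst.
under [X in is_poly X]eq_fun do rewrite big_cons.
case Pi: (P i) => //; apply: is_polyM => //; exact: ip.
Qed.

Lemma is_polyX N m (p : 'rV[R]_N -> R) : is_poly p -> is_poly (fun x => p x ^+ m).
Proof.
move=> ip; elim: m => [|m IH].
  under [X in is_poly X]eq_fun do rewrite expr0; exact: is_poly_cst.
under [X in is_poly X]eq_fun do rewrite exprS; exact: is_polyM.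
Qed.

Lemma is_poly_comp N M (L : 'rV[R]_N -> 'rV[R]_M) (p : 'rV[R]_M -> R) :
  (forall i, is_poly (fun x => L x 0 i)) -> is_poly p ->
  is_poly (fun x => p (L x)).
Proof.
move=> Lp [s ps]; under [X in is_poly X]eq_fun do rewrite ps.
apply: is_poly_sum => c _; apply: is_polyZ; apply: is_poly_prod => i _.
exact: is_polyX.
Qed.

Lemma is_poly_pd N j (p : 'rV[R]_N -> R) : is_poly p -> is_poly (pd j p).
Proof.
move=> [s ps].
rewrite (_ : pd j p = fun x => \sum_(c <- s) c.2 * ((c.1 j)%:R * monom (decr j c.1) x)).
  by apply: is_poly_sum => c _; do 2 apply: is_polyZ; exact: is_poly_monom.
by apply/funext => x; exact: pdE.
Qed.

(** [Rintegral] is additive on integrable functions only, so linearity of [Vop] and of the cell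
    integral is asked on polynomials. *)
Definition lin_on_poly N (L : ('rV[R]_N -> R) -> R) := forall c p q,
  is_poly p -> is_poly q -> L (fun x => c * p x + q x) = c * L p + L q.

Lemma lin_poly0 N (L : ('rV[R]_N -> R) -> R) : lin_on_poly L -> L (fun=> 0) = 0.
Proof.
move=> lL; have := lL (-1) _ _ (is_poly_cst N 0) (is_poly_cst N 0).
by rewrite mulN1r addNr mulN1r addNr.
Qed.

Lemma lin_polyZ N (L : ('rV[R]_N -> R) -> R) c p : lin_on_poly L -> is_poly p ->
  L (fun x => c * p x) = c * L p.
Proof.
move=> lL ip; have := lL c _ _ ip (is_poly_cst N 0).
rewrite lin_poly0// addr0.
by under [X in L X = _ -> _]eq_fun do rewrite addr0.
Qed.

Lemma lin_polyD N (L : ('rV[R]_N -> R) -> R) p q : lin_on_poly L ->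
  is_poly p -> is_poly q -> L (fun x => p x + q x) = L p + L q.
Proof.
move=> lL ip iq; have := lL 1 _ _ ip iq; rewrite mul1r.
by under [X in L X = _ -> _]eq_fun do rewrite mul1r.
Qed.

Lemma lin_poly_sum N (L : ('rV[R]_N -> R) -> R) (I : Type) (r : seq I)
    (c : I -> R) (p : I -> 'rV[R]_N -> R) : lin_on_poly L ->
  (forall i, is_poly (p i)) ->
  L (fun x => \sum_(i <- r) c i * p i x) = \sum_(i <- r) c i * L (p i).
Proof.
move=> lL ip; elim: r => [|i r IH].
  rewrite big_nil -[RHS](lin_poly0 lL); congr L.
  by apply/funext => x; rewrite big_nil.
rewrite big_cons -IH -lL//.
  by congr L; apply/funext => x; rewrite big_cons.
apply: is_poly_sum => j _; exact: is_polyZ.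
Qed.

Lemma lin_poly_big N (L : ('rV[R]_N -> R) -> R) (I : Type) (r : seq I)
    (P : pred I) (p : I -> 'rV[R]_N -> R) : lin_on_poly L ->
  (forall i, is_poly (p i)) ->
  L (fun x => \sum_(i <- r | P i) p i x) = \sum_(i <- r | P i) L (p i).
Proof.
move=> lL ip; elim: r => [|i r IH].
  rewrite big_nil -[RHS](lin_poly0 lL); congr L.
  by apply/funext => x; rewrite big_nil.
rewrite big_cons -IH; case Pi: (P i); last first.
  by congr L; apply/funext => x; rewrite big_cons Pi.
rewrite -lin_polyD//; last by apply: is_poly_sum => j _.
by congr L; apply/funext => x; rewrite big_cons Pi.
Qed.

End PolynomialFunctions.
Arguments is_poly_monom {R N} a.
Arguments is_hpoly_monom {R N} a.
Arguments is_poly_cst {R N} c.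
Arguments is_poly_coord {R N} i.

(** * The intertwining operator on polynomials *)

Section OrbitRecursion.
Variable R : realType.

Lemma permrowE n (w : 'S_n) (x : 'rV[R]_n) i : permrow w x 0 i = x 0 (w i).
Proof. by rewrite mxE. Qed.

Lemma permrow1 n (x : 'rV[R]_n) : permrow 1%g x = x.
Proof. by apply/rowP => i; rewrite permrowE perm1. Qed.

Lemma swapc_permrow n (i j : 'I_n) (w : 'S_n) (x : 'rV[R]_n) :
  swapc i j (permrow w x) = permrow (tperm i j * w)%g x.
Proof. by apply/rowP => l; rewrite !mxE permM. Qed.

Lemma distinct_permrow n (w : 'S_n) (x : 'rV[R]_n) :
  distinct_coords x -> distinct_coords (permrow w x).
Proof.
move=> dx i j ij; rewrite !permrowE; apply: dx.
by rewrite (inj_eq perm_inj).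
Qed.

Lemma sum_pairsC n (F : 'I_n -> 'I_n -> R) :
  \sum_j \sum_(i | i != j) F i j = \sum_j \sum_(i | i != j) F j i.
Proof.
rewrite (exchange_big_dep xpredT)//=; apply: eq_bigr => j _.
by apply: eq_bigl => i; rewrite eq_sym.
Qed.

Lemma sum_pairs_sym n (F : 'I_n -> 'I_n -> R) :
  \sum_j \sum_(i | i != j) F i j =
  2^-1 * \sum_j \sum_(i | i != j) (F i j + F j i).
Proof.
under [in RHS]eq_bigr do rewrite big_split/=.
rewrite big_split/= -sum_pairsC; lra.
Qed.

(** At a permutation where |d a| is largest, multiplying the relation by the sign of d a makes every
    difference nonnegative, so |a| times the maximum is at most the right-hand side, which has lower
    degree. It serves twice: B = 1 bounds the moments of the representing measures, B = 0 proves
    uniqueness. *)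
Lemma orbit_bound N (k rho B : R) (x : 'S_N -> 'I_N -> R)
    (d : ('I_N -> nat) -> 'S_N -> R) :
  0 < k -> 0 <= rho -> (forall s j, `|x s j| <= rho) ->
  (forall s, `|d (fun=> 0%N) s| <= B) ->
  (forall a s, (\sum_i a i)%:R * d a s +
     k / 2 * \sum_j \sum_(i | i != j) (d a s - d a (tperm i j * s)%g) =
     \sum_j x s j * ((a j)%:R * d (decr j a) s)) ->
  forall a s, `|d a s| <= B * rho ^+ (\sum_i a i).
Proof.
move=> k0 r0 xr d0 drec a; move: {2}(\sum_i a i)%N (erefl (\sum_i a i)%N) => m.
have B0 : 0 <= B by apply: le_trans (d0 1%g).
elim: m a => [a a0 s|m IH a am s].
  rewrite a0 expr0 mulr1 (_ : a = fun=> 0%N)//; apply/funext => i.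
  by move/eqP: a0; rewrite sum_nat_eq0 => /forallP/(_ i)/= /eqP.
pose t := [arg max_(t > s) `|d a t|]%O.
have tmax u : `|d a u| <= `|d a t|.
  by rewrite /t; case: arg_maxP => //= v _; apply.
apply: le_trans (tmax s) _; rewrite am.
have m0 : 0 < m.+1%:R :> R by rewrite ltr0n.
rewrite -(ler_pM2l m0); pose e := Num.sg (d a t).
have := drec a t; rewrite am => /(congr1 (fun z => e * z)).
rewrite mulrDr mulrCA -[e * d a t]normrEsg => erec.
have pos : 0 <= e * (k / 2 * \sum_j \sum_(i | i != j) (d a t - d a (tperm i j * t)%g)).
  rewrite mulrCA; apply: mulr_ge0; first by rewrite divr_ge0// ltW.
  rewrite mulr_sumr sumr_ge0// => j _.
  rewrite mulr_sumr sumr_ge0// => i _; rewrite mulrBr -normrEsg subr_ge0.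
  apply: le_trans (tmax (tperm i j * t)%g); apply: le_trans (ler_norm _) _.
  rewrite normrM normr_sg; case: (_ != _); rewrite ?mul1r// mul0r//.
apply: (@le_trans _ _ (e * \sum_j x t j * ((a j)%:R * d (decr j a) t))); first lra.
apply: (@le_trans _ _ (\sum_j rho * ((a j)%:R * (B * rho ^+ m)))).
  rewrite mulr_sumr; apply: ler_sum => j _; apply: le_trans (ler_norm _) _.
  rewrite !normrM; apply: (@le_trans _ _ (1 * (`|x t j| * (`|(a j)%:R| * `|d (decr j a) t|)))).
    by apply: ler_wpM2r => //; rewrite normr_sg; case: (_ != _).
  rewrite mul1r; apply: ler_pM => //; rewrite normr_nat.
  (* [decr j a] has lower degree only if a j > 0; otherwise its coefficient is 0. *)
  have [->|aj] := posnP (a j); first by rewrite !mul0r.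
  apply: ler_wpM2l => //; have := IH (decr j a); rewrite sum_decr// am; exact.
rewrite -mulr_sumr -mulr_suml -natr_sum am exprS; lra.
Qed.

End OrbitRecursion.

(** * Supports of probability measures and their moments *)

Section RepresentingMeasures.
Variables (R : realType) (N : nat).

Definition far (M : R) : set (N.-tuple R) := [set t | exists i, M < `|tnth t i|].

Lemma far1_measurable (M : R) i : measurable [set t : N.-tuple R | M < `|tnth t i|].
Proof.
rewrite (_ : [set _ | _] = (fun t : N.-tuple R => `|tnth t i|) @^-1` `]M, +oo[%classic).
  rewrite -[X in measurable X]setTI.
  have mf : measurable_fun setT (fun t : N.-tuple R => `|tnth t i|).
    by apply: measurableT_comp => //; exact: measurable_tnth.
  exact: mf.
by apply/seteqP; split => t /=; rewrite in_itv/= andbT.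
Qed.

Lemma far_measurable (M : R) : measurable (far M).
Proof.
rewrite (_ : far M = \big[setU/set0]_(i < N) [set t | M < `|tnth t i|]).
  by apply: bigsetU_measurable => i _; exact: far1_measurable.
rewrite -bigcup_seq; apply/seteqP; split => [t [i it]|t [i _ it]]; last by exists i.
by exists i => //=; rewrite mem_index_enum.
Qed.

Lemma measurable_monom (a : 'I_N -> nat) :
  measurable_fun setT (fun t : N.-tuple R => monom a (tup2rV t)).
Proof.
apply: measurable_prod => i _; apply: measurable_funX.
rewrite (_ : (fun t => _) = (fun t : N.-tuple R => tnth t i)); last first.
  by apply/funext => t; rewrite mxE.
exact: measurable_tnth.
Qed.

Lemma measurable_is_poly (p : 'rV[R]_N -> R) : is_poly p ->
  measurable_fun setT (fun t : N.-tuple R => p (tup2rV t)).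
Proof.
case=> s ps; rewrite (_ : (fun t => _) =
    (fun t : N.-tuple R => \sum_(c <- s) c.2 * monom c.1 (tup2rV t))); last first.
  by apply/funext => t; rewrite ps.
by apply: measurable_sum => c; apply: measurable_funM => //; exact: measurable_monom.
Qed.

Lemma poly_bounded (p : 'rV[R]_N -> R) (M : R) : is_poly p ->
  exists C, forall x : 'rV[R]_N, (forall i, `|x 0 i| <= M) -> `|p x| <= C.
Proof.
case=> s ps; exists (\sum_(c <- s) `|c.2| * \prod_i M ^+ c.1 i) => x xM.
rewrite ps; apply: le_trans (ler_norm_sum _ _ _) _; apply: ler_sum => c _.
rewrite normrM; apply: ler_wpM2l => //; rewrite normr_prod; apply: ler_prod => i _.
by rewrite normr_ge0 normrX; apply: lerXn2r; rewrite ?nnegrE// (le_trans _ (xM i)).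
Qed.

Variable P : probability (N.-tuple R) R.

Lemma integrable_far (g : 'rV[R]_N -> R) (M C : R) :
  P (far M) = 0%E -> measurable_fun setT (fun t : N.-tuple R => g (tup2rV t)) ->
  (forall x : 'rV[R]_N, (forall i, `|x 0 i| <= M) -> `|g x| <= C) ->
  P.-integrable setT (EFin \o (fun t => g (tup2rV t))).
Proof.
move=> PM mg gC; apply/(negligible_integrable (far_measurable M)) => //.
  exact/measurable_EFinP.
apply: measurable_bounded_integrable => //.
- by apply: measurableD => //; exact: far_measurable.
- by rewrite (le_lt_trans (probability_le1 _ _)) ?ltry//; apply: measurableD => //; exact: far_measurable.
- exact: measurable_funS mg.
exists C; split; first exact: num_real.
move=> z Cz t [_ /= tM]; apply: le_trans (ltW Cz); apply: gC => i.
by rewrite mxE leNgt; apply/negP => h; apply: tM; exists i.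
Qed.

Lemma integrable_poly (p : 'rV[R]_N -> R) (M : R) : P (far M) = 0%E ->
  is_poly p -> P.-integrable setT (EFin \o (fun t => p (tup2rV t))).
Proof.
move=> PM ip; have [C pC] := poly_bounded M ip.
exact: integrable_far PM (measurable_is_poly ip) pC.
Qed.

Lemma Rintegral_far_le (g : 'rV[R]_N -> R) (M C : R) :
  P (far M) = 0%E -> measurable_fun setT (fun t : N.-tuple R => g (tup2rV t)) ->
  (forall x : 'rV[R]_N, (forall i, `|x 0 i| <= M) -> `|g x| <= C) ->
  `|Rintegral P setT (fun t => g (tup2rV t))| <= C.
Proof.
move=> PM mg gC; have ig := integrable_far PM mg gC.
have mf := far_measurable M.
rewrite /Rintegral (negligible_integral mf)//.
have iD : P.-integrable (setT `\` far M) (EFin \o (fun t => g (tup2rV t))).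
  by apply: integrableS ig => //; exact: measurableD.
have C0 : 0 <= C.
  have [[t tM]|fT] := pselect (exists t, ~ far M t); last first.
    have E : far M = setT.
      by apply/seteqP; split => t // _; apply: contrapT => nt; apply: fT; exists t.
    by move: PM; rewrite E probability_setT => /eqP; rewrite onee_eq0.
  apply: le_trans (gC (tup2rV t) _) => // i.
  by rewrite mxE leNgt; apply/negP => h; apply: tM; exists i.
apply: le_trans (le_normr_Rintegral _ iD) _; first exact: measurableD.
apply: (@le_trans _ _ (\int[P]_(t in setT `\` far M) C)).
  apply: le_Rintegral; first exact: measurableD.
  - rewrite (_ : _ \o _ = abse \o (EFin \o (fun t => g (tup2rV t)))); last first.
      by apply/funext.
    exact: integrable_abse.
  - by apply: finite_measure_integrable_cst; exact: measurableD.
  move=> t [_ tM]; apply: gC => i.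
  by rewrite mxE leNgt; apply/negP => h; apply: tM; exists i.
rewrite Rintegral_cst; last exact: measurableD.
rewrite -[leRHS]mulr1 ler_wpM2l// -lee_fin fineK ?probability_le1//.
  exact: measurableD.
exact: fin_num_measure (measurableD _ _).
Qed.

(** Chebyshev's inequality with even powers of one coordinate: r^(2m) P(|t_i| > r) <= rho^(2m) for
    every m, and (rho / r)^(2m) tends to 0. The radius M, of which nothing else is known, makes the
    moments integrable. *)
Lemma far_of_moments (M rho r : R) : P (far M) = 0%E -> 0 <= rho < r ->
  (forall a, Rintegral P setT (fun t => monom a (tup2rV t)) <=
     rho ^+ (\sum_i a i)) ->
  P (far r) = 0%E.
Proof.
move=> PM /andP[rho0 rhor] mom.
have r0 : 0 < r by exact: le_lt_trans rhor.
have farU : far r = \big[setU/set0]_(i < N) [set t | r < `|tnth t i|].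
  rewrite -bigcup_seq; apply/seteqP; split => [t [i it]|t [i _ it]]; last by exists i.
  by exists i => //=; rewrite mem_index_enum.
have far1 i : P [set t : N.-tuple R | r < `|tnth t i|] = 0%E.
  set A := [set _ | _]; have mA : measurable A by exact: far1_measurable.
  have PA : P A \is a fin_num by exact: fin_num_measure.
  rewrite -(fineK PA); congr (_%:E).
  have bnd m : fine (P A) <= (rho / r) ^+ (m.*2).
    pose a := fun j : 'I_N => if j == i then m.*2 else 0%N.
    have sa : (\sum_j a j = m.*2)%N.
      by rewrite (bigD1 i)//= /a eqxx big1 ?addn0// => j /negPf ->.
    have aE t : monom a (tup2rV t) = (tnth t i) ^+ m.*2 :> R.
      rewrite /monom (bigD1 i)//= /a eqxx big1 ?mulr1 ?mxE// => j /negPf ->.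
      by rewrite expr0.
    rewrite expr_div_n ler_pdivlMr ?exprn_gt0//.
    apply: le_trans (_ : _ <= Rintegral P setT (fun t => monom a (tup2rV t))) _; last first.
      by have := mom a; rewrite sa.
    have int := integrable_poly PM (is_poly_monom a).
    have intA : P.-integrable A (EFin \o (fun t => monom a (tup2rV t))).
      exact: integrableS int.
    apply: (@le_trans _ _ (\int[P]_(t in A) monom a (tup2rV t))).
      rewrite mulrC -Rintegral_cst//; apply: le_Rintegral => //.
        by apply: finite_measure_integrable_cst.
      move=> t /= rt; have even_ge0 : 0 <= tnth t i ^+ m.*2.
        by rewrite -mul2n exprM exprn_ge0// sqr_ge0.
      rewrite aE -[leRHS](ger0_norm even_ge0) normrX.
      by apply: lerXn2r; rewrite ?nnegrE ?(ltW r0)// ltW.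
    rewrite Rintegral_mkcond; apply: le_Rintegral => //.
      by rewrite -restrict_EFin; apply/integrable_restrict => //; rewrite setTI.
    move=> t _; rewrite patchE; case: ifPn => // _; rewrite aE.
    by rewrite -mul2n exprM exprn_ge0// sqr_ge0.
  apply/le_anti; rewrite fine_ge0// andbT.
  have q1 : `|(rho / r) ^+ 2| < 1.
    rewrite ger0_norm ?exprn_ge0 ?divr_ge0 ?(ltW r0)//.
    by rewrite exprn_ilt1// ?divr_ge0 ?(ltW r0)// ltr_pdivrMr ?mul1r.
  have cv := cvg_expr q1.
  rewrite -(cvg_lim _ cv)//; apply: limr_ge; first exact: cvgP cv.
  by apply: nearW => m; rewrite -exprM mul2n.
apply/negligibleP; first exact: far_measurable.
rewrite farU; elim/big_ind: _ => [|A B|i _]; first exact: negligible_set0.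
  exact: negligibleU.
by apply/negligibleP; [exact: far1_measurable|exact: far1].
Qed.

End RepresentingMeasures.

(** * Recursion and uniform support for the representing measures *)

Section IntertwiningOperator.
Variables (R : realType) (N : nat) (k : R).
Variable mu : 'rV[R]_N -> probability (N.-tuple R) R.
Hypothesis k_gt0 : 0 < k.
Hypothesis muV : is_Vk_measures k mu.

Lemma Vop_far lam : exists M, mu lam (far M) = 0%E.
Proof. by case: muV => /(_ lam). Qed.

Lemma Vop_lin lam : lin_on_poly (fun g => Vop mu g lam).
Proof.
move=> c p q ip iq; have [M muM] := Vop_far lam.
rewrite /Vop (RintegralD _ (f1 := fun t => c * p (tup2rV t)))//.
- by rewrite RintegralZl//; exact: integrable_poly muM ip.
- exact: integrable_poly muM (is_polyZ c ip).
- exact: integrable_poly muM iq.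
Qed.

Lemma Vop_cst lam c : Vop mu (fun=> c) lam = c.
Proof. rewrite /Vop Rintegral_cst//.
rewrite -[RHS]mulr1; congr (_ * _); rewrite -[RHS]/(fine 1%E).
by apply: congr1; exact: probability_setT. Qed.

Lemma Vop_hpoly m p : is_hpoly m p -> is_hpoly m (Vop mu p).
Proof. by case: muV => _ + _; apply. Qed.

Lemma Vop_polyE (s : seq (('I_N -> nat) * R)) p :
  (forall x, p x = \sum_(c <- s) c.2 * monom c.1 x) ->
  forall lam, Vop mu p lam = \sum_(c <- s) c.2 * Vop mu (monom c.1) lam.
Proof.
move=> ps lam.
rewrite -(lin_poly_sum s snd (Vop_lin lam) (fun c => is_poly_monom c.1)).
by congr (Vop mu _ _); apply/funext.
Qed.

Lemma Vop_poly p : is_poly p -> is_poly (Vop mu p).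
Proof.
case=> s ps; rewrite (_ : Vop mu p = fun lam => \sum_(c <- s) c.2 * Vop mu (monom c.1) lam).
  apply: is_poly_sum => c _; apply: is_polyZ.
  exact: is_hpoly_poly (Vop_hpoly (is_hpoly_monom c.1)).
by apply/funext; exact: Vop_polyE.
Qed.

Lemma Vop_dunkl p j lam : is_poly p -> distinct_coords lam ->
  Vop mu (pd j p) lam = pd j (Vop mu p) lam + k * \sum_(i < N | i != j)
    (Vop mu p lam - Vop mu p (swapc i j lam)) / (lam 0 j - lam 0 i).
Proof. by case: muV => _ _ + ip dl; move=> /(_ _ j _ ip dl). Qed.

Lemma swapcC i j (x : 'rV[R]_N) : swapc i j x = swapc j i x.
Proof. by apply/rowP => l; rewrite !mxE tpermC. Qed.

(** Multiply T_j V = V d_j by lam_j and sum over j. Euler's identity takes care of the derivatives;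
    among the reflections the pairs (i,j) and (j,i) combine through lam_j / (lam_j - lam_i) + lam_i
    / (lam_i - lam_j) = 1, which removes the denominators. *)
Lemma Vop_monom_rec (a : 'I_N -> nat) lam : distinct_coords lam ->
  (\sum_i a i)%:R * Vop mu (monom a) lam +
    k / 2 * \sum_j \sum_(i | i != j)
      (Vop mu (monom a) lam - Vop mu (monom a) (swapc i j lam)) =
  \sum_j lam 0 j * ((a j)%:R * Vop mu (monom (decr j a)) lam).
Proof.
move=> dl.
have E j : (a j)%:R * Vop mu (monom (decr j a)) lam =
    Vop mu (pd j (monom a)) lam.
  by rewrite pd_monom (lin_polyZ _ (Vop_lin lam))//; exact: is_poly_monom.
under [RHS]eq_bigr do rewrite E (Vop_dunkl _ (is_poly_monom a) dl).
rewrite -(euler_hpoly lam (Vop_hpoly (is_hpoly_monom a))).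
under [RHS]eq_bigr do rewrite mulrDr; rewrite big_split/=; congr (_ + _).
under [RHS]eq_bigr do rewrite mulrCA mulr_sumr.
rewrite -mulr_sumr [in RHS]sum_pairs_sym mulrA; congr (_ * _).
apply: eq_bigr => j _; apply: eq_bigr => i ij.
rewrite [swapc j i lam]swapcC.
have h1 : lam 0 j - lam 0 i != 0 by rewrite subr_eq0 dl// eq_sym.
have h2 : lam 0 i - lam 0 j != 0 by rewrite subr_eq0 dl.
by field; rewrite h1 h2.
Qed.

(* The maximum principle bounds the moments of [mu lam], hence its support, by
   the largest coordinate of [lam]. *)
Lemma Vop_far_unif lam (rho r : R) : distinct_coords lam ->
  (forall i, `|lam 0 i| <= rho) -> 0 <= rho < r -> mu lam (far r) = 0%E.
Proof.
move=> dl lrho /andP[rho0 rhor]; have [M muM] := Vop_far lam.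
apply: (far_of_moments muM (rho := rho)); first by rewrite rho0.
move=> a; have := @orbit_bound R N k rho 1 (fun s j => permrow s lam 0 j)
  (fun a s => Vop mu (monom a) (permrow s lam)) k_gt0 rho0.
have H s j : `|permrow s lam 0 j| <= rho by rewrite permrowE.
have H0 s : `|Vop mu (monom (fun=> 0%N)) (permrow s lam)| <= 1.
  rewrite (_ : monom _ = fun=> 1) ?Vop_cst ?normr1//; apply/funext => x.
  by rewrite /monom big1.
move=> /(_ H H0) B; have {B} := B _ a 1%g.
rewrite permrow1 mul1r => B; apply: le_trans (ler_norm _) _; apply: B => b s.
rewrite -Vop_monom_rec; last exact: distinct_permrow.
congr (_ + _ * _); apply: eq_bigr => j _; apply: eq_bigr => i _.
by rewrite swapc_permrow.
Qed.

End IntertwiningOperator.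

(** * Improper and iterated integrals *)

Section OneDimensionalIntegrals.
Variable R : realType.
Notation leb := (@lebesgue_measure R).
Implicit Types (a b al be C : R) (f F h H : R -> R).

(** The integrand may blow up at both ends, where only [F] is controlled. The fundamental theorem on
    compact subintervals passes to the limit by monotone convergence, which gives integrability as
    well. *)
Lemma ge0_FTC_oo a b f F : a < b ->
  (forall x, a < x < b -> 0 <= f x) ->
  (forall x, a < x < b -> {for x, continuous f}) ->
  (forall x, a < x < b -> is_derive x 1 F (f x)) ->
  F x @[x --> a^'+] --> F a -> F x @[x --> b^'-] --> F b ->
  leb.-integrable `]a, b[ (EFin \o f) /\
  Rintegral leb `]a, b[%classic f = F b - F a.
Proof.
move=> ab f0 fc Fd Fa Fb.
(* Starting at 3 gives e m < (b - a) / 2, hence u m < v m, already for m = 0. *)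
pose e (m : nat) := (b - a) / m.+3%:R.
have e0 m : 0 < e m by rewrite divr_gt0 ?subr_gt0.
have e3 m : e m < (b - a) / 2.
  by rewrite ltr_pM2l ?subr_gt0// ltf_pV2 ?posrE// ltr_nat.
have e_cvg : e m @[m --> \oo] --> 0.
  rewrite -(mulr0 (b - a)); apply: cvgMr.
  have := @cvg_harmonic R; rewrite -(cvg_shiftn 2).
  by under eq_fun do rewrite /harmonic addn2.
pose u m := a + e m; pose v m := b - e m.
have uab m : a < u m < b by have := e0 m; have := e3 m; rewrite /u; lra.
have vab m : a < v m < b by have := e0 m; have := e3 m; rewrite /v; lra.
have uv m : u m < v m by have := e3 m; rewrite /u /v; lra.
have itv_sub m : `[u m, v m]%classic `<=` `]a, b[%classic.
  move=> x /=; rewrite !in_itv/= => /andP[ux xv].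
  by have /andP[] := uab m; have /andP[] := vab m; lra.
have mf : measurable_fun `]a, b[ f.
  apply: open_continuous_measurable_fun; first exact: interval_open.
  by move=> x; rewrite inE/= in_itv/=; exact: fc.
have FTC m : (\int[leb]_(x in `[u m, v m]) (f x)%:E = (F (v m) - F (u m))%:E)%E.
  have Fin x : x \in `]u m, v m[ -> a < x < b.
    rewrite in_itv/= => /andP[ux xv].
    by have /andP[] := uab m; have /andP[] := vab m; lra.
  rewrite (@continuous_FTC2 _ f F)//.
  - apply: continuous_in_subspaceT => x; rewrite inE => /itv_sub/=.
    by rewrite in_itv/=; exact: fc.
  - split.
    + by move=> x /Fin/Fd[].
    + apply: cvg_at_right_filter; apply: differentiable_continuous.
      by apply/derivable1_diffP; case: (Fd _ (uab m)).
    + apply: cvg_at_left_filter; apply: differentiable_continuous.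
      by apply/derivable1_diffP; case: (Fd _ (vab m)).
  - by move=> x /Fin/Fd[_ <-]; rewrite derive1E.
have cvg1 : (\int[leb]_(x in `[u m, v m]) (f x)%:E)%E @[m --> \oo] -->
    (\int[leb]_(x in \bigcup_m `[u m, v m]%classic) (f x)%:E)%E.
  apply: ge0_nondecreasing_set_cvg_integral => //.
  - move=> m p mp; rewrite subsetEset => x /=; rewrite !in_itv/=.
    have : e p <= e m by rewrite ler_pM2l ?subr_gt0// lef_pV2 ?posrE// ler_nat !ltnS.
    by rewrite /u /v; lra.
  - by move=> m; apply/measurable_EFinP; exact: measurable_funS mf.
  - by move=> m x /itv_sub/=; rewrite in_itv/= lee_fin => /f0.
have cup : \bigcup_m `[u m, v m]%classic = `]a, b[%classic.
  apply/seteqP; split => [x [m _ /itv_sub]//|x /=]; rewrite in_itv/= => /andP[ax xb].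
  have [m _ /= em] : \forall m \near \oo, e m < Num.min (x - a) (b - x).
    apply: (cvgr_lt 0) => //; rewrite lt_min; lra.
  exists m => //=; have := em m (leqnn m).
  by rewrite lt_min in_itv/= /u /v; lra.
have uvlim : (F (v m) - F (u m)) @[m --> \oo] --> F b - F a.
  apply: cvgB.
  - move/cvg_at_leftP : Fb; apply; split; first by move=> m; case/andP: (vab m).
    by rewrite -[X in _ --> X]subr0; apply: cvgB => //; exact: cvg_cst.
  - move/cvg_at_rightP : Fa; apply; split; first by move=> m; case/andP: (uab m).
    by rewrite -[X in _ --> X]addr0; apply: cvgD => //; exact: cvg_cst.
have intE : (\int[leb]_(x in `]a, b[) (f x)%:E = (F b - F a)%:E)%E.
  apply: (cvg_unique _ (F := (\int[leb]_(x in `[u m, v m]) (f x)%:E)%E @[m --> \oo])).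
  - exact: ereal_hausdorff.
  - by rewrite -cup; exact: cvg1.
  - by rewrite /= (eq_cvg _ _ FTC); apply/cvg_EFin; [exact: nearW|exact: uvlim].
have fi : leb.-integrable `]a, b[ (EFin \o f).
  apply/integrableP; split; first exact/measurable_EFinP.
  rewrite [ltLHS](_ : _ = (F b - F a)%:E) ?ltry// -intE; apply: eq_integral.
  by move=> x; rewrite inE/= in_itv/= => /f0 fx0; rewrite /= ger0_norm.
by split => //; rewrite /Rintegral intE.
Qed.

(** Domination makes f + h nonnegative with antiderivative F + H; the nonnegative case applies to f
    + h and to h, and f is their difference. *)
Lemma FTC_oo a b f F h H : a < b ->
  (forall x, a < x < b -> `|f x| <= h x) ->
  (forall x, a < x < b -> {for x, continuous h}) ->
  (forall x, a < x < b -> is_derive x 1 H (h x)) ->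
  H x @[x --> a^'+] --> H a -> H x @[x --> b^'-] --> H b ->
  (forall x, a < x < b -> {for x, continuous f}) ->
  (forall x, a < x < b -> is_derive x 1 F (f x)) ->
  F x @[x --> a^'+] --> F a -> F x @[x --> b^'-] --> F b ->
  leb.-integrable `]a, b[ (EFin \o f) /\
  Rintegral leb `]a, b[%classic f = F b - F a.
Proof.
move=> ab fh hc Hd Ha Hb fc Fd Fa Fb.
have [hi hE] : leb.-integrable `]a, b[ (EFin \o h) /\
    Rintegral leb `]a, b[%classic h = H b - H a.
  by apply: ge0_FTC_oo => // x /fh; apply: le_trans.
have [gi gE] : leb.-integrable `]a, b[ (EFin \o (fun x => f x + h x)) /\
    Rintegral leb `]a, b[%classic (fun x => f x + h x) = (F b + H b) - (F a + H a).
  apply: (@ge0_FTC_oo a b (fun x => f x + h x) (fun x => F x + H x)) => //.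
  - by move=> x /fh; rewrite ler_norml; lra.
  - by move=> x xab; apply: cvgD; [exact: fc|exact: hc].
  - by move=> x xab; apply: is_deriveD; [exact: Fd|exact: Hd].
  - exact: cvgD.
  - exact: cvgD.
have fE : f = (fun x => (f x + h x) - h x) by apply/funext => x; rewrite addrK.
split; last by rewrite fE RintegralB// gE hE; lra.
rewrite fE; exact: (integrableB _ gi hi).
Qed.

Lemma continuous_powR_norm al : 0 < al -> continuous (fun x : R => `|x| `^ al).
Proof.
move=> al0 x; have [->|x0] := eqVneq x 0.
  rewrite /continuous_at normr0 powR0 ?gt_eqF//.
  apply/cvgr0Pnorm_lt => e e0.
  near=> y; rewrite ger0_norm ?powR_ge0//.
  have -> : e = (e `^ al^-1) `^ al by rewrite -powRrM mulVf ?gt_eqF// powRr1// ltW.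
  apply: gt0_ltr_powR; rewrite ?nnegrE ?powR_ge0//.
  near: y; apply: (cvgr0_norm_lt id) => //; exact: powR_gt0.
apply: (@continuous_comp _ _ _ (fun y : R => `|y|) (fun y => y `^ al)).
  exact: (@norm_continuous _ R).
apply: differentiable_continuous; apply/derivable1_diffP.
have x1 : 0 < `|x| by rewrite normr_gt0.
by case: (is_derive1_powR al x1).
Unshelve. all: by end_near. Qed.

(* Powers at both ends dominate every integrand met below; their antiderivative
   is explicit. *)
Definition edge_bound a b al be C x :=
  C * ((x - a) `^ (al - 1) + (b - x) `^ (be - 1)).

(** The absolute values make it continuous on the whole line, so its one-sided limits at a and b are
    its values there. *)
Definition edge_prim a b al be C x :=
  C * (`|x - a| `^ al / al - `|b - x| `^ be / be).

Lemma is_derive_powR_comp (g : R -> R) (dg al x : R) : 0 < g x ->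
  is_derive x 1 g dg ->
  is_derive x 1 (fun y => g y `^ al) (al * g x `^ (al - 1) * dg).
Proof.
move=> gx gd; have := is_derive1_powR al gx => pd.
by apply: (is_derive_eq (is_derive1_comp pd gd)); rewrite mulrC.
Qed.

Lemma continuous_powR_comp (g : R -> R) al x : 0 < g x ->
  {for x, continuous g} -> {for x, continuous (fun y => g y `^ al)}.
Proof.
move=> gx gc; apply: (@continuous_comp _ _ _ g (fun y => y `^ al)) => //.
apply: differentiable_continuous; apply/derivable1_diffP.
by case: (is_derive1_powR al gx).
Qed.

Lemma continuous_edge_prim a b al be C : 0 < al -> 0 < be ->
  continuous (edge_prim a b al be C).
Proof.
move=> al0 be0 x; rewrite /edge_prim; apply: cvgM; first exact: cvg_cst.
apply: cvgB; apply: cvgMl.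
  apply: (@continuous_comp _ _ _ (fun x => x - a) (fun x => `|x| `^ al)).
    by apply: cvgB; [exact: cvg_id|exact: cvg_cst].
  exact: continuous_powR_norm.
apply: (@continuous_comp _ _ _ (fun x => b - x) (fun x => `|x| `^ be)).
  by apply: cvgB; [exact: cvg_cst|exact: cvg_id].
exact: continuous_powR_norm.
Qed.

Lemma is_derive_edge_prim a b al be C x : 0 < al -> 0 < be -> a < x < b ->
  is_derive x 1 (edge_prim a b al be C) (edge_bound a b al be C x).
Proof.
move=> al0 be0 /andP[ax xb].
have d1 : is_derive x 1 (fun y => (y - a) `^ al / al) ((x - a) `^ (al - 1)).
  have h : is_derive x 1 (fun y => y - a) 1.
    by apply: (is_derive_eq (is_deriveB (is_derive_id x 1) (is_derive_cst a x 1))); rewrite subr0.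
  have gx : 0 < x - a by rewrite subr_gt0.
  have := is_deriveZ al^-1 (is_derive_powR_comp (g := fun y => y - a) al gx h).
  rewrite (_ : _ \*: _ = (fun y => (y - a) `^ al / al)); last first.
    by apply/funext => y; rewrite /= mulrC.
  move/is_derive_eq; apply; rewrite /GRing.scale/= mulr1 mulrA mulVf ?mul1r//.
  by rewrite gt_eqF.
have d2 : is_derive x 1 (fun y => (b - y) `^ be / be) (- (b - x) `^ (be - 1)).
  have h : is_derive x 1 (fun y => b - y) (-1).
    by apply: (is_derive_eq (is_deriveB (is_derive_cst b x 1) (is_derive_id x 1))); rewrite sub0r.
  have gx : 0 < b - x by rewrite subr_gt0.
  have := is_deriveZ be^-1 (is_derive_powR_comp (g := fun y => b - y) be gx h).
  rewrite (_ : _ \*: _ = (fun y => (b - y) `^ be / be)); last first.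
    by apply/funext => y; rewrite /= mulrC.
  move/is_derive_eq; apply; rewrite /GRing.scale/= mulrN1 mulrN mulrA mulVf ?mul1r//.
  by rewrite gt_eqF.
have d : is_derive x 1 (fun y => C * ((y - a) `^ al / al - (b - y) `^ be / be))
    (edge_bound a b al be C x).
  by apply: (is_derive_eq (is_deriveZ C (is_deriveB d1 d2))); rewrite opprK.
apply: near_eq_is_derive d; near=> y; rewrite /edge_prim !ger0_norm// subr_ge0 ltW//.
  by near: y; exact: lt_nbhsl.
by near: y; exact: lt_nbhsr.
Unshelve. all: by end_near. Qed.

Lemma continuous_edge_bound a b al be C x : a < x < b ->
  {for x, continuous (edge_bound a b al be C)}.
Proof.
move=> /andP[ax xb].
have c1 : {for x, continuous (fun y => (y - a) `^ (al - 1))}.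
  apply: (continuous_powR_comp (g := fun y => y - a)); rewrite ?subr_gt0//.
  by apply: cvgB; [exact: cvg_id|exact: cvg_cst].
have c2 : {for x, continuous (fun y => (b - y) `^ (be - 1))}.
  apply: (continuous_powR_comp (g := fun y => b - y)); rewrite ?subr_gt0//.
  by apply: cvgB; [exact: cvg_cst|exact: cvg_id].
exact: (cvgM (cvg_cst C) (cvgD c1 c2)).
Qed.

Lemma FTC_edge a b al be C f F : a < b -> 0 < al -> 0 < be ->
  (forall x, a < x < b -> `|f x| <= edge_bound a b al be C x) ->
  (forall x, a < x < b -> {for x, continuous f}) ->
  (forall x, a < x < b -> is_derive x 1 F (f x)) ->
  F x @[x --> a^'+] --> F a -> F x @[x --> b^'-] --> F b ->
  leb.-integrable `]a, b[ (EFin \o f) /\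
  Rintegral leb `]a, b[%classic f = F b - F a.
Proof.
move=> ab al0 be0 fh fc Fd Fa Fb.
apply: (FTC_oo (h := edge_bound a b al be C) (H := edge_prim a b al be C)
  ab fh _ _ _ _ fc Fd Fa Fb).
- by move=> x; exact: continuous_edge_bound.
- by move=> x; exact: is_derive_edge_prim.
- by apply: cvg_at_right_filter; exact: continuous_edge_prim.
- by apply: cvg_at_left_filter; exact: continuous_edge_prim.
Qed.

Lemma integrable_edge_bound a b al be C : a < b -> 0 < al -> 0 < be -> 0 <= C ->
  leb.-integrable `]a, b[ (EFin \o edge_bound a b al be C).
Proof.
move=> ab al0 be0 C0.
apply: (FTC_edge (C := C) (F := edge_prim a b al be C) ab al0 be0 _ _ _ _ _).1.
- move=> x _; rewrite ger0_norm// /edge_bound mulr_ge0// addr_ge0 ?powR_ge0//.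
- by move=> x; exact: continuous_edge_bound.
- by move=> x; exact: is_derive_edge_prim.
- by apply: cvg_at_right_filter; exact: continuous_edge_prim.
- by apply: cvg_at_left_filter; exact: continuous_edge_prim.
Qed.

Lemma integrable_edge a b al be C f : a < b -> 0 < al -> 0 < be -> 0 <= C ->
  (forall x, a < x < b -> `|f x| <= edge_bound a b al be C x) ->
  (forall x, a < x < b -> {for x, continuous f}) ->
  leb.-integrable `]a, b[ (EFin \o f).
Proof.
move=> ab al0 be0 C0 fh fc.
apply: le_integrable (integrable_edge_bound ab al0 be0 C0) => //.
  apply/measurable_EFinP; apply: open_continuous_measurable_fun.
    exact: interval_open.
  by move=> x; rewrite inE/= in_itv/=; exact: fc.
move=> x /=; rewrite in_itv/= lee_fin => /fh fx.
exact: le_trans fx (ler_norm _).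
Qed.

End OneDimensionalIntegrals.

Lemma integrable_sum_seq d (T : measurableType d) (R : realType)
    (mu : {measure set T -> \bar R}) (A : set T) (I : Type) (s : seq I)
    (c : I -> R) (f : I -> T -> R) : measurable A ->
  (forall t, List.In t s -> mu.-integrable A (EFin \o f t)) ->
  mu.-integrable A (EFin \o (fun x => \sum_(t <- s) c t * f t x)) /\
  Rintegral mu A (fun x => \sum_(t <- s) c t * f t x) =
  \sum_(t <- s) c t * Rintegral mu A (f t).
Proof.
move=> mA; elim: s => [_|t s IH sint].
  rewrite big_nil (_ : (fun x => _) = cst 0); last first.
    by apply/funext => x; rewrite big_nil.
  by split; [exact: integrable0|rewrite Rintegral_cst// mul0r].
have [si sE] := IH (fun u us => sint u (or_intror us)).
have ti := sint t (or_introl erefl).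
rewrite (_ : (fun x => \sum_(t <- t :: s) _) =
    (fun x => c t * f t x + \sum_(t <- s) c t * f t x)); last first.
  by apply/funext => x; rewrite big_cons.
have cti : mu.-integrable A (EFin \o (fun x => c t * f t x)).
  exact: (integrableZl mA (c t) ti).
split; first exact: (integrableD mA cti si).
by rewrite RintegralD// RintegralZl// sE big_cons.
Qed.

(** * Iterated integrals of sums of products and of their limits *)

Section IteratedIntegrals.
Variable R : realType.
Notation leb := (@lebesgue_measure R).
Variables (a b : nat -> R) (om : nat -> R -> R).

Definition in_cell m (nu : nat -> R) := forall i, (i < m)%N -> a i < nu i < b i.

(** The functions whose iterated integral is computed directly. Points are functions on nat, as in
    [iint]; only the first m coordinates are read. *)
Definition prodsum m (s : seq (R * (nat -> R -> R))) (nu : nat -> R) :=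
  \sum_(t <- s) t.1 * \prod_(i < m) t.2 i (nu i).

Definition prodsum_int m (s : seq (R * (nat -> R -> R))) :=
  \sum_(t <- s) t.1 * \prod_(i < m) Rintegral leb `]a i, b i[%classic (t.2 i).

Definition factors_int m (s : seq (R * (nat -> R -> R))) :=
  forall t : R * (nat -> R -> R), List.In t s ->
    forall i, (i < m)%N -> leb.-integrable `]a i, b i[ (EFin \o t.2 i).

Lemma Rintegral_itv_ccoo (A B : R) (f : R -> R) :
  measurable_fun `]A, B[ f ->
  Rintegral leb `[A, B]%classic f = Rintegral leb `]A, B[%classic f.
Proof.
move=> mf; rewrite /Rintegral; congr fine; apply: integral_itv_bndoo.
exact/measurable_EFinP.
Qed.

(** At each stage the inner integral must be shown measurable in the outer variable. Approximability
    of [g] to every precision, relative to the weight, provides this: the inner integral is a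
    pointwise limit of the one-variable combinations [L]. The error bound for the given [e] and [s]
    is then integrated one variable at a time. *)
Lemma iint_approx m (g : (nat -> R) -> R) :
  (forall i, (i < m)%N -> a i < b i) ->
  (forall i x, (i < m)%N -> a i < x < b i -> 0 < om i x) ->
  (forall i, (i < m)%N -> leb.-integrable `]a i, b i[ (EFin \o om i)) ->
  (forall e : R, 0 < e -> exists2 s, factors_int m s &
     forall nu, in_cell m nu ->
       `|g nu - prodsum m s nu| <= e * \prod_(i < m) om i (nu i)) ->
  forall (e : R) s, 0 <= e -> factors_int m s ->
  (forall nu, in_cell m nu ->
     `|g nu - prodsum m s nu| <= e * \prod_(i < m) om i (nu i)) ->
  `|iint m a b g - prodsum_int m s| <=
     e * \prod_(i < m) Rintegral leb `]a i, b i[%classic (om i).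
Proof.
elim: m g => [|m IH] g ab om0 omi gapp e s e0 sint ges.
  have -> : prodsum_int 0 s = prodsum 0 s (fun=> 0).
    by apply: eq_bigr => t _; rewrite !big_ord0.
  by have := ges (fun=> 0); rewrite !big_ord0; apply.
set A := a m; set B := b m; have AB : A < B by exact: ab.
pose upd (nu : nat -> R) x := fun i => if i == m then x else nu i.
pose G x := iint m a b (fun nu => g (upd nu x)).
pose K := \prod_(i < m) Rintegral leb `]a i, b i[%classic (om i).
pose L (s : seq (R * (nat -> R -> R))) x := \sum_(t <- s)
  (t.1 * \prod_(i < m) Rintegral leb `]a i, b i[%classic (t.2 i)) * t.2 m x.
have K0 : 0 <= K.
  apply: prodr_ge0 => i _; apply: Rintegral_ge0 => x /=; rewrite in_itv/= => xi.
  by apply/ltW/om0 => //; exact/leqW/ltn_ord.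
have updP x nu : A < x < B -> in_cell m nu -> in_cell m.+1 (upd nu x).
  move=> xAB nuP i; rewrite ltnS leq_eqVlt /upd => /predU1P[->|im]; first by rewrite eqxx.
  by rewrite ltn_eqF//; exact: nuP.
have prodU (u : nat -> R -> R) nu x :
    \prod_(i < m.+1) u i (upd nu x i) = (\prod_(i < m) u i (nu i)) * u m x.
  rewrite big_ord_recr/= /upd eqxx; congr (_ * _); apply: eq_bigr => i _.
  by rewrite ltn_eqF.
pose sx (s : seq (R * (nat -> R -> R))) x := [seq (t.1 * t.2 m x, t.2) | t <- s].
have sxE s' nu x : prodsum m.+1 s' (upd nu x) = prodsum m (sx s' x) nu.
  rewrite /prodsum big_map; apply: eq_bigr => t _ /=.
  by rewrite prodU mulrA mulrAC.
have sxI s' x : prodsum_int m (sx s' x) = L s' x.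
  rewrite /prodsum_int big_map; apply: eq_bigr => t _ /=; exact: mulrAC.
have sx_int s' x : factors_int m.+1 s' -> factors_int m (sx s' x).
  move=> s'i t /(List.in_map_iff _ _ _)[t' [<- t's]] i im /=.
  by apply: s'i => //; exact: leqW.
have step e' s' x : A < x < B -> 0 <= e' -> factors_int m.+1 s' ->
    (forall nu, in_cell m.+1 nu ->
      `|g nu - prodsum m.+1 s' nu| <= e' * \prod_(i < m.+1) om i (nu i)) ->
    `|G x - L s' x| <= e' * K * om m x.
  move=> xAB e'0 s'i gs'; have omx : 0 < om m x by exact: om0.
  rewrite -sxI mulrAC; apply: IH => //.
  - by move=> i im; apply: ab; exact: leqW.
  - by move=> i y im; apply: om0; exact: leqW.
  - by move=> i im; apply: omi; exact: leqW.
  (* On the slice at [x] the last weight is the constant [om m x], so precision [e1] on the slice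
     comes from precision [e1 / om m x] for [g]. *)
  - move=> e1 e10; have [|s1 s1i gs1] := gapp (e1 / om m x); first by rewrite divr_gt0.
    exists (sx s1 x); first exact: sx_int.
    move=> nu /(updP _ _ xAB)/gs1; rewrite sxE prodU => h.
    by rewrite [_ * om m x]mulrC mulrA divfK ?gt_eqF in h.
  - by rewrite mulr_ge0// ltW.
  - exact: sx_int.
  - by move=> nu /(updP _ _ xAB)/gs'; rewrite sxE prodU mulrA mulrAC.
have Li s' : factors_int m.+1 s' ->
    leb.-integrable `]A, B[ (EFin \o L s') /\
    Rintegral leb `]A, B[%classic (L s') = prodsum_int m.+1 s'.
  move=> s'i; have [//|t ts|? ->] := @integrable_sum_seq _ _ R leb `]A, B[%classic _ s'
    (fun t => t.1 * \prod_(i < m) Rintegral leb `]a i, b i[%classic (t.2 i))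
    (fun t => t.2 m).
    exact: s'i.
  split => //; apply: eq_bigr => t _.
  by rewrite big_ord_recr/= mulrA.
have mG : measurable_fun `]A, B[ G.
  have app (j : nat) : {s' | factors_int m.+1 s' & forall nu, in_cell m.+1 nu ->
      `|g nu - prodsum m.+1 s' nu| <= j.+1%:R^-1 * \prod_(i < m.+1) om i (nu i)}.
    by apply: cid2; apply: gapp; rewrite invr_gt0.
  apply: (measurable_fun_cvg (h := fun j => L (s2val (app j)))) => //.
    by move=> j; case: (app j) => s' s'i ? /=; have [/measurable_int/measurable_EFinP] := Li _ s'i.
  move=> x /=; rewrite in_itv/= => xAB.
  apply/cvgrPdist_le => e1 e10.
  (* The added 1 keeps the divisor positive, since only K >= 0 is at hand. *)
  have c0 : 0 < K * om m x + 1 by rewrite ltr_wpDl// mulr_ge0// ltW// om0.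
  have ec0 : 0 < e1 / (K * om m x + 1) by exact: divr_gt0.
  near=> j.
  case: (app j) => s' s'i gs' /=.
  apply: le_trans (step _ _ _ xAB _ s'i gs') _; first by rewrite invr_ge0.
  have jc : j.+1%:R^-1 < e1 / (K * om m x + 1).
    by near: j; exact: (near_infty_natSinv_lt (PosNum ec0)).
  rewrite -mulrA; apply: (@le_trans _ _ (j.+1%:R^-1 * (K * om m x + 1))).
    by rewrite ler_wpM2l ?invr_ge0// lerDl.
  by rewrite -ler_pdivlMr// ltW.
have omi' : leb.-integrable `]A, B[ (EFin \o om m) by exact: omi.
have eKi : leb.-integrable `]A, B[ (EFin \o (fun x => e * K * om m x)).
  exact: (integrableZl _ (e * K) omi').
have [Lsi LsE] := Li _ sint.
have GL x : A < x < B -> `|G x - L s x| <= e * K * om m x.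
  by move=> xAB; exact: step.
have iD : leb.-integrable `]A, B[ (EFin \o (fun x => G x - L s x)).
  apply: le_integrable eKi => //.
    apply/measurable_EFinP; apply: measurable_funB => //.
    by have /measurable_int/measurable_EFinP := Lsi.
  move=> x /=; rewrite in_itv/= lee_fin => /GL h.
  exact: le_trans h (ler_norm _).
have iG : leb.-integrable `]A, B[ (EFin \o G).
  rewrite (_ : G = fun x => (G x - L s x) + L s x); first exact: (integrableD _ iD Lsi).
  by apply/funext => x; rewrite subrK.
have -> : iint m.+1 a b g = Rintegral leb `]A, B[%classic G.
  by rewrite -Rintegral_itv_ccoo.
rewrite -LsE -RintegralB//; apply: le_trans (le_normr_Rintegral _ iD) _ => //.
rewrite big_ord_recr/= mulrA -/K -/A -/B -RintegralZl//.
apply: le_Rintegral => //.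
exact: (integrable_abse iD).
Unshelve. all: by end_near. Qed.

End IteratedIntegrals.

(** The approximation lemma with weight 1 and error 0, [s] being itself an approximation to every
    precision. *)
Lemma iint_prodsum (R : realType) (a b : nat -> R) m (g : (nat -> R) -> R) s :
  (forall i, (i < m)%N -> a i < b i) -> factors_int a b m s ->
  (forall nu, in_cell a b m nu -> g nu = prodsum m s nu) ->
  iint m a b g = prodsum_int a b m s.
Proof.
move=> ab si gs.
have gs' (e : R) nu : 0 <= e -> in_cell a b m nu ->
    `|g nu - prodsum m s nu| <= e * \prod_(i < m) 1.
  by move=> e0 /gs ->; rewrite subrr normr0 big1// mulr1.
have := @iint_approx R a b (fun _ _ => 1) m g ab (fun _ _ _ _ => ltr01) _ _ 0 s
  (lexx _) si (fun nu => gs' 0 nu (lexx _)).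
rewrite mul0r normr_le0 subr_eq0 => /(_ _ _)/eqP; apply.
- move=> i im; apply: measurable_bounded_integrable => //.
    by rewrite /= lebesgue_measure_itv; case: ifP => _; rewrite ?ltry// -EFinD ltry.
  by exists 1; split; [exact: num_real|move=> z z1 t _ /=; rewrite normr1 ltW].
- by move=> e e0; exists s => // nu; apply: gs'; exact: ltW.
Qed.

(** * Integration by parts against powers of a polynomial *)

Section WeightedIntegrals.
Variable R : realType.
Notation leb := (@lebesgue_measure R).
Implicit Types (P Phi : {poly R}) (a b k sg C : R).

Lemma horner_bounded P a b :
  exists2 C, 0 <= C & forall x, a < x < b -> `|P.[x]| <= C.
Proof.
pose M := Num.max `|a| `|b|.
exists (\sum_(i < size P) `|P`_i| * M ^+ i).
  by apply: sumr_ge0 => i _; rewrite mulr_ge0// exprn_ge0// le_max normr_ge0.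
move=> x /andP[ax xb]; rewrite horner_coef.
apply: le_trans (ler_norm_sum _ _ _) _; apply: ler_sum => i _.
rewrite normrM ler_wpM2l// normrX lerXn2r ?nnegrE ?le_max ?normr_ge0//.
have [x0|x0] := ler0P x.
  apply/orP; left; rewrite ler0_norm; lra.
apply/orP; right; rewrite ger0_norm; lra.
Qed.

Lemma continuous_weight P Phi k x : Phi.[x] != 0 ->
  {for x, continuous (fun y => P.[y] * `|Phi.[y]| `^ k)}.
Proof.
move=> Px; apply: (@cvgM _ _ _ _ (horner P) (fun y => `|Phi.[y]| `^ k)).
  exact: continuous_horner.
apply: (continuous_powR_comp (g := fun y => `|Phi.[y]|)); first by rewrite normr_gt0.
apply: (@continuous_comp _ _ _ (horner Phi) (fun y : R => `|y|)).
  exact: continuous_horner.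
exact: (@norm_continuous _ R).
Qed.

(* The integrand is the derivative of [P * Phi * |Phi|^(k-1)]. *)
Lemma FTC_weight P Phi a b k sg C : a < b -> 0 < k -> 0 <= C -> sg * sg = 1 ->
  (forall x, a < x < b -> 0 < sg * Phi.[x]) ->
  (forall x, a < x < b -> `|Phi.[x]| `^ (k - 1) <= edge_bound a b k k C x) ->
  leb.-integrable `]a, b[ (EFin \o (fun x => P.[x] * `|Phi.[x]| `^ (k - 1))) /\
  Rintegral leb `]a, b[%classic (fun x => (P^`() * Phi + k *: (P * Phi^`())).[x]
     * `|Phi.[x]| `^ (k - 1)) =
  sg * (P.[b] * `|Phi.[b]| `^ k - P.[a] * `|Phi.[a]| `^ k).
Proof.
move=> ab k0 C0 sg2 sgPhi PhiC.
have Phi0 x : a < x < b -> Phi.[x] != 0.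
  by move=> /sgPhi; apply: contraTneq => ->; rewrite mulr0 ltxx.
have normPhi x : a < x < b -> `|Phi.[x]| = sg * Phi.[x].
  move=> xab; rewrite -(gtr0_norm (sgPhi x xab)) normrM.
  suff -> : `|sg| = 1 by rewrite mul1r.
  have : `|sg| ^+ 2 = 1 ^+ 2 by rewrite -normrX expr2 sg2 normr1 expr1n.
  by move/eqP; rewrite eqrXn2// => /eqP.
have bnd Q x (D : R) : (`|Q.[x]| <= D) -> 0 <= D -> a < x < b ->
    `|Q.[x] * `|Phi.[x]| `^ (k - 1)| <= edge_bound a b k k (D * C) x.
  move=> QD D0 xab; rewrite normrM (ger0_norm (powR_ge0 _ _)).
  rewrite /edge_bound -mulrA; apply: ler_pM => //; exact: PhiC.
split.
  have [D D0 PD] := horner_bounded P a b.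
  apply: (@integrable_edge _ a b k k (D * C)) => //; first exact: mulr_ge0.
    by move=> x xab; apply: bnd => //; exact: PD.
  by move=> x /Phi0; exact: continuous_weight.
have [D D0 QD] := horner_bounded (P^`() * Phi + k *: (P * Phi^`())) a b.
have Fc : continuous (fun x => sg * (P.[x] * `|Phi.[x]| `^ k)).
  move=> x; apply: cvgMr; apply: (@cvgM _ _ _ _ (horner P) (fun y => `|Phi.[y]| `^ k)).
    exact: continuous_horner.
  apply: (@continuous_comp _ _ _ (horner Phi) (fun y : R => `|y| `^ k)).
    exact: continuous_horner.
  exact: continuous_powR_norm.
rewrite (FTC_edge (a := a) (b := b) (al := k) (be := k) (C := D * C)
  (F := fun x => sg * (P.[x] * `|Phi.[x]| `^ k)) ab k0 k0 _ _ _ _ _).2 ?mulrBr//.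
- by move=> x xab; apply: bnd => //; exact: QD.
- by move=> x /Phi0; exact: continuous_weight.
- move=> x xab.
  have d1 : is_derive x 1 (fun y => sg * Phi.[y]) (sg * Phi^`().[x]).
    exact: (is_deriveZ sg (is_derive_poly Phi x)).
  have d2 := is_derive_powR_comp (g := fun y => sg * Phi.[y]) k (sgPhi x xab) d1.
  have d3 : is_derive x 1 (fun y => sg * (P.[y] * (sg * Phi.[y]) `^ k))
     ((P^`() * Phi + k *: (P * Phi^`())).[x] * `|Phi.[x]| `^ (k - 1)).
    apply: (is_derive_eq (is_deriveZ sg (is_deriveM (is_derive_poly P x) d2))).
    rewrite /GRing.scale/= !(hornerD, hornerM, hornerZ) normPhi//.
    rewrite -[in LHS](mulr_powRB1 (x := sg * Phi.[x]) _ k0); last exact/ltW/sgPhi.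
    set w := powR _ (k - 1).
    transitivity ((sg * sg) * (P^`().[x] * Phi.[x] + k * (P.[x] * Phi^`().[x])) * w).
      by ring.
    by rewrite sg2 mul1r.
  apply: near_eq_is_derive d3; near=> y; rewrite normPhi//.
  apply/andP; split; near: y.
    by apply: lt_nbhsr; case/andP: xab.
  by apply: lt_nbhsl; case/andP: xab.
- by apply: cvg_at_right_filter; exact: Fc.
- by apply: cvg_at_left_filter; exact: Fc.
Unshelve. all: by end_near. Qed.

(** Euler's Beta value B(k, m + 1), in a product form free of Gamma. *)
Definition beta (k : R) (m : nat) : R := m`!%:R / \prod_(i < m.+1) (k + i%:R).

Lemma beta0 k : beta k 0 = k^-1.
Proof. by rewrite /beta big_ord1 fact0 addr0 mul1r. Qed.

Lemma betaS k m : beta k m.+1 = m.+1%:R / (m.+1%:R + k) * beta k m.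
Proof.
rewrite /beta [in LHS]big_ord_recr/= factS natrM invfM [k + _]addrC; ring.
Qed.

Lemma beta_gt0 k m : 0 < k -> 0 < beta k m.
Proof.
move=> k0; apply: divr_gt0; first by rewrite ltr0n fact_gt0.
by apply: prodr_gt0 => i _; rewrite ltr_wpDr.
Qed.

Lemma beta_rec k c (S : nat -> R) : 0 < k -> k * S 0%N = c ->
  (forall m, (m.+1%:R + k) * S m.+1 = m.+1%:R * S m) ->
  forall m, S m = c * beta k m.
Proof.
move=> k0 S0 Srec; elim=> [|m IH].
  by rewrite beta0 -S0 mulrAC mulfV ?mul1r// gt_eqF.
have mk0 : m.+1%:R + k != 0 by rewrite gt_eqF// ltr_wpDl.
apply: (mulfI mk0); rewrite Srec IH betaS; move: mk0.
by set d := _ + k; set m1 := m.+1%:R => mk0; field.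
Qed.

Lemma edge_left_bound a b k x : a < x < b ->
  `|('X - a%:P).[x]| `^ (k - 1) <= edge_bound a b k k 1 x.
Proof.
move=> /andP[ax xb]; rewrite !hornerE gtr0_norm ?subr_gt0// /edge_bound mul1r.
by rewrite lerDl powR_ge0.
Qed.

Lemma edge_right_bound a b k x : a < x < b ->
  `|('X - b%:P).[x]| `^ (k - 1) <= edge_bound a b k k 1 x.
Proof.
move=> /andP[ax xb]; rewrite !hornerE ltr0_norm ?subr_lt0// opprB /edge_bound.
by rewrite mul1r lerDr powR_ge0.
Qed.

Lemma integral_beta_left k b m : 0 < k -> 0 < b ->
  leb.-integrable `]0, b[ (EFin \o (fun t => (1 - t / b) ^+ m * t `^ (k - 1))) /\
  Rintegral leb `]0, b[%classic (fun t => (1 - t / b) ^+ m * t `^ (k - 1)) =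
    b `^ k * beta k m.
Proof.
move=> k0 b0; pose p : {poly R} := 1 - b^-1 *: 'X.
have pE x : p.[x] = 1 - x / b by rewrite !hornerE mulrC.
have sgP x : 0 < x < b -> 0 < 1 * ('X - 0%:P : {poly R}).[x].
  by move=> /andP[x0 _]; rewrite hornerXsubC mul1r subr0.
have FTC P := @FTC_weight P ('X - 0%:P) 0 b k 1 1 b0 k0 ler01 (mulr1 1) sgP
  (fun x => @edge_left_bound 0 b k x).
have wE j x : x \in `]0, b[%classic ->
    (p ^+ j).[x] * `|('X - 0%:P : {poly R}).[x]| `^ (k - 1) =
    (1 - x / b) ^+ j * x `^ (k - 1).
  rewrite inE/= in_itv/= => /andP[x0 _]; rewrite horner_exp pE.
  by rewrite hornerXsubC subr0 gtr0_norm.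
have int j : leb.-integrable `]0, b[ (EFin \o (fun t => (1 - t / b) ^+ j * t `^ (k - 1))).
  apply: eq_integrable (FTC (p ^+ j)).1 => // x xab.
  by rewrite /= wE.
split => //; move: m; apply: beta_rec => // [|m].
  have [_] := FTC 1.
  rewrite [RHS](_ : _ = b `^ k); last first.
    rewrite !hornerC !hornerXsubC subrr normr0 powR0 ?gt_eqF// subr0 gtr0_norm//.
    by rewrite mulr0 subr0 !mul1r.
  move=> <-; rewrite -RintegralZl//; apply: eq_Rintegral => x xab; rewrite -(wE 0%N)//.
  rewrite mulrA; congr (_ * _).
  have d1 : (1 : {poly R})^`() = 0 by rewrite -polyC1 derivC.
  by rewrite expr0 d1 mul0r add0r derivXsubC mul1r hornerZ.
(* [p] vanishes at [b] and X at 0, so there are no boundary terms; substituting t / b = 1 - p turns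
   the identity into the relation required by [beta_rec]. *)
have [_] := FTC (p ^+ m.+1).
rewrite [RHS](_ : _ = 0); last first.
  rewrite !horner_exp !pE mulfV ?gt_eqF// subrr expr0n mul0r.
  by rewrite hornerXsubC subrr normr0 powR0 ?gt_eqF// mulr0 subrr mulr0.
move=> E; apply/eqP; rewrite -subr_eq0 -!RintegralZl//.
rewrite -RintegralB//; last 2 first.
- exact: (integrableZl _ _ (int m.+1)).
- exact: (integrableZl _ _ (int m)).
apply/eqP; rewrite -[RHS]E; apply: eq_Rintegral => x xab.
rewrite -!wE// !mulrA -mulrBl; congr (_ * _).
have dp : p^`() = (- b^-1)%:P.
  by rewrite derivB -polyC1 derivC derivZ derivX sub0r -mul_polyC mulr1 polyCN.
rewrite deriv_exp dp derivXsubC mulr1 subr0 !(hornerD, hornerM, hornerZ, hornerX).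
rewrite !hornerMn !hornerM hornerC !horner_exp pE /=.
set u := _ ^+ m; rewrite !exprS -/u -mulr_natl; field; exact: lt0r_neq0.
Qed.

Lemma integral_beta_right k o b m : 0 < k -> o < b ->
  leb.-integrable `]o, b[
    (EFin \o (fun x => ((x - o) / (b - o)) ^+ m * (b - x) `^ (k - 1))) /\
  Rintegral leb `]o, b[%classic
    (fun x => ((x - o) / (b - o)) ^+ m * (b - x) `^ (k - 1)) =
    (b - o) `^ k * beta k m.
Proof.
move=> k0 ob; pose l := b - o; have l0 : 0 < l by rewrite subr_gt0.
pose p : {poly R} := l^-1 *: ('X - o%:P).
have pE x : p.[x] = (x - o) / l by rewrite hornerZ hornerXsubC mulrC.
have sgP x : o < x < b -> 0 < -1 * ('X - b%:P : {poly R}).[x].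
  by move=> /andP[_ xb]; rewrite hornerXsubC mulN1r opprB subr_gt0.
have N1 : -1 * -1 = 1 :> R by rewrite mulrNN mulr1.
have FTC P := @FTC_weight P ('X - b%:P) o b k (-1) 1 ob k0 ler01 N1 sgP
  (fun x => @edge_right_bound o b k x).
have wE j x : x \in `]o, b[%classic ->
    (p ^+ j).[x] * `|('X - b%:P : {poly R}).[x]| `^ (k - 1) =
    ((x - o) / l) ^+ j * (b - x) `^ (k - 1).
  rewrite inE/= in_itv/= => /andP[_ xb]; rewrite horner_exp pE.
  by rewrite hornerXsubC ltr0_norm ?opprB// subr_lt0.
have int j : leb.-integrable `]o, b[
    (EFin \o (fun t => ((t - o) / l) ^+ j * (b - t) `^ (k - 1))).
  apply: eq_integrable (FTC (p ^+ j)).1 => // x xab.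
  by rewrite /= wE.
split => //; move: m; apply: beta_rec => // [|m].
  have [_] := FTC 1.
  rewrite [RHS](_ : _ = l `^ k); last first.
    rewrite !hornerC !hornerXsubC subrr normr0 powR0 ?gt_eqF// ltr0_norm ?opprB ?subr_lt0//.
    by rewrite mulr0 sub0r mul1r mulrNN mul1r.
  move=> <-; rewrite -RintegralZl//; apply: eq_Rintegral => x xab; rewrite -(wE 0%N)//.
  rewrite mulrA; congr (_ * _).
  have d1 : (1 : {poly R})^`() = 0 by rewrite -polyC1 derivC.
  by rewrite expr0 d1 mul0r add0r derivXsubC mul1r hornerZ.
have [_] := FTC (p ^+ m.+1).
rewrite [RHS](_ : _ = 0); last first.
  rewrite !horner_exp !pE !subrr mul0r expr0n mul0r.
  by rewrite hornerXsubC subrr normr0 powR0 ?gt_eqF// mulr0 subrr mulr0.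
move=> E; apply/eqP; rewrite -subr_eq0 -!RintegralZl//.
rewrite -RintegralB//; last 2 first.
- exact: (integrableZl _ _ (int m.+1)).
- exact: (integrableZl _ _ (int m)).
apply/eqP; rewrite -[RHS]E; apply: eq_Rintegral => x xab.
rewrite -!wE// !mulrA -mulrBl; congr (_ * _).
have dp : p^`() = (l^-1)%:P.
  by rewrite derivZ derivXsubC -mul_polyC mulr1.
rewrite deriv_exp dp derivXsubC mulr1 !(hornerD, hornerN, hornerM, hornerZ, hornerX).
rewrite !hornerMn !hornerM !hornerC !horner_exp pE /=.
have -> : x + - b = (x - o) - l by rewrite /l; lra.
set u := _ ^+ m; rewrite !exprS -/u -mulr_natl; field; exact: lt0r_neq0.
Qed.

End WeightedIntegrals.

(** * Beta and Gamma integrals *)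

Section GammaLimit.
Variable R : realType.
Notation leb := (@lebesgue_measure R).

Lemma bernoulli_expr (u : R) m : 0 <= u <= 1 -> 1 - m%:R * u <= (1 - u) ^+ m.
Proof.
move=> /andP[u0 u1]; elim: m => [|m IH]; first by rewrite mul0r subr0 expr0.
rewrite exprS; apply: (@le_trans _ _ ((1 - u) * (1 - m%:R * u))).
  rewrite -natr1; have : 0 <= m%:R * u * u by rewrite !mulr_ge0.
  lra.
by rewrite ler_wpM2l// subr_ge0.
Qed.

(** With M = m + 1, the lower bound is Bernoulli's inequality for (1 - (t/M)^2)^M = (1 - t/M)^M (1 +
    t/M)^M, whose last factor is at most e^t. *)
Lemma expr_sub_le (t : R) m : 0 <= t <= m.+1%:R ->
  expR (- t) * (1 - t ^+ 2 / m.+1%:R) <= (1 - t / m.+1%:R) ^+ m.+1 <= expR (- t).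
Proof.
move=> /andP[t0 tm]; set M : R := m.+1%:R; have M0 : 0 < M by rewrite ltr0n.
have tM1 : t / M <= 1 by rewrite ler_pdivrMr ?mul1r.
have tM0 : 0 <= t / M by rewrite divr_ge0// ltW.
have eM (s : R) : expR s = expR (s / M) ^+ m.+1.
  by rewrite -expRM_natl -/M mulrC divfK ?gt_eqF.
apply/andP; split; last first.
  rewrite eM mulNr; apply: lerXn2r; rewrite ?nnegrE ?subr_ge0 ?expR_ge0//.
  exact: expR_ge1Dx.
have h1 : 1 - t ^+ 2 / M <= (1 - (t / M) ^+ 2) ^+ m.+1.
  apply: le_trans (bernoulli_expr _ _).
    by rewrite -/M (_ : M * (t / M) ^+ 2 = t ^+ 2 / M)//; field; exact: lt0r_neq0.
  by rewrite exprn_ge0//= exprn_ile1.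
have h2 : (1 - (t / M) ^+ 2) ^+ m.+1 <= (1 - t / M) ^+ m.+1 * expR t.
  rewrite (eM t) -exprMn; apply: lerXn2r; rewrite ?nnegrE.
  - by rewrite subr_ge0 exprn_ile1.
  - by rewrite mulr_ge0 ?subr_ge0 ?expR_ge0.
  rewrite (_ : 1 - (t / M) ^+ 2 = (1 - t / M) * (1 + t / M)); last by ring.
  by rewrite ler_wpM2l ?subr_ge0// expR_ge1Dx.
rewrite mulrC -ler_pdivlMr ?expR_gt0// -expRN opprK.
exact: le_trans h1 h2.
Qed.

Lemma cvg_expr_expR (t : R) : 0 <= t ->
  (1 - t / m.+1%:R) ^+ m.+1 @[m --> \oo] --> expR (- t).
Proof.
move=> t0.
have nat_cvg : t ^+ 2 / m.+1%:R @[m --> \oo] --> 0.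
  by rewrite -[X in _ --> X](mulr0 (t ^+ 2)); apply: cvgMr; exact: cvg_harmonic.
apply: (@squeeze_cvgr _ _ _ _ (fun m => expR (- t) * (1 - t ^+ 2 / m.+1%:R))
  (fun=> expR (- t))).
- near=> m; apply: expr_sub_le; rewrite t0/=.
  apply: (@le_trans _ _ m%:R); last by rewrite ler_nat.
  by near: m; exact: nbhs_infty_ger.
- rewrite -[X in _ --> X]mulr1; apply: cvgMr.
  by rewrite -[X in _ --> X]subr0; apply: cvgB => //; exact: cvg_cst.
- exact: cvg_cst.
Unshelve. all: by end_near. Qed.

Definition gamma_fun (k t : R) := t `^ (k - 1) * expR (- t).

Lemma continuous_gamma_fun k x : 0 < x -> {for x, continuous (gamma_fun k)}.
Proof.
move=> x0; apply: (@cvgM _ _ _ _ (fun t => t `^ (k - 1)) (fun t => expR (- t))).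
  by apply: (continuous_powR_comp (g := id)) => //; exact: cvg_id.
apply: (@continuous_comp _ _ _ (fun t : R => - t) (@expR R)).
  by apply: cvgN; exact: cvg_id.
exact: continuous_expR.
Qed.

Lemma measurable_gamma_fun (k : R) :
  measurable_fun `](0 : R), +oo[ (gamma_fun k).
Proof.
apply: open_continuous_measurable_fun; first exact: interval_open.
by move=> x; rewrite inE/= in_itv/= andbT; exact: continuous_gamma_fun.
Qed.

Lemma integrable_gamma_fun (k : R) : 0 < k ->
  leb.-integrable `](0 : R), +oo[ (EFin \o gamma_fun k).
Proof.
move=> k0; pose N := (Num.truncn k).+1.
have kN : k < N%:R by exact: truncnS_gt.
(* For t >= 2, t^(k-1) <= t^N <= N! 2^N e^(t/2) by a single term of the exponential series; one more
   factor 2 offsets the rate 1/2 in the exponential density. *)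
pose C := (N`!%:R * 2 ^+ N.+1 : R).
have C0 : 0 <= C by rewrite mulr_ge0// exprn_ge0.
pose h1 := (fun t : R => t `^ (k - 1)) \_ `]0, 2[.
pose h t := h1 t + C * exponential_pdf (2^-1 : R) t.
have ih1 : leb.-integrable `](0 : R), +oo[ (EFin \o h1).
  rewrite -restrict_EFin; apply/integrable_restrict => //.
  apply: (@integrableS _ _ _ leb `]0, 2[%classic) => //; first exact: measurableI.
  have [+ _] := @integral_beta_left R k 2 0 k0 (ltr0Sn _ _).
  by under [X in EFin \o X]eq_fun do rewrite expr0 mul1r.
have ih2 : leb.-integrable `](0 : R), +oo[ (EFin \o exponential_pdf (2^-1 : R)).
  by apply: integrableS (integrable_exponential_pdf _); rewrite ?invr_gt0.
have ih : leb.-integrable `](0 : R), +oo[ (EFin \o h).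
  exact: (integrableD _ ih1 (integrableZl _ C ih2)).
apply: le_integrable ih => //.
  by apply/measurable_EFinP; exact: measurable_gamma_fun.
move=> t /=; rewrite in_itv/= andbT lee_fin => t0.
apply: le_trans (ler_norm _); rewrite /gamma_fun ger0_norm; last first.
  by rewrite mulr_ge0 ?powR_ge0 ?expR_ge0.
have p0 : 0 <= exponential_pdf (2^-1 : R) t by apply: exponential_pdf_ge0; rewrite invr_ge0.
have [t2|t2] := ltP t 2.
  rewrite /h /h1 patchE ifT; last by rewrite inE/= in_itv/= t0.
  apply: (@le_trans _ _ (t `^ (k - 1))); last by rewrite lerDl mulr_ge0.
  by rewrite ler_piMr ?powR_ge0// -[leRHS]expR0 ler_expR oppr_le0 ltW.
rewrite /h /h1 patchE ifF; last first.
  by apply/negbTE/negP; rewrite inE/= in_itv/= => /andP[_]; rewrite ltNge t2.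
rewrite add0r exponential_pdfE ?(ltW t0)//.
apply: (@le_trans _ _ (t ^+ N * expR (- t))).
  rewrite ler_wpM2r ?expR_ge0// -powR_mulrn ?(ltW t0)// ler_powR//; lra.
have := @expR_ge1Dxn R (t / 2) N.-1 (divr_ge0 (ltW t0) (ler0n _ _)).
rewrite prednK// => ht.
have -> : - t = - 2^-1 * t + - (t / 2) by lra.
rewrite expRD !mulrA mulrC mulrA ler_wpM2r ?expR_ge0// expRN.
rewrite mulrC ler_pdivrMr ?expR_gt0//.
have : (t / 2) ^+ N / N`!%:R <= expR (t / 2) by lra.
rewrite expr_div_n ler_pdivrMr ?ltr0n ?fact_gt0// ler_pdivrMr ?exprn_gt0// => h3.
apply: le_trans h3 _; rewrite le_eqVlt; apply/orP; left; apply/eqP.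
by rewrite /C exprS; field.
Qed.

(** The left-hand side is the integral of (1 - t/(m+1))^(m+1) t^(k-1) over ]0, m+1[. This integrand
    is dominated by that of Gamma(k) and tends to it, so dominated convergence applies. *)
Lemma cvg_beta_gamma (k : R) : 0 < k ->
  m.+1%:R `^ k * beta k m.+1 @[m --> \oo] --> GammaF k.
Proof.
move=> k0; pose u (m : nat) (t : R) := (1 - t / m.+1%:R) ^+ m.+1 * t `^ (k - 1).
pose D : set R := `]0, +oo[%classic; pose I (m : nat) : set R := `]0, m.+1%:R[%classic.
pose f m t := (u m \_ (I m)) t.
have mI m : measurable (I m) by exact: measurable_itv.
have ID m : D `&` I m = I m.
  by apply/seteqP; split => [x []//|x /= h]; split => //; move: h;
     rewrite /D /= !in_itv/= andbT => /andP[].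
have uint m := @integral_beta_left R k m.+1%:R m.+1 k0 (ltr0Sn _ _).
have fE m : Rintegral leb D (f m) = m.+1%:R `^ k * beta k m.+1.
  by rewrite -(uint m).2 /f -Rintegral_mkcondr ID.
have fi m : leb.-integrable D (EFin \o f m).
  rewrite /f -restrict_EFin; apply/integrable_restrict => //.
  - exact: mI.
  - exact: measurable_itv.
  - by rewrite ID; exact: (uint m).1.
have fle m t : D t -> `|f m t| <= gamma_fun k t.
  rewrite /D/= in_itv/= andbT => t0; rewrite /f patchE; case: ifPn => [|_].
    rewrite inE /I/= in_itv/= => /andP[_ tm]; rewrite /u /gamma_fun mulrC.
    have /andP[_ h] : expR (- t) * (1 - t ^+ 2 / m.+1%:R) <= (1 - t / m.+1%:R) ^+ m.+1 <= expR (- t).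
      by apply: expr_sub_le; rewrite !ltW.
    rewrite normrM (ger0_norm (powR_ge0 _ _)) ler_wpM2l ?powR_ge0// ger0_norm//.
    by rewrite exprn_ge0// subr_ge0 ler_pdivrMr// mul1r ltW.
  (* Outside [I m] the restriction takes the default value [point], which is 0 in [R]. *)
  by rewrite -[point]/(0 : R) normr0 mulr_ge0 ?powR_ge0 ?expR_ge0.
have fcvg t : D t -> f m t @[m --> \oo] --> gamma_fun k t.
  rewrite /D/= in_itv/= andbT => t0.
  have h : u m t @[m --> \oo] --> gamma_fun k t.
    rewrite /u /gamma_fun mulrC; apply: cvgMl; apply: cvg_expr_expR; exact: ltW.
  apply: cvg_trans h; apply: near_eq_cvg; near=> m.
  rewrite /f patchE ifT// inE /I/= in_itv/= t0/=.
  apply: (@lt_le_trans _ _ m%:R); last by rewrite ler_nat.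
  by near: m; exact: nbhs_infty_gtr.
have := @dominated_convergence _ _ R leb D _ (fun m => EFin \o f m)
  (EFin \o gamma_fun k) (EFin \o gamma_fun k).
move=> /(_ (measurable_itv _)) []//.
- by move=> m; exact: (measurable_int _ (fi m)).
- by apply/measurable_EFinP; exact: measurable_gamma_fun.
- by apply: aeW => t Dt; apply: cvg_EFin; [exact: nearW|exact: fcvg].
- exact: integrable_gamma_fun.
- by apply: aeW => t m Dt; rewrite lee_fin; exact: fle.
move=> _ _ cv.
have -> : GammaF k = Rintegral leb D (gamma_fun k) by [].
under eq_fun do rewrite -fE.
apply: fine_cvg; rewrite fineK.
  exact: cv.
by apply: integrable_fin_num; [exact: measurable_itv|exact: integrable_gamma_fun].
Unshelve. all: by end_near. Qed.

Lemma GammaF_gt0 (k : R) : 0 < k -> 0 < GammaF k.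
Proof.
move=> k0; have gi := integrable_gamma_fun k0.
have [int1 intE] := @integral_beta_left R k 1 0 k0 ltr01.
have sub : `]0, 1[%classic `<=` `](0 : R), +oo[%classic.
  by move=> x /=; rewrite !in_itv/= andbT => /andP[].
apply: (@lt_le_trans _ _ (expR (- 1) * k^-1)); first by rewrite mulr_gt0 ?expR_gt0 ?invr_gt0.
have -> : expR (- 1) * k^-1 = Rintegral leb `]0, 1[%classic
    (fun t => expR (- 1) * ((1 - t / 1) ^+ 0 * t `^ (k - 1))).
  by rewrite RintegralZl// intE beta0 powR1 mul1r.
apply: (@le_trans _ _ (Rintegral leb `]0, 1[%classic (gamma_fun k))).
  apply: le_Rintegral => //.
  - exact: (integrableZl _ _ int1).
  - exact: integrableS gi.
  - move=> t /=; rewrite in_itv/= => /andP[t0 t1]; rewrite expr0 mul1r mulrC.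
    by rewrite ler_wpM2l ?powR_ge0// ler_expR lerN2 ltW.
have -> : GammaF k = Rintegral leb `]0, +oo[%classic (gamma_fun k) by [].
have IE : `](0 : R), +oo[%classic `&` `]0, 1[%classic = `]0, 1[%classic.
  by apply/seteqP; split => [x []|x h] //; split => //; exact: sub.
rewrite -IE Rintegral_mkcondr; apply: le_Rintegral => //.
  rewrite -restrict_EFin; apply/integrable_restrict => //.
  by rewrite IE; exact: integrableS gi.
move=> t _; rewrite patchE; case: ifPn => // _.
by rewrite mulr_ge0 ?powR_ge0 ?expR_ge0.
Qed.

End GammaLimit.

(** * Concentration of Beta integrals at an end point *)

Section WatsonLemma.
Variable R : realType.
Notation leb := (@lebesgue_measure R).

(* [((x - o) / (b - o)) ^+ m] concentrates at [b]; only the behaviour of [phi]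
   near [b] matters in the limit. *)
Lemma watson (o b k gb : R) (phi : R -> R) : 0 < k -> o < b ->
  leb.-integrable `]o, b[ (EFin \o phi) ->
  (forall e : R, 0 < e -> exists2 d : R, 0 < d & forall x, o < x < b -> b - d < x ->
     `|phi x - gb * (b - x) `^ (k - 1)| <= e * (b - x) `^ (k - 1)) ->
  Rintegral leb `]o, b[%classic (fun x => ((x - o) / (b - o)) ^+ m * phi x) / beta k m
    @[m --> \oo] --> gb * (b - o) `^ k.
Proof.
move=> k0 ob phii phiP; pose l := b - o; have l0 : 0 < l by rewrite subr_gt0.
pose w x := (b - x) `^ (k - 1); pose y x := (x - o) / l.
have y01 x : o < x < b -> 0 <= y x <= 1.
  move=> /andP[ox xb]; apply/andP; split.
    by apply: divr_ge0; rewrite ?subr_ge0 ltW.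
  by rewrite ler_pdivrMr// mul1r /l lerD2r ltW.
have wm m := @integral_beta_right R k o b m k0 ob.
have wi : leb.-integrable `]o, b[ (EFin \o w).
  have [+ _] := wm 0%N; by under [X in EFin \o X]eq_fun do rewrite expr0 mul1r.
pose psi x := phi x - gb * w x.
have psii : leb.-integrable `]o, b[ (EFin \o psi).
  exact: (integrableB _ phii (integrableZl _ gb wi)).
have ymi m (f : R -> R) : leb.-integrable `]o, b[ (EFin \o f) ->
    leb.-integrable `]o, b[ (EFin \o (fun x => y x ^+ m * f x)).
  move=> fi; apply: (le_integrable _ _ _ fi) => //.
    apply/measurable_EFinP; apply: measurable_funM.
      apply: measurable_funX; apply: measurable_funM => //.
      exact: measurable_funB.
    by have /measurable_int/measurable_EFinP := fi.
  move=> x /=; rewrite in_itv/= lee_fin => /y01/andP[y0 y1].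
  by rewrite normrM ler_piMl// ger0_norm ?exprn_ge0// exprn_ile1.
have E m : Rintegral leb `]o, b[%classic (fun x => y x ^+ m * phi x) / beta k m =
    Rintegral leb `]o, b[%classic (fun x => y x ^+ m * psi x) / beta k m + gb * l `^ k.
  have bm : beta k m != 0 by rewrite gt_eqF// beta_gt0.
  apply: (canLR (mulfK bm)); rewrite mulrDl divfK// -mulrA -(wm m).2.
  rewrite -RintegralZl//; last exact: (wm m).1.
  rewrite -RintegralD//; last 2 first.
  - exact: ymi.
  - exact: (integrableZl _ gb (wm m).1).
  by apply: eq_Rintegral => x _; rewrite /psi /w /y; ring.
rewrite (_ : (fun m => _) = (fun m => Rintegral leb `]o, b[%classic
    (fun x => y x ^+ m * psi x) / beta k m + gb * l `^ k)); last first.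
  by apply/funext => m; exact: E.
rewrite -[X in _ --> X]add0r; apply: cvgD; last exact: cvg_cst.
apply/cvgr0Pnorm_le => e e0.
have lk0 : 0 < l `^ k by exact: powR_gt0.
have [|d d0 dP] := phiP (e / 2 / l `^ k); first by rewrite !divr_gt0.
pose d' := Num.min d (l / 2).
have d'0 : 0 < d' by rewrite lt_min d0 divr_gt0.
have d'd : d' <= d by rewrite ge_min lexx.
have d'l : d' < l.
  by apply: (@le_lt_trans _ _ (l / 2)); [rewrite ge_min lexx orbT|lra].
(* Left of [b - d'] the ratio [y] is at most [rho], right of [b - eta] it is at least [r > rho]. The
   far part of the integral is thus at most [rho ^+ m * K] while [beta k m] is at least
   [r ^+ m * c], so their quotient decays like (rho / r)^m. *)
pose rho := 1 - d' / l; pose eta := d' / 2; pose r := 1 - eta / l.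
have dl1 : 0 < d' / l < 1 by rewrite divr_gt0//= ltr_pdivrMr// mul1r.
have rho0 : 0 < rho by rewrite /rho; lra.
have rhor : rho < r by rewrite /r /rho /eta mulrAC; lra.
have r0 : 0 < r by lra.
pose K := Rintegral leb `]o, b[%classic (fun x => `|psi x|).
have bound1 m : `|Rintegral leb `]o, b[%classic (fun x => y x ^+ m * psi x)| <=
    e / 2 * beta k m + rho ^+ m * K.
  apply: le_trans (le_normr_Rintegral _ (ymi m _ psii)) _ => //.
  rewrite -RintegralZl//; last exact: (integrable_abse psii).
  have -> : e / 2 * beta k m = e / 2 / l `^ k * (l `^ k * beta k m).
    by field; exact: lt0r_neq0.
  rewrite -(wm m).2 -RintegralZl//; last exact: (wm m).1.
  rewrite -RintegralD//; last 2 first.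
  - exact: (integrableZl _ _ (wm m).1).
  - exact: (integrableZl _ (rho ^+ m) (integrable_abse psii)).
  apply: le_Rintegral => //.
  - exact: (integrable_abse (ymi m _ psii)).
  - apply: (integrableD _ (integrableZl _ _ (wm m).1)
      (integrableZl _ (rho ^+ m) (integrable_abse psii))) => //.
  move=> x /=; rewrite in_itv/= => xob; have /andP[y0 y1] := y01 x xob.
  rewrite normrM (ger0_norm (exprn_ge0 _ y0)).
  have [xd|xd] := ltP (b - d') x.
    apply: (@le_trans _ _ (e / 2 / l `^ k * (y x ^+ m * w x))); last first.
      by rewrite lerDl mulr_ge0// exprn_ge0// ltW.
    rewrite mulrCA ler_wpM2l ?exprn_ge0//; apply: dP => //; lra.
  apply: (@le_trans _ _ (rho ^+ m * `|psi x|)); last first.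
    rewrite lerDr mulr_ge0 ?divr_ge0 ?(ltW lk0) ?(ltW e0)//.
    by rewrite mulr_ge0 ?exprn_ge0 ?powR_ge0.
  rewrite ler_wpM2r//; apply: lerXn2r; rewrite ?nnegrE ?(ltW rho0)//.
  rewrite /y ler_pdivrMr// /rho mulrBl mul1r divfK ?gt_eqF// /l; lra.
pose c := eta `^ k / k / l `^ k.
have eta0 : 0 < eta by rewrite divr_gt0.
have c0 : 0 < c by rewrite !divr_gt0// powR_gt0.
have bound2 m : r ^+ m * c <= beta k m.
  have be : b - eta < b by lra.
  have [vi vE] := @integral_beta_right R k (b - eta) b 0 k0 be.
  have {}vi : leb.-integrable `]b - eta, b[ (EFin \o w).
    by move: vi; under [X in EFin \o X]eq_fun do rewrite expr0 mul1r.
  have {}vE : Rintegral leb `]b - eta, b[%classic w = eta `^ k / k.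
    move: vE; rewrite beta0 (_ : b - (b - eta) = eta); last lra.
    by under eq_Rintegral do rewrite expr0 mul1r.
  rewrite /c mulrA ler_pdivrMr// -vE [leRHS]mulrC -(wm m).2 -RintegralZl//.
  have sub : `]b - eta, b[%classic `<=` `]o, b[%classic.
    move=> x /=; rewrite !in_itv/= => /andP[x1 ->]; rewrite andbT.
    by move: d'l x1; rewrite /eta /l; lra.
  have IE : `]o, b[%classic `&` `]b - eta, b[%classic = `]b - eta, b[%classic.
    by apply/seteqP; split => [x []|x h] //; split => //; exact: sub.
  rewrite -IE Rintegral_mkcondr; apply: le_Rintegral => //.
  - rewrite -restrict_EFin; apply/integrable_restrict => //.
    rewrite IE; exact: (integrableZl _ (r ^+ m) vi).
  - exact: (wm m).1.
  move=> x /=; rewrite in_itv/= => /[dup] xob /y01 /andP[y0 _].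
  rewrite patchE; case: ifPn => [|_]; last by rewrite mulr_ge0 ?exprn_ge0 ?powR_ge0.
  rewrite inE/= in_itv/= => /andP[bx _]; rewrite ler_wpM2r ?powR_ge0//.
  apply: lerXn2r; rewrite ?nnegrE ?(ltW r0)//.
  rewrite ler_pdivlMr// /r mulrBl mul1r divfK ?gt_eqF// /l; lra.
have K0 : 0 <= K by apply: Rintegral_ge0.
have q1 : `|rho / r| < 1 by rewrite ger0_norm ?divr_ge0 ?ltW// ltr_pdivrMr// mul1r.
have qcv : K / c * (rho / r) ^+ m @[m --> \oo] --> 0.
  by rewrite -[X in _ --> X](mulr0 (K / c)); apply: cvgMr; exact: cvg_expr.
near=> m.
have bm := beta_gt0 m k0.
rewrite normrM normfV (gtr0_norm bm) ler_pdivrMr//; apply: le_trans (bound1 m) _.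
have : K / c * (rho / r) ^+ m <= e / 2.
  near: m; move/cvgr0_norm_le : qcv => /(_ (e / 2)); rewrite divr_gt0// => /(_ isT).
  by apply: filterS => m; apply: le_trans; exact: ler_norm.
rewrite expr_div_n => h.
have : rho ^+ m * K <= e / 2 * beta k m.
  apply: (@le_trans _ _ (K / c * (rho ^+ m / r ^+ m) * (r ^+ m * c))).
    by rewrite le_eqVlt; apply/orP; left; apply/eqP; field; rewrite !gt_eqF ?exprn_gt0.
  have rm0 : 0 < r ^+ m by exact: exprn_gt0.
  have rhom0 : 0 < rho ^+ m by exact: exprn_gt0.
  apply: ler_pM => //.
    by apply: mulr_ge0; apply: divr_ge0 => //; exact: ltW.
  by apply: mulr_ge0; exact: ltW.
lra.
Unshelve. all: by end_near. Qed.

End WatsonLemma.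

(** * Bounds for powers with an exponent of either sign *)

Section PowerBounds.
Variable R : realType.
Implicit Types (u v t p a b c x : R).

Lemma powR_prod (I : Type) (r : seq I) (P : pred I) (F : I -> R) p :
  (forall i, P i -> 0 <= F i) ->
  (\prod_(i <- r | P i) F i) `^ p = \prod_(i <- r | P i) F i `^ p.
Proof.
move=> F0; suff : 0 <= \prod_(i <- r | P i) F i /\
    (\prod_(i <- r | P i) F i) `^ p = \prod_(i <- r | P i) F i `^ p by case.
elim/big_rec2 : _ => [|i x y Pi [y0 <-]]; first by rewrite powR1.
by rewrite powRM ?F0// mulr_ge0 ?F0.
Qed.

(** The exponent k - 1 can have either sign; the sum of both end values serves for increasing and
    decreasing powers alike. *)
Lemma powR_le_ends u v t p : 0 < u -> u <= t <= v -> t `^ p <= u `^ p + v `^ p.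
Proof.
move=> u0 /andP[ut tv].
have t0 : 0 < t by exact: lt_le_trans ut.
have v0 : 0 < v by exact: lt_le_trans tv.
have [p0|p0] := leP 0 p.
  apply: (@le_trans _ _ (v `^ p)); last by rewrite lerDr powR_ge0.
  by apply: ge0_ler_powR; rewrite ?nnegrE// ltW.
apply: (@le_trans _ _ (u `^ p)); last by rewrite lerDl powR_ge0.
have : u `^ (- p) <= t `^ (- p).
  by apply: ge0_ler_powR; rewrite ?nnegrE ?oppr_ge0// ltW.
by rewrite !powRN lef_pV2 ?posrE ?powR_gt0.
Qed.

Lemma powR_dist_le a b c x p : a < x < b -> b < c \/ c < a ->
  `|x - c| `^ p <= `|b - c| `^ p + `|a - c| `^ p.
Proof.
move=> /andP[ax xb] [bc|ca].
  rewrite !ltr0_norm; try lra.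
  by apply: powR_le_ends; lra.
rewrite [leRHS]addrC !gtr0_norm; try lra.
by apply: powR_le_ends; lra.
Qed.

(** On each half of the interval one of the two bases lies between (b - a) / 2 and b - a, so that
    its power is bounded by the constant. *)
Lemma powR_edges_le a b x p : a < x < b ->
  (x - a) `^ p * (b - x) `^ p <=
  (((b - a) / 2) `^ p + (b - a) `^ p) * ((x - a) `^ p + (b - x) `^ p).
Proof.
move=> /andP[ax xb].
have h t : (b - a) / 2 <= t <= b - a -> t `^ p <= ((b - a) / 2) `^ p + (b - a) `^ p.
  by apply: powR_le_ends; lra.
have S0 : 0 <= ((b - a) / 2) `^ p + (b - a) `^ p by rewrite addr_ge0 ?powR_ge0.
have A0 : 0 <= (x - a) `^ p by rewrite powR_ge0.
have B0 : 0 <= (b - x) `^ p by rewrite powR_ge0.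
have [xm|xm] := leP x ((a + b) / 2).
  have Bh : (b - x) `^ p <= ((b - a) / 2) `^ p + (b - a) `^ p by apply: h; lra.
  rewrite mulrC; apply: ler_pM => //; lra.
have Ah : (x - a) `^ p <= ((b - a) / 2) `^ p + (b - a) `^ p by apply: h; lra.
apply: ler_pM => //; lra.
Qed.

End PowerBounds.

(** * The normalising determinant *)

Section Chamber.
Variables (R : realType) (n : nat) (k : R).
Notation leb := (@lebesgue_measure R).

Definition Phi (x : 'rV[R]_n.+1) : {poly R} := \prod_r ('X - (x 0 r)%:P).

Definition rpoly (x : 'rV[R]_n.+1) (s : 'I_n.+1) : {poly R} :=
  \prod_(r | r != s) ('X - (x 0 r)%:P).

Definition emb (s : 'I_n) : 'I_n.+1 := widen_ord (leqnSn n) s.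

Lemma PhiE x s : Phi x = ('X - (x 0 s)%:P) * rpoly x s.
Proof. by rewrite /Phi (bigD1 s). Qed.

Lemma deriv_Phi x : (Phi x)^`() = \sum_s rpoly x s.
Proof.
rewrite /Phi.
have H (r : seq 'I_n.+1) : uniq r ->
    (\prod_(i <- r) ('X - (x 0 i)%:P))^`() =
    \sum_(i <- r) \prod_(j <- r | j != i) ('X - (x 0 j)%:P).
  elim: r => [_|i r IH /= /andP[ir ur]]; first by rewrite !big_nil -polyC1 derivC.
  rewrite !big_cons derivM IH// derivXsubC mul1r eqxx/=; congr (_ + _).
    rewrite big_seq [RHS]big_seq_cond; apply: eq_bigl => j.
    by case: (boolP (j \in r)) => //= jr; apply/esym; apply: contraNneq ir => <-.
  rewrite mulr_sumr; apply: eq_big_seq => j jr.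
  have ij : i != j by apply: contraNneq ir => ->.
  by rewrite big_cons ij.
by rewrite H ?index_enum_uniq.
Qed.

Lemma Phi_perm x (s : 'S_n.+1) : Phi (permrow s x) = Phi x.
Proof.
rewrite /Phi [RHS](reindex_inj (@perm_inj _ s)).
by apply: eq_bigr => i _; rewrite permrowE.
Qed.

Lemma rpoly_horner x s y : (rpoly x s).[y] = \prod_(r | r != s) (y - x 0 r).
Proof. by rewrite horner_prod; apply: eq_bigr => r _; rewrite hornerXsubC. Qed.

Variable lam : 'rV[R]_n.+1.
Hypothesis lamC : in_chamber lam.
Hypothesis k_gt0 : 0 < k.

Lemma chamber_distinct : distinct_coords lam.
Proof.
move=> i j; rewrite -val_eqE neq_ltn => /orP[] /lamC h; last by rewrite lt_eqF.
by rewrite gt_eqF.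
Qed.

Lemma chamber_le (i j : 'I_n.+1) : (i <= j)%N -> lam 0 j <= lam 0 i.
Proof.
by rewrite leq_eqVlt => /predU1P[/val_inj ->//|/lamC/ltW].
Qed.

Definition lo (i : nat) : R := lam 0 (inord i.+1).
Definition hi (i : nat) : R := lam 0 (inord i).

Lemma lo_hi i : (i < n)%N -> lo i < hi i.
Proof. by move=> ni; apply: lamC; rewrite !inordK// ltnS ltnW. Qed.

Lemma hi_emb (i : 'I_n) : hi i = lam 0 (emb i).
Proof.
by congr (lam 0 _); apply: val_inj; rewrite /= inordK// ltnS ltnW.
Qed.

Lemma chamber_out i (r : 'I_n.+1) : (i < n)%N -> r != inord i -> r != inord i.+1 ->
  hi i < lam 0 r \/ lam 0 r < lo i.
Proof.
move=> ni ri ri1; have iS : (i < n.+1)%N by rewrite ltnS ltnW.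
have [h|h|h] := ltngtP r i; first by left; apply: lamC; rewrite inordK.
  right; apply: lamC; rewrite inordK//; move: ri1; rewrite -val_eqE/= inordK//.
  by rewrite ltn_neqAle eq_sym => ->.
by move: ri; rewrite -val_eqE/= inordK// h eqxx.
Qed.

Definition wt (x : R) : R := `|(Phi lam).[x]| `^ (k - 1).

Lemma wt_prod x : wt x = \prod_r `|x - lam 0 r| `^ (k - 1).
Proof.
rewrite /wt /Phi horner_prod normr_prod powR_prod//.
by apply: eq_bigr => r _; rewrite hornerXsubC.
Qed.

(** Only the two roots that bound the interval can make the weight singular; every other factor is
    bounded by the sum of its values at the ends. *)
Lemma wt_bound i : (i < n)%N -> exists2 C, 0 <= C &
  forall x, lo i < x < hi i -> wt x <= edge_bound (lo i) (hi i) k k C x.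
Proof.
move=> ni; have iS : (i < n.+1)%N by rewrite ltnS ltnW.
pose p := k - 1; pose a := lo i; pose b := hi i.
pose c r := `|b - lam 0 r| `^ p + `|a - lam 0 r| `^ p.
pose D := \prod_(r | (r != inord i) && (r != inord i.+1)) c r.
have c0 r : 0 <= c r by rewrite addr_ge0 ?powR_ge0.
have D0 : 0 <= D by apply: prodr_ge0.
exists (D * (((b - a) / 2) `^ p + (b - a) `^ p)).
  by rewrite mulr_ge0// addr_ge0 ?powR_ge0.
move=> x xab; have /andP[ax xb] := xab; have ii : inord i.+1 != inord i :> 'I_n.+1.
  by rewrite -val_eqE/= !inordK// gtn_eqF.
rewrite wt_prod (bigD1 (inord i))//= (bigD1 (inord i.+1))//= -/p mulrA mulrC.
rewrite /edge_bound -mulrA; apply: ler_pM.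
- by apply: prodr_ge0 => r _; exact: powR_ge0.
- by rewrite mulr_ge0 ?powR_ge0.
- apply: ler_prod => r /andP[ri ri1]; rewrite powR_ge0/=.
  exact: (powR_dist_le _ xab (chamber_out ni ri ri1)).
- have -> : `|x - lam 0 (inord i)| = hi i - x by rewrite ltr0_norm ?opprB ?subr_lt0.
  have -> : `|x - lam 0 (inord i.+1)| = x - lo i by rewrite gtr0_norm ?subr_gt0.
  by rewrite mulrC; exact: powR_edges_le.
Qed.

Lemma Phi_sign i : (i < n)%N -> exists2 sg, sg * sg = 1 &
  forall x, lo i < x < hi i -> 0 < sg * (Phi lam).[x].
Proof.
move=> ni; have iS : (i < n.+1)%N by rewrite ltnS ltnW.
exists (\prod_(r < n.+1) (if (r <= i)%N then -1 else 1)).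
  rewrite -big_split/= big1// => r _; case: ifP => _; last by rewrite mulr1.
  by rewrite mulrNN mulr1.
move=> x /andP[ax xb]; rewrite /Phi horner_prod -big_split/=.
apply: prodr_gt0 => r _; rewrite hornerXsubC; case: leqP => ri.
  rewrite mulN1r opprB subr_gt0 (lt_le_trans xb)//.
  by apply: chamber_le; rewrite inordK.
rewrite mul1r subr_gt0 (le_lt_trans _ ax)//.
by apply: chamber_le; rewrite inordK.
Qed.

Definition cM (i : nat) (P : {poly R}) : R :=
  Rintegral leb `]lo i, hi i[%classic (fun x => P.[x] * wt x).

Lemma wt_integrable i P : (i < n)%N ->
  leb.-integrable `]lo i, hi i[ (EFin \o (fun x => P.[x] * wt x)).
Proof.
move=> ni; have [C C0 wC] := wt_bound ni; have [sg sg2 sgP] := Phi_sign ni.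
exact: (FTC_weight P (lo_hi ni) k_gt0 C0 sg2 sgP wC).1.
Qed.

(** The boundary terms vanish because both ends are roots of [Phi lam]. The recursion for the
    determinant and the one for general integrands both come from this relation. *)
Lemma cM_parts i P : (i < n)%N ->
  cM i (P^`() * Phi lam + k *: (P * (Phi lam)^`())) = 0.
Proof.
move=> ni; have [C C0 wC] := wt_bound ni; have [sg sg2 sgP] := Phi_sign ni.
rewrite /cM (FTC_weight P (lo_hi ni) k_gt0 C0 sg2 sgP wC).2.
have -> : (Phi lam).[hi i] = 0 by rewrite (PhiE _ (inord i)) hornerM hornerXsubC subrr mul0r.
have -> : (Phi lam).[lo i] = 0 by rewrite (PhiE _ (inord i.+1)) hornerM hornerXsubC subrr mul0r.
by rewrite normr0 powR0 ?gt_eqF// !mulr0 subrr mulr0.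
Qed.

Lemma cMD i P Q : (i < n)%N -> cM i (P + Q) = cM i P + cM i Q.
Proof.
move=> ni; rewrite /cM -RintegralD//; try exact: wt_integrable.
by apply: eq_Rintegral => x _; rewrite hornerD mulrDl.
Qed.

Lemma cMZ i c P : (i < n)%N -> cM i (c *: P) = c * cM i P.
Proof.
move=> ni; rewrite /cM -RintegralZl//; try exact: wt_integrable.
by apply: eq_Rintegral => x _; rewrite hornerZ mulrA.
Qed.

Lemma cM_sum i (I : Type) (r : seq I) (F : I -> {poly R}) : (i < n)%N ->
  cM i (\sum_(j <- r) F j) = \sum_(j <- r) cM i (F j).
Proof.
move=> ni; elim: r => [|j r IH]; last by rewrite !big_cons cMD// IH.
by rewrite !big_nil -(scale0r 0) cMZ// mul0r.
Qed.

(** The smallest root: X - base is positive on all the intervals, its powers concentrate at each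
    upper end, and as a factor of [Phi lam] it fits the integration by parts. *)
Definition base : R := lam 0 ord_max.

Lemma base_le_lo i : (i < n)%N -> base <= lo i.
Proof. by move=> ni; apply: chamber_le; rewrite inordK. Qed.

Lemma base_lt_hi i : (i < n)%N -> base < hi i.
Proof. by move=> ni; exact: le_lt_trans (base_le_lo ni) (lo_hi ni). Qed.

Lemma rpoly_hi_neq0 i : (rpoly lam (inord i)).[hi i] != 0.
Proof.
rewrite rpoly_horner; apply/prodf_neq0 => r ri.
by rewrite subr_eq0; apply: chamber_distinct; rewrite eq_sym.
Qed.

(** Extending the integrand by 0 down to [base] brings it into the form of [watson]. Near [hi i] the
    weight is (hi i - x)^(k-1) times the continuous |q|^(k-1), and this gives the limit. *)
Lemma cM_limit i P : (i < n)%N ->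
  cM i (('X - base%:P) ^+ m * P) / ((hi i - base) ^+ m * beta k m) @[m --> \oo] -->
  P.[hi i] * `|(rpoly lam (inord i)).[hi i]| `^ (k - 1) * (hi i - base) `^ k.
Proof.
move=> ni; set l := hi i - base; pose q := rpoly lam (inord i).
have l0 : 0 < l by rewrite subr_gt0 base_lt_hi.
pose phi := (fun x => P.[x] * wt x) \_ `]lo i, hi i[%classic.
have sub : `]base, hi i[%classic `&` `]lo i, hi i[%classic = `]lo i, hi i[%classic.
  apply/seteqP; split => [x []|x] //=; rewrite !in_itv/= => /andP[xl xh].
  by rewrite xl xh (le_lt_trans (base_le_lo ni) xl).
have phii : leb.-integrable `]base, hi i[ (EFin \o phi).
  rewrite -restrict_EFin; apply/integrable_restrict => //.
  by rewrite sub; exact: wt_integrable.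
have E m : cM i (('X - base%:P) ^+ m * P) / (l ^+ m * beta k m) =
    Rintegral leb `]base, hi i[%classic
      (fun x => ((x - base) / l) ^+ m * phi x) / beta k m.
  have lm : l ^+ m != 0 by rewrite expf_neq0// gt_eqF.
  rewrite invfM mulrA; congr (_ / _); rewrite mulrC.
  have -> : (fun x => ((x - base) / l) ^+ m * phi x) =
      (fun x => ((x - base) / l) ^+ m * (P.[x] * wt x)) \_ `]lo i, hi i[%classic.
    apply/funext => x; rewrite /phi !patchE; case: ifP => // _.
    by rewrite -[point]/(0 : R) mulr0.
  rewrite -Rintegral_mkcondr sub /cM -RintegralZl//; last exact: wt_integrable.
  apply: eq_Rintegral => x _; rewrite hornerM horner_exp hornerXsubC expr_div_n.
  by rewrite !mulrA; congr (_ * _ * _); rewrite mulrC.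
rewrite (_ : (fun m => _) = (fun m => Rintegral leb `]base, hi i[%classic
      (fun x => ((x - base) / l) ^+ m * phi x) / beta k m)); last first.
  by apply/funext => m; exact: E.
apply: watson => //; first exact: base_lt_hi.
move=> e e0.
have gc : {for hi i, continuous (fun x => P.[x] * `|q.[x]| `^ (k - 1))}.
  by apply: continuous_weight; exact: rpoly_hi_neq0.
have /cvgrPdist_le/(_ e e0) := gc.
rewrite near_simpl => /nbhs_ballP[d /= d0 dP].
exists (Num.min d (hi i - lo i)); first by rewrite lt_min d0 subr_gt0 lo_hi.
move=> x /andP[bx xh] xd.
have [dmin dmin2] : Num.min d (hi i - lo i) <= d /\ Num.min d (hi i - lo i) <= hi i - lo i.
  by rewrite !ge_min !lexx orbT.
have xlo : lo i < x < hi i by rewrite xh andbT; lra.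
rewrite /phi patchE ifT; last by rewrite inE/= in_itv/=.
have -> : wt x = (hi i - x) `^ (k - 1) * `|q.[x]| `^ (k - 1).
  rewrite /wt (PhiE _ (inord i)) hornerM hornerXsubC normrM powRM//.
  by congr (_ `^ _ * _); rewrite ltr0_norm ?opprB ?subr_lt0.
rewrite mulrCA [X in _ - X]mulrC -mulrBr normrM (ger0_norm (powR_ge0 _ _)) mulrC.
rewrite ler_wpM2r ?powR_ge0// distrC; apply: dP.
by rewrite /ball/= gtr0_norm ?subr_gt0//; lra.
Qed.

Definition ell (i : nat) : R := hi i - base.

Lemma ell_gt0 i : (i < n)%N -> 0 < ell i.
Proof. by move=> ni; rewrite subr_gt0 base_lt_hi. Qed.

Definition cB (m : nat) : 'M[R]_n :=
  \matrix_(s, t) cM t (('X - base%:P) ^+ m * rpoly lam (emb s)).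

Lemma cM_base_max i m : (i < n)%N ->
  (m.+1%:R + k) * cM i (('X - base%:P) ^+ m.+1 * rpoly lam ord_max) =
  - k * \sum_s cM i (('X - base%:P) ^+ m.+1 * rpoly lam (emb s)).
Proof.
move=> ni; have := cM_parts (('X - base%:P) ^+ m.+1) ni.
rewrite deriv_Phi big_ord_recr/= deriv_exp derivXsubC mul1r.
have -> : ('X - base%:P) ^+ m *+ m.+1 * Phi lam =
    m.+1%:R *: (('X - base%:P) ^+ m.+1 * rpoly lam ord_max).
  by rewrite (PhiE _ ord_max) -/base exprSr -mulrA scaler_nat mulrnAl.
rewrite mulrDr scalerDr addrCA -scalerDl addrC cMD// !cMZ//.
rewrite mulr_sumr cM_sum// => /eqP; rewrite addr_eq0 => /eqP ->.
by rewrite mulNr.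
Qed.

Lemma cM_base_rec i m (s : 'I_n) : (i < n)%N ->
  cM i (('X - base%:P) ^+ m.+1 * rpoly lam (emb s)) =
  ell s * cM i (('X - base%:P) ^+ m * rpoly lam (emb s)) +
  cM i (('X - base%:P) ^+ m.+1 * rpoly lam ord_max).
Proof.
move=> ni; rewrite -cMZ// -cMD//; congr (cM i _).
have -> : ('X - base%:P) ^+ m.+1 * rpoly lam ord_max = ('X - base%:P) ^+ m * Phi lam.
  by rewrite (PhiE _ ord_max) -/base exprSr mulrA.
rewrite (PhiE _ (emb s)) -hi_emb -mul_polyC /ell polyCB exprSr; ring.
Qed.

(** The moment of [rpoly lam ord_max] is eliminated between the two preceding relations. The matrix
    on the left is a rank-one perturbation of the identity, so its determinant is explicit. *)
Lemma cB_rec m :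
  (1%:M + const_mx (k / (m.+1%:R + k))) *m cB m.+1 =
  diag_mx (\row_s ell s) *m cB m.
Proof.
have mk0 : m.+1%:R + k != 0 by rewrite gt_eqF// ltr_wpDl.
apply/matrixP => s t; rewrite mulmxDl mul1mx mul_diag_mx !mxE.
have := cM_base_max m (ltn_ord t).
have := cM_base_rec m s (ltn_ord t).
set x := cM t (_ * rpoly lam ord_max); set S := \sum__ _.
have -> : \sum_j const_mx (k / (m.+1%:R + k)) s j * cB m.+1 j t = k / (m.+1%:R + k) * S.
  by rewrite mulr_sumr; apply: eq_bigr => j _; rewrite !mxE.
move=> -> /(canRL (mulKf mk0)) ->; field.
by rewrite nat1r.
Qed.

(** Sylvester's identity, from two block triangular factorisations involving the same block
    matrix. *)
Lemma det_add1_mulmx (p q : nat) (A : 'M[R]_(p, q)) (B : 'M[R]_(q, p)) :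
  \det (1%:M + A *m B) = \det (1%:M + B *m A).
Proof.
have h1 : block_mx 1%:M A (- B) 1%:M *m block_mx 1%:M 0 B 1%:M =
    block_mx (1%:M + A *m B) A 0 1%:M.
  by rewrite mulmx_block !mul1mx !mulmx0 !mulmx1 ?add0r addNr.
have h2 : block_mx 1%:M 0 (- B) 1%:M *m block_mx 1%:M A 0 (1%:M + B *m A) =
    block_mx 1%:M A (- B) 1%:M.
  rewrite mulmx_block !mul1mx !mul0mx !mulmx1 !addr0.
  by congr block_mx; rewrite mulNmx addrCA addNr addr0.
have := congr1 determinant h1; rewrite -h2 !det_mulmx !det_ublock !det_lblock !det1.
by rewrite !(mul1r, mulr1).
Qed.

Lemma det_add1_const (p : nat) (c : R) :
  \det (1%:M + const_mx c : 'M[R]_p) = 1 + p%:R * c.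
Proof.
have -> : const_mx c = (const_mx c : 'cV[R]_p) *m (const_mx 1 : 'rV[R]_p).
  by apply/matrixP => i j; rewrite !mxE big_ord1 !mxE mulr1.
rewrite det_add1_mulmx [X in \det X]mx11_scalar det_scalar1 !mxE eqxx; congr (_ + _).
under eq_bigr do rewrite !mxE mul1r.
by rewrite sumr_const card_ord mulr_natl.
Qed.

(** Besides the product of the [ell s], each step contributes (m+1+k) / (m+1+(n+1)k), the quotient
    of the steps of the two Beta values; [n.+1%:R] compensates their quotient 1/(n+1) at m = 0. *)
Lemma det_cB m : \det (cB m) =
  \det (cB 0) * n.+1%:R * (\prod_(s < n) ell s ^+ m) *
  (beta (n.+1%:R * k) m / beta k m).
Proof.
elim: m => [|m IH].
  rewrite !beta0 big1// mulr1 invrK invfM; field.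
  by rewrite gt_eqF//= gt_eqF.
have mk0 : m.+1%:R + k != 0 by rewrite gt_eqF// ltr_wpDl.
have mK0 : m.+1%:R + n.+1%:R * k != 0.
  by rewrite gt_eqF// ltr_wpDl// mulr_gt0.
have := congr1 determinant (cB_rec m).
rewrite !det_mulmx det_add1_const det_diag.
have -> : 1 + n%:R * (k / (m.+1%:R + k)) = (m.+1%:R + n.+1%:R * k) / (m.+1%:R + k).
  by rewrite -(natr1 n); field; rewrite nat1r.
under eq_bigr do rewrite mxE.
have c0 : (m.+1%:R + n.+1%:R * k) / (m.+1%:R + k) != 0 by rewrite mulf_neq0 ?invr_neq0.
move=> /(canRL (mulKf c0)) ->; rewrite IH !betaS.
have -> : \prod_(s < n) ell s ^+ m.+1 = \prod_(s < n) ell s * \prod_(s < n) ell s ^+ m.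
  by rewrite -big_split/=; apply: eq_bigr => s _; rewrite exprS.
have b0 := beta_gt0 m k_gt0.
move: mk0 mK0 b0; set d := _ + k; set D := _ + _ * k => mk0 mK0 b0.
by field; rewrite mk0 mK0 (gt_eqF b0) nat1r pnatr_eq0.
Qed.

Lemma cvg_det (E : nat -> 'M[R]_n) (L : 'M[R]_n) :
  (forall i j, E m i j @[m --> \oo] --> L i j) -> \det (E m) @[m --> \oo] --> \det L.
Proof.
move=> EL; rewrite /determinant.
apply: (cvg_big (op := +%R) (x0 := 0)); first exact: add_continuous.
move=> s _; apply: cvgMr.
elim: (index_enum _) => [|i r IH].
  rewrite big_nil (_ : (fun x => _) = cst 1); first exact: cvg_cst.
  by apply/funext => m; rewrite big_nil.
rewrite big_cons (_ : (fun x => _) =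
    (fun m => E m i (s i) * \prod_(i <- r) E m i (s i))); last first.
  by apply/funext => m; rewrite big_cons.
by apply: cvgM => //; exact: EL.
Qed.

Lemma piA_gt0 : 0 < piA lam.
Proof.
rewrite /piA; apply: prodr_gt0 => i _; apply: prodr_gt0 => j ij.
by rewrite subr_gt0; exact: lamC.
Qed.

Lemma prod_rpoly_piA : \prod_s `|(rpoly lam s).[lam 0 s]| = piA lam ^+ 2.
Proof.
have E s : `|(rpoly lam s).[lam 0 s]| =
    (\prod_(r < n.+1 | (s < r)%N) (lam 0 s - lam 0 r)) *
    (\prod_(r < n.+1 | (r < s)%N) (lam 0 r - lam 0 s)).
  rewrite rpoly_horner normr_prod (bigID (fun r : 'I_n.+1 => (s < r)%N))/=.
  congr (_ * _); (apply: eq_big => r; first by rewrite -val_eqE/=; lia).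
    by move=> /andP[_ sr]; rewrite gtr0_norm// subr_gt0; exact: lamC.
  move=> /andP[rs sr]; rewrite ltr0_norm ?opprB// subr_lt0; apply: lamC.
  by move: rs sr; rewrite -val_eqE/=; lia.
under eq_bigr do rewrite E; rewrite big_split/= expr2 /piA; congr (_ * _).
by rewrite (exchange_big_dep xpredT).
Qed.

(** This is (-1)^(n(n-1)/2): the sign of the product of the q_s(lam_s) over s < n, and also the sign
    between [Qf] and the product of the q_s(nu_s). *)
Definition sgQ : R := \prod_(s < n) (-1) ^+ s.

Lemma rpoly_sign (s : 'I_n.+1) :
  (rpoly lam s).[lam 0 s] = (-1) ^+ s * `|(rpoly lam s).[lam 0 s]|.
Proof.
rewrite rpoly_horner normr_prod.
have -> : (-1) ^+ s = \prod_(r < n.+1 | r != s) (if (r < s)%N then -1 else 1) :> R.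
  rewrite -big_mkcondr/= (eq_bigl (fun r : 'I_n.+1 => (r < s)%N)); last first.
    by move=> r; rewrite -val_eqE/=; lia.
  by rewrite -(big_ord_widen n.+1 (fun=> -1 : R) (ltnW (ltn_ord s))) prodr_const card_ord.
rewrite -big_split/=; apply: eq_bigr => r rs; case: ifP => h.
  by rewrite mulN1r ltr0_norm ?opprK// subr_lt0; exact: lamC.
rewrite mul1r gtr0_norm// subr_gt0; apply: lamC.
by move: rs h; rewrite -val_eqE/=; lia.
Qed.

(** The normalised moment matrices [E m] tend to the diagonal matrix [L], because q_s vanishes at
    lam_t for t <> s. By [det_cB] their determinants are multiples of the one at level 0, and the
    limit of the multipliers is [cnk]. *)
Lemma det_cM_rpoly :
  \det (\matrix_(s < n, t < n) cM t (rpoly lam (emb s))) * cnk n k =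
  sgQ * piA lam `^ (2 * k).
Proof.
pose K := n.+1%:R * k; have K0 : 0 < K by rewrite mulr_gt0.
pose E m : 'M[R]_n := \matrix_(s, t)
  (cM t (('X - base%:P) ^+ m.+1 * rpoly lam (emb s)) / (ell t ^+ m.+1 * beta k m.+1)).
pose L : 'M[R]_n := diag_mx (\row_s ((rpoly lam (emb s)).[hi s] *
   `|(rpoly lam (emb s)).[hi s]| `^ (k - 1) * ell s `^ k)).
have hin (s : 'I_n) : inord s = emb s.
  by apply: val_inj; rewrite /= inordK// ltnS ltnW.
have EL : \det (E m) @[m --> \oo] --> \det L.
  apply: cvg_det => s t.
  have := cM_limit (P := rpoly lam (emb s)) (ltn_ord t); rewrite hin => h.
  have {h} : E m s t @[m --> \oo] --> (rpoly lam (emb s)).[hi t] *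
      `|(rpoly lam (emb t)).[hi t]| `^ (k - 1) * ell t `^ k.
    rewrite (_ : (fun m => _) = (fun m => cM t (('X - base%:P) ^+ (m + 1) *
        rpoly lam (emb s)) / ((hi t - base) ^+ (m + 1) * beta k (m + 1)))); last first.
      by apply/funext => m; rewrite mxE addn1.
    by rewrite (cvg_shiftn 1 (fun m => cM t (('X - base%:P) ^+ m *
        rpoly lam (emb s)) / ((hi t - base) ^+ m * beta k m))).
  congr (_ --> _); rewrite !mxE.
  have [->|st] := eqVneq s t; first by rewrite mulr1n.
  rewrite mulr0n rpoly_horner (bigD1 (emb t))/=; last by rewrite eq_sym.
  by rewrite hi_emb subrr !mul0r.
have Edet m : \det (E m) = \det (cB 0) * n.+1%:R *
    ((m.+1%:R `^ K * beta K m.+1) / (m.+1%:R `^ k * beta k m.+1) ^+ n.+1).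
  have -> : E m = cB m.+1 *m diag_mx (\row_t (ell t ^+ m.+1 * beta k m.+1)^-1).
    by apply/matrixP => s t; rewrite mul_mx_diag !mxE.
  rewrite det_mulmx det_diag (det_cB m.+1) -/K.
  under [X in _ * X]eq_bigr do rewrite mxE.
  rewrite prodfV big_split/= prodr_const card_ord.
  (* Since K = (n+1) k, the powers of m + 1 inserted for Euler's limit formula cancel. *)
  have mK : m.+1%:R `^ K = (m.+1%:R `^ k) ^+ n.+1 :> R.
    by rewrite -powR_mulrn ?powR_ge0// -powRrM mulrC.
  have e0 : \prod_(s < n) ell s ^+ m.+1 != 0.
    by apply/prodf_neq0 => s _; rewrite expf_neq0// gt_eqF// ell_gt0.
  have b0 := lt0r_neq0 (beta_gt0 m.+1 k_gt0).
  have p0 : m.+1%:R `^ k != 0 :> R by rewrite gt_eqF// powR_gt0.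
  rewrite mK (exprMn n.+1) (exprS (beta k m.+1)).
  have bn0 : beta k m.+1 ^+ n != 0 by rewrite expf_neq0.
  have pn0 : (m.+1%:R `^ k) ^+ n.+1 != 0 :> R by rewrite expf_neq0.
  move: e0 b0 bn0 pn0; set u := \prod_(s < n) _; set v := beta k _; set z := _ ^+ n.+1.
  set y := v ^+ n => e0 b0 bn0 pn0.
  by field; rewrite e0 b0 bn0 pn0.
have lim2 : \det (E m) @[m --> \oo] --> \det (cB 0) * cnk n k.
  rewrite (_ : (fun m => _) = (fun m => \det (cB 0) * n.+1%:R *
    ((m.+1%:R `^ K * beta K m.+1) / (m.+1%:R `^ k * beta k m.+1) ^+ n.+1))); last first.
    by apply/funext.
  rewrite /cnk [X in _ --> X](_ : _ = \det (cB 0) * n.+1%:R *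
    (GammaF K / GammaF k ^+ n.+1)); last by rewrite /K; ring.
  apply: cvgMr; apply: cvgM; first exact: cvg_beta_gamma.
  apply: cvgV; first by rewrite expf_neq0// gt_eqF// GammaF_gt0.
  exact: (cvg_comp _ _ (cvg_beta_gamma k_gt0) (@exprn_continuous R n.+1 _)).
have -> : \matrix_(s < n, t < n) cM t (rpoly lam (emb s)) = cB 0.
  by apply/matrixP => s t; rewrite !mxE expr0 mul1r.
rewrite -(cvg_unique (@Rhausdorff R) EL lim2)//.
rewrite det_diag.
pose v s : R := `|(rpoly lam (emb s)).[lam 0 (emb s)]|.
have v0 s : 0 < v s by rewrite normr_gt0 -hi_emb -hin rpoly_hi_neq0.
rewrite (eq_bigr (fun s : 'I_n => (-1) ^+ s * (v s * ell s) `^ k)); last first.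
  move=> s _; rewrite mxE hi_emb -/(v s) rpoly_sign -/(v s).
  rewrite powRM ?ltW// ?ell_gt0// -(mulr_powRB1 (ltW (v0 s)) k_gt0).
  by rewrite !mulrA.
rewrite big_split/= -/sgQ -powR_prod; last first.
  by move=> s _; rewrite mulr_ge0 ?(ltW (v0 s))// ltW// ell_gt0.
congr (_ * _); rewrite powRrM powR_mulrn ?(ltW piA_gt0)//; congr (_ `^ _).
(* The product of the [ell s] is |q| at the last root for the last index, the factor missing from
   the product of the [v s]. *)
rewrite -prod_rpoly_piA big_ord_recr/= big_split/=; congr (_ * _).
rewrite rpoly_horner normr_prod [RHS]big_mkcond [RHS]big_ord_recr/= eqxx mulr1.
apply: eq_bigr => s _; rewrite ifT; last by rewrite -val_eqE/= ltn_eqF.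
rewrite /ell hi_emb ltr0_norm ?opprB// subr_lt0 -hi_emb; exact: base_lt_hi.
Qed.

End Chamber.

(** * The recursion satisfied by the interlacing integral *)

Section CellIntegral.
Variables (R : realType) (n : nat) (k : R) (lam : 'rV[R]_n.+1).
Hypothesis lamC : in_chamber lam.
Notation leb := (@lebesgue_measure R).

Definition cell (nu : 'rV[R]_n) := forall s : 'I_n, lo lam s < nu 0 s < hi lam s.

Definition rowf (nu : nat -> R) : 'rV[R]_n := \row_(i < n) nu i.

Definition J (g : 'rV[R]_n -> R) : R :=
  iint n (lo lam) (hi lam) (fun nu => g (rowf nu) * Wk k lam (rowf nu)).

Lemma cell_distinct nu : cell nu -> distinct_coords nu.
Proof.
move=> nuC i j; wlog ij : i j / (i < j)%N => [wl|_].
  move=> ij; have : (i : nat) != j by rewrite val_eqE.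
  rewrite neq_ltn => /orP[h|h]; first exact: wl.
  by rewrite eq_sym; apply: wl => //; rewrite eq_sym.
have /andP[_ jh] := nuC j; have /andP[il _] := nuC i.
rewrite gt_eqF// (lt_le_trans jh)// (le_trans _ (ltW il))//.
by apply: chamber_le => //; have ? := ltn_ord i; have ? := ltn_ord j; rewrite !inordK; lia.
Qed.

Lemma Wk_wt nu : cell nu -> Wk k lam nu = \prod_(s < n) wt k lam (nu 0 s).
Proof.
move=> nuC; have hE (s : 'I_n) : hi lam s = lam 0 (emb s) by exact: hi_emb.
have pos1 (r : 'I_n.+1) (s : 'I_n) : (r <= s)%N -> 0 < lam 0 r - nu 0 s.
  move=> rs; have /andP[_ h] := nuC s; rewrite subr_gt0 (lt_le_trans h)// hE.
  exact: chamber_le.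
have pos2 (r : 'I_n.+1) (s : 'I_n) : (s < r)%N -> 0 < nu 0 s - lam 0 r.
  move=> rs; have /andP[h _] := nuC s; rewrite subr_gt0 (le_lt_trans _ h)//.
  by apply: chamber_le => //; rewrite inordK// ltnS.
rewrite /Wk /wt -powR_prod//; congr (_ `^ _).
have E (r : 'I_n.+1) : (\prod_(s < n | (r <= s)%N) (lam 0 r - nu 0 s)) *
    (\prod_(s < n | (s < r)%N) (nu 0 s - lam 0 r)) =
    \prod_(s < n) `|nu 0 s - lam 0 r|.
  rewrite [RHS](bigID (fun s : 'I_n => (r <= s)%N))/=; congr (_ * _).
    by apply: eq_bigr => s rs; rewrite distrC gtr0_norm// pos1.
  apply: eq_big => s; first by rewrite ltnNge.
  by move=> rs; rewrite gtr0_norm// pos2.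
rewrite (eq_bigr _ (fun r _ => E r)) exchange_big/=; apply: eq_bigr => s _.
rewrite /Phi horner_prod normr_prod; apply: eq_bigr => r _.
by rewrite hornerXsubC.
Qed.

Hypothesis k_gt0 : 0 < k.

(* [g] is, on the cell, a finite sum of products of one-variable polynomials,
   and [v] is the corresponding sum of products of one-variable integrals. *)
Definition pfJ (g : 'rV[R]_n -> R) (v : R) : Prop :=
  exists s : seq (R * ('I_n -> {poly R})),
    (forall nu, cell nu -> g nu = \sum_(t <- s) t.1 * \prod_i (t.2 i).[nu 0 i]) /\
    v = \sum_(t <- s) t.1 * \prod_(i < n) cM k lam i (t.2 i).

Lemma pfJ_prodsum g v : pfJ g v -> exists s,
  [/\ factors_int (lo lam) (hi lam) n s, v = prodsum_int (lo lam) (hi lam) n s &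
   forall nu, in_cell (lo lam) (hi lam) n nu ->
     cell (rowf nu) /\ g (rowf nu) * Wk k lam (rowf nu) = prodsum n s nu].
Proof.
move=> [s [gs ->]].
(* [iint] numbers its variables by nat; the default 0 is taken only at indices outside ['I_n]. *)
pose u (P : 'I_n -> {poly R}) (i : nat) (x : R) : R :=
  if insub i is Some i' then (P i').[x] * wt k lam x else 0.
have uE P (i : 'I_n) x : u P i x = (P i).[x] * wt k lam x by rewrite /u valK.
exists [seq (t.1, u t.2) | t <- s]; split.
- move=> t /(List.in_map_iff _ _ _)[t' [<- _]] i ni /=.
  rewrite (_ : u _ _ = fun x => (t'.2 (Ordinal ni)).[x] * wt k lam x).
    exact: wt_integrable.
  by apply/funext => x; rewrite -(uE _ (Ordinal ni)).
- rewrite /prodsum_int big_map; apply: eq_bigr => t _ /=; congr (_ * _).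
  by apply: eq_bigr => i _; apply: eq_Rintegral => x _; apply/esym/uE.
- move=> nu nuC; have rC : cell (rowf nu).
    by move=> i; rewrite mxE; exact: nuC.
  split=> //; rewrite gs// Wk_wt// /prodsum big_map mulr_suml; apply: eq_bigr => t _ /=.
  rewrite -mulrA -big_split/=; congr (_ * _); apply: eq_bigr => i _.
  by rewrite uE mxE.
Qed.

Lemma pfJ_J g v : pfJ g v -> J g = v.
Proof.
move=> /pfJ_prodsum[s [si -> gs]]; apply: iint_prodsum si _; first exact: lo_hi.
by move=> nu /gs[].
Qed.

Lemma pfJ_ext g g' v : (forall nu, cell nu -> g nu = g' nu) -> pfJ g v -> pfJ g' v.
Proof. by move=> gg' [s [gs vs]]; exists s; split => // nu nuC; rewrite -gg'// gs. Qed.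

Lemma pfJ_prod (P : 'I_n -> {poly R}) :
  pfJ (fun nu => \prod_i (P i).[nu 0 i]) (\prod_(i < n) cM k lam i (P i)).
Proof. by exists [:: (1, P)]; split => [nu _|]; rewrite big_seq1 mul1r. Qed.

Lemma pfJD g g' v v' : pfJ g v -> pfJ g' v' -> pfJ (fun nu => g nu + g' nu) (v + v').
Proof.
move=> [s [gs ->]] [s' [gs' ->]]; exists (s ++ s'); rewrite big_cat/=; split => //.
by move=> nu nuC; rewrite big_cat/= gs// gs'.
Qed.

Lemma pfJZ c g v : pfJ g v -> pfJ (fun nu => c * g nu) (c * v).
Proof.
move=> [s [gs ->]]; exists [seq (c * t.1, t.2) | t <- s].
rewrite big_map mulr_sumr; split => [nu nuC|]; last by apply: eq_bigr => t _; rewrite mulrA.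
by rewrite big_map gs// mulr_sumr; apply: eq_bigr => t _; rewrite mulrA.
Qed.

Lemma pfJ_sum (I : Type) (r : seq I) (P : pred I) g v :
  (forall i, P i -> pfJ (g i) (v i)) ->
  pfJ (fun nu => \sum_(i <- r | P i) g i nu) (\sum_(i <- r | P i) v i).
Proof.
move=> gv; elim: r => [|i r IH].
  exists [::]; rewrite !big_nil; split => // nu _; by rewrite !big_nil.
rewrite big_cons; case: ifP => Pi.
  by apply: pfJ_ext (pfJD (gv i Pi) IH) => nu _; rewrite big_cons Pi.
by apply: pfJ_ext IH => nu _; rewrite big_cons Pi.
Qed.

Lemma pfJ_poly p : is_poly p -> exists v, pfJ p v.
Proof.
move=> [s ps]; exists (\sum_(c <- s) c.2 * \prod_(i < n) cM k lam i ('X ^+ c.1 i)).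
have h := @pfJ_sum _ s xpredT (fun c nu => c.2 * \prod_i ('X ^+ c.1 i).[nu 0 i])
  (fun c => c.2 * \prod_(i < n) cM k lam i ('X ^+ c.1 i)).
apply: pfJ_ext (h _); last by move=> c _; apply: pfJZ; exact: pfJ_prod.
move=> nu _; rewrite ps; apply: eq_bigr => c _; congr (_ * _).
by apply: eq_bigr => i _; rewrite hornerXn.
Qed.

Lemma J_lin : lin_on_poly J.
Proof.
move=> c p q /pfJ_poly[v pv] /pfJ_poly[w qw].
by rewrite (pfJ_J pv) (pfJ_J qw); apply: pfJ_J; apply: pfJD => //; exact: pfJZ.
Qed.

End CellIntegral.

Section PairSums.
Variable R : realType.

Lemma sum_pairs_recr n (F : 'I_n.+1 -> 'I_n.+1 -> R) :
  \sum_j \sum_(i | i != j) F i j =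
  \sum_(j < n) \sum_(i < n | i != j) F (emb i) (emb j) +
  \sum_(i < n) (F (emb i) ord_max + F ord_max (emb i)).
Proof.
have embNmax (i : 'I_n) : (emb i != ord_max) by rewrite -val_eqE/= ltn_eqF.
rewrite big_ord_recr/= big_split/= [X in _ = _ + X]addrC addrA; congr (_ + _).
  rewrite -big_split/=; apply: eq_bigr => j _.
  rewrite big_mkcond big_ord_recr/= eq_sym embNmax; congr (_ + _).
  by rewrite [RHS]big_mkcond; apply: eq_bigr => i _; rewrite -!val_eqE.
rewrite big_mkcond big_ord_recr/= eqxx addr0.
by apply: eq_bigr => i _; rewrite embNmax.
Qed.

(** The set where [D] is maximal is stable under transpositions, which generate the group. In degree
    0 the recursion on the orbit reduces to this hypothesis. *)
Lemma harmonic_const n (D : 'S_n -> R) :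
  (forall s, \sum_j \sum_(i | i != j) (D s - D (tperm i j * s)%g) = 0) ->
  forall s, D s = D 1%g.
Proof.
move=> Dh; pose t := [arg max_(t > 1%g) D t]%O.
have tmax u : D u <= D t by rewrite /t; case: arg_maxP => //= v _; apply.
have step u : D u = D t -> forall i j, D (tperm i j * u)%g = D t.
  move=> ut i j; have [->|ij] := eqVneq i j; first by rewrite tperm1 mul1g.
  have ge0 i' j' : 0 <= D u - D (tperm i' j' * u)%g by rewrite ut subr_ge0.
  have /eqP := Dh u; rewrite psumr_eq0 => [/allP/(_ j)|j' _]; last exact: sumr_ge0.
  rewrite mem_index_enum => /(_ isT)/=; rewrite psumr_eq0 => [/allP/(_ i)|i' _//].
  by rewrite mem_index_enum ij/= subr_eq0 ut => /(_ isT)/eqP.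
suff all u : D u = D t by move=> s; rewrite !all.
rewrite -(mulgKV t u); case: (prod_tpermP (u * t^-1)%g) => ts -> _.
elim: ts => [|p ts IH]; first by rewrite big_nil mul1g.
by rewrite big_cons -mulgA; exact: step.
Qed.

End PairSums.

(** * Algebraic identities for the kernel Q *)

Section InterlacingKernel.
Variables (R : realType) (n : nat).
Implicit Types (x : 'rV[R]_n.+1) (nu : 'rV[R]_n).

Definition Qr x nu : R := \prod_(s < n) (rpoly x (emb s)).[nu 0 s].

Lemma Qf_Qr x nu : Qf x nu = sgQ R n * Qr x nu.
Proof.
rewrite /Qf big_split/= (exchange_big_dep xpredT)//=.
rewrite [X in _ * X](exchange_big_dep xpredT)//= -big_split/=.
rewrite /sgQ /Qr -big_split/=; apply: eq_bigr => s _.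
rewrite rpoly_horner [X in _ = _ * X](bigID (fun r : 'I_n.+1 => (r < s)%N))/=.
rewrite [X in _ = _ * (_ * X)](eq_bigl (fun r : 'I_n.+1 => (s < r)%N)); last first.
  by move=> r; rewrite -val_eqE/=; lia.
rewrite mulrA; congr (_ * _).
rewrite [X in _ = _ * X](eq_bigl (fun r : 'I_n.+1 => (r < s)%N)); last first.
  by move=> r; rewrite -val_eqE/=; lia.
have -> : (-1) ^+ s = \prod_(r < n.+1 | (r < s)%N) -1 :> R.
  rewrite -(big_ord_widen n.+1 (fun=> -1 : R)) ?prodr_const ?card_ord//.
  by rewrite (leq_trans (ltnW (ltn_ord s))).
rewrite -big_split/=; apply: eq_bigr => r _.
by rewrite mulN1r opprB.
Qed.

Lemma rpoly_perm x (t : 'S_n.+1) s : rpoly (permrow t x) s = rpoly x (t s).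
Proof.
rewrite /rpoly [RHS](reindex_inj (@perm_inj _ t))/=.
by apply: eq_big => [r|r _]; [rewrite (inj_eq perm_inj)|rewrite permrowE].
Qed.

Lemma swapcE N (i j : 'I_N) (y : 'rV[R]_N) : swapc i j y = permrow (tperm i j) y.
Proof. by apply/rowP => l; rewrite !mxE. Qed.

Lemma emb_inj : injective (@emb n).
Proof. by move=> i j /(congr1 val) /= /val_inj. Qed.

Lemma tperm_emb (i j s : 'I_n) : tperm (emb i) (emb j) (emb s) = emb (tperm i j s).
Proof.
by case: tpermP => [/emb_inj->|/emb_inj->|]; rewrite ?tpermL ?tpermR// => si sj;
   rewrite tpermD//; apply/eqP => h; [apply: si|apply: sj]; rewrite h.
Qed.

Lemma Qr_swap x nu (i j : 'I_n) :
  Qr (swapc (emb i) (emb j) x) nu = Qr x (swapc i j nu).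
Proof.
rewrite /Qr [RHS](reindex_inj (@perm_inj _ (tperm i j)))/=.
apply: eq_bigr => s _.
by rewrite swapcE rpoly_perm tperm_emb mxE tpermK.
Qed.

(* [Phi^`() = \sum_r rpoly x r] turns the [k * Phi^`()] term of the vanishing integral
   into a sum of these products. *)
Definition Qrep x nu (r : 'I_n.+1) (j : 'I_n) : R :=
  (\prod_(s < n | s != j) (rpoly x (emb s)).[nu 0 s]) * (rpoly x r).[nu 0 j].

Lemma Qrep_diag x nu j : Qrep x nu (emb j) j = Qr x nu.
Proof. by rewrite /Qrep /Qr [RHS](bigD1 j)//= mulrC. Qed.

Lemma Qrep_max x nu j : Qrep x nu ord_max j = Qr (swapc (emb j) ord_max x) nu.
Proof.
rewrite /Qrep /Qr [RHS](bigD1 j)//= mulrC swapcE rpoly_perm tpermL; congr (_ * _).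
apply: eq_bigr => s sj; rewrite rpoly_perm tpermD//.
  by rewrite (inj_eq emb_inj) eq_sym.
by rewrite -val_eqE/= gtn_eqF.
Qed.

(** A single replacement makes one q occur twice and gives no permuted kernel. The two symmetric
    replacements together do, up to a divided difference of the kernel in [nu]; with the common
    factors set apart this is a rational identity in x_i, x_j, nu_i, nu_j. *)
Lemma Qrep_pair x nu (i j : 'I_n) : i != j -> nu 0 j != nu 0 i ->
  Qrep x nu (emb i) j + Qrep x nu (emb j) i =
  Qr x nu + Qr x (swapc i j nu) -
  (x 0 (emb j) - x 0 (emb i)) / (nu 0 j - nu 0 i) * (Qr x nu - Qr x (swapc i j nu)).
Proof.
move=> ij nuij; have ji : j != i by rewrite eq_sym.
have eij : emb i != emb j by rewrite (inj_eq emb_inj).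
pose P y := \prod_(r | (r != emb i) && (r != emb j)) (y - x 0 r).
have ri y : (rpoly x (emb i)).[y] = (y - x 0 (emb j)) * P y.
  by rewrite rpoly_horner (bigD1 (emb j))//= eq_sym.
have rj y : (rpoly x (emb j)).[y] = (y - x 0 (emb i)) * P y.
  rewrite rpoly_horner (bigD1 (emb i))//=; congr (_ * _).
  by apply: eq_bigl => r; rewrite andbC.
pose Z := \prod_(s < n | (s != j) && (s != i)) (rpoly x (emb s)).[nu 0 s].
have Q1 : Qr x nu = (rpoly x (emb j)).[nu 0 j] * ((rpoly x (emb i)).[nu 0 i] * Z).
  by rewrite /Qr (bigD1 j)//= (bigD1 i).
have Q2 : Qr x (swapc i j nu) = (rpoly x (emb j)).[nu 0 i] * ((rpoly x (emb i)).[nu 0 j] * Z).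
  rewrite /Qr (bigD1 j)//= (bigD1 i)//= !mxE tpermR tpermL; congr (_ * (_ * _)).
  apply: eq_bigr => s /andP[sj si]; rewrite mxE tpermD//.
    by rewrite eq_sym.
  by rewrite eq_sym.
have Q3 : Qrep x nu (emb i) j = (rpoly x (emb i)).[nu 0 i] * Z * (rpoly x (emb i)).[nu 0 j].
  by rewrite /Qrep (bigD1 i).
have Q4 : Qrep x nu (emb j) i = (rpoly x (emb j)).[nu 0 j] * Z * (rpoly x (emb j)).[nu 0 i].
  rewrite /Qrep (bigD1 j)//=; congr (_ * _ * _).
  by apply: eq_bigl => s; rewrite andbC.
rewrite Q1 Q2 Q3 Q4 !ri !rj; field.
by rewrite subr_eq0.
Qed.

(** Replacements by the last root are exact reflections of [x], the others are taken in pairs. The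
    divided differences left over have the shape of the reflection terms of the Dunkl operators in n
    variables, which they are meant to cancel. *)
Lemma Qrep_sum x nu : distinct_coords nu ->
  \sum_j \sum_r Qrep x nu r j =
  2^-1 * (\sum_j \sum_(i : 'I_n.+1 | i != j) (Qr x nu + Qr (swapc i j x) nu)) -
  2^-1 * \sum_j \sum_(i : 'I_n | i != j)
    (x 0 (emb j) - x 0 (emb i)) / (nu 0 j - nu 0 i) * (Qr x nu - Qr x (swapc i j nu)).
Proof.
move=> dnu; rewrite sum_pairs_recr mulrDr addrAC -mulrBr.
under [X in _ = _ + 2^-1 * X]eq_bigr do rewrite [swapc ord_max _ x]swapcC.
have -> : 2^-1 * \sum_(i < n) (Qr x nu + Qr (swapc (emb i) ord_max x) nu +
     (Qr x nu + Qr (swapc (emb i) ord_max x) nu)) =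
     \sum_(i < n) (Qr x nu + Qr (swapc (emb i) ord_max x) nu).
  by rewrite mulr_sumr; apply: eq_bigr => i _; lra.
rewrite -sumrB.
have -> : \sum_(j < n) (\sum_(i < n | i != j) (Qr x nu + Qr (swapc (emb i) (emb j) x) nu) -
     \sum_(i < n | i != j) (x 0 (emb j) - x 0 (emb i)) / (nu 0 j - nu 0 i) *
         (Qr x nu - Qr x (swapc i j nu))) =
   \sum_(j < n) \sum_(i < n | i != j) (Qrep x nu (emb i) j + Qrep x nu (emb j) i).
  apply: eq_bigr => j _; rewrite -sumrB; apply: eq_bigr => i ij.
  by rewrite Qrep_pair// ?Qr_swap// dnu// eq_sym.
rewrite -(sum_pairs_sym (fun i j => Qrep x nu (emb i) j)) -big_split/=.
apply: eq_bigr => j _; rewrite big_ord_recr/= Qrep_max (bigD1 j)//= Qrep_diag.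
by rewrite addrAC addrC.
Qed.

End InterlacingKernel.

(** * Euler identity for the alternating integral *)

Section Recursion.
Variables (R : realType) (n : nat) (k : R) (lam : 'rV[R]_n.+1).
Variable mut : 'rV[R]_n -> probability (n.-tuple R) R.
Hypothesis lamC : in_chamber lam.
Hypothesis k_gt0 : 0 < k.
Hypothesis mutV : is_Vk_measures k mut.

Definition alt (x : 'rV[R]_n.+1) (G : 'rV[R]_n -> R) (nu : 'rV[R]_n) : R :=
  \sum_(w : 'S_n) sgn w * Qr x (permrow w nu) * G (permrow w nu).

(** [x] runs through the orbit of [lam] and enters the kernel alone; the cell and the weight remain
    those of [lam]. *)
Definition U (x : 'rV[R]_n.+1) (G : 'rV[R]_n -> R) : R := J k lam (alt x G).

Lemma is_poly_permrow (w : 'S_n) (p : 'rV[R]_n -> R) : is_poly p ->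
  is_poly (fun nu => p (permrow w nu)).
Proof.
move=> ip; apply: is_poly_comp ip => i.
rewrite (_ : (fun nu => _) = (fun nu : 'rV[R]_n => nu 0 (w i))).
  exact: is_poly_coord.
by apply/funext => nu; rewrite permrowE.
Qed.

Lemma is_poly_horner (P : {poly R}) (i : 'I_n) : is_poly (fun nu : 'rV[R]_n => P.[nu 0 i]).
Proof.
rewrite (_ : (fun nu => _) = (fun nu : 'rV[R]_n => \sum_(j < size P) P`_j * nu 0 i ^+ j)).
  by apply: is_poly_sum => j _; apply/is_polyZ/is_polyX/is_poly_coord.
by apply/funext => nu; rewrite horner_coef.
Qed.

Lemma is_poly_Qr x : is_poly (@Qr R n x).
Proof. by apply: is_poly_prod => s _; exact: is_poly_horner. Qed.

Lemma is_poly_alt x G : is_poly G -> is_poly (alt x G).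
Proof.
move=> ip; apply: is_poly_sum => w _; apply: is_polyM.
  by apply/is_polyZ/is_poly_permrow/is_poly_Qr.
exact: is_poly_permrow.
Qed.

Lemma U_lin x : lin_on_poly (U x).
Proof.
move=> c p q ip iq; rewrite /U.
rewrite (_ : alt x _ = (fun nu => c * alt x p nu + alt x q nu)); last first.
  apply/funext => nu; rewrite /alt mulr_sumr -big_split/=; apply: eq_bigr => w _.
  by rewrite mulrDr mulrCA.
by apply: (J_lin lamC k_gt0); exact: is_poly_alt.
Qed.

Lemma UV_lin x : lin_on_poly (fun h => U x (Vop mut h)).
Proof.
move=> c p q ip iq.
rewrite -(U_lin x c (Vop_poly mutV ip) (Vop_poly mutV iq)); congr (U x _).
by apply/funext => nu; exact: (Vop_lin mutV).
Qed.

Lemma sgnM (v w : 'S_n) : sgn (v * w)%g = sgn v * sgn w :> R.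
Proof. by rewrite /sgn odd_permM signr_addb. Qed.

Lemma sgn_tperm (i j : 'I_n) : i != j -> sgn (tperm i j) = -1 :> R.
Proof. by rewrite /sgn odd_tperm => ->. Qed.

(* Reindexing [w] by a transposition moves the reflection from [G] to the kernel. *)
Lemma alt_swap x G nu (i j : 'I_n) (c : R) : i != j ->
  \sum_(w : 'S_n) sgn w * Qr x (permrow w nu) *
    (c / (permrow w nu 0 j - permrow w nu 0 i) * G (swapc i j (permrow w nu))) =
  \sum_(w : 'S_n) sgn w * Qr x (swapc i j (permrow w nu)) *
    (c / (permrow w nu 0 j - permrow w nu 0 i) * G (permrow w nu)).
Proof.
move=> ij; rewrite (reindex_inj (mulgI (tperm i j)))/=; apply: eq_bigr => w _.
rewrite sgnM sgn_tperm// swapc_permrow swapc_permrow mulgA tperm2 mul1g.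
rewrite !permrowE !permM tpermL tpermR -(opprB (nu 0 (w j))) invrN.
by ring.
Qed.

Lemma pairs_antisym (x : 'rV[R]_n.+1) (mu : 'rV[R]_n) (F : 'I_n -> 'I_n -> R) :
  (forall i j, F i j = F j i) ->
  \sum_j x 0 (emb j) * (\sum_(i | i != j) F i j / (mu 0 j - mu 0 i)) =
  2^-1 * \sum_j \sum_(i | i != j)
    (x 0 (emb j) - x 0 (emb i)) / (mu 0 j - mu 0 i) * F i j.
Proof.
move=> FC; under eq_bigr do rewrite mulr_sumr.
rewrite sum_pairs_sym; congr (_ * _); apply: eq_bigr => j _; apply: eq_bigr => i _.
by rewrite (FC j i) -(opprB (mu 0 j)) invrN; ring.
Qed.

(** In the products that make up kernel times [G], the factor at j is replaced by the polynomial of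
    [cM_parts], so the resulting sum [Z] integrates to 0. Its Phi part yields the derivatives of
    [G], its k Phi' part the [Qrep] terms, whose divided differences cancel the reflections in the
    Dunkl relations; hence [Z] equals the integrand [Y] on the cell. The sign of a transposition
    later turns the + before the reflected terms into the - of [Vop_monom_rec]. *)
Lemma U_euler_monom x (b : 'I_n -> nat) : Phi x = Phi lam ->
  U x (fun nu => (\sum_i b i)%:R * Vop mut (monom b) nu -
     \sum_j x 0 (emb j) * Vop mut (pd j (monom b)) nu) +
  k / 2 * (\sum_j \sum_(i : 'I_n.+1 | i != j)
     (U x (Vop mut (monom b)) + U (swapc i j x) (Vop mut (monom b)))) = 0.
Proof.
move=> Phix; set d := (\sum_i b i)%N; set G := Vop mut (monom b).
have Ghp : is_hpoly d G by exact: (Vop_hpoly mutV (is_hpoly_monom b)).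
have Gp := is_hpoly_poly Ghp.
have [s [_ Gs]] := Ghp.
pose H (nu : 'rV[R]_n) : R := d%:R * G nu - \sum_j x 0 (emb j) * Vop mut (pd j (monom b)) nu.
have Hp : is_poly H.
  apply: is_polyD; first exact: is_polyZ.
  rewrite (_ : (fun nu => _) =
     (fun nu => -1 * \sum_j x 0 (emb j) * Vop mut (pd j (monom b)) nu)).
    apply: is_polyZ; apply: is_poly_sum => j _; apply: is_polyZ.
    exact/(Vop_poly mutV)/is_poly_pd/is_poly_monom.
  by apply/funext => nu; rewrite mulN1r.
pose Pz (j : 'I_n) (a : 'I_n -> nat) (s : 'I_n) : {poly R} :=
  if s == j then ('X ^+ a j)^`() * Phi lam + k *: ('X ^+ a j * (Phi lam)^`())
  else rpoly x (emb s) * 'X ^+ a s.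
(* The variable nu_t is coordinate [(w^-1)%g t] of [permrow w nu]; writing the products in [nu]
   itself lets [pfJ] apply. *)
pose Z (nu : 'rV[R]_n) : R := \sum_(w : 'S_n) \sum_j \sum_(c <- s)
  (sgn w * c.2) * \prod_t (Pz j c.1 ((w^-1)%g t)).[nu 0 t].
have Z0 : pfJ k lam Z 0.
  pose v (w : 'S_n) j (c : ('I_n -> nat) * R) := (sgn w * c.2) *
    \prod_(t < n) cM k lam t (Pz j c.1 ((w^-1)%g t)).
  have -> : 0 = \sum_(w : 'S_n) \sum_(j < n) \sum_(c <- s) v w j c :> R.
    rewrite big1// => w _; rewrite big1// => j _; rewrite big1// => c _.
    rewrite /v (bigD1 (w j))//= permK /Pz eqxx cM_parts// mul0r mulr0//.
  by apply: pfJ_sum => w _; apply: pfJ_sum => j _; apply: pfJ_sum => c _;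
     apply: pfJZ; exact: pfJ_prod.
pose Y (nu : 'rV[R]_n) : R := alt x H nu + k / 2 * (\sum_j \sum_(i : 'I_n.+1 | i != j)
     (alt x G nu + alt (swapc i j x) G nu)).
have altp y : is_poly (alt y G) by exact: is_poly_alt.
have -> : U x H + k / 2 * (\sum_j \sum_(i : 'I_n.+1 | i != j)
     (U x G + U (swapc i j x) G)) = J k lam Y.
  have Jl := J_lin lamC k_gt0.
  rewrite /Y lin_polyD//; last 2 first.
  - exact: is_poly_alt.
  - apply: is_polyZ; apply: is_poly_sum => j _; apply: is_poly_sum => i _.
    exact: is_polyD.
  rewrite lin_polyZ//; last first.
    by apply: is_poly_sum => j _; apply: is_poly_sum => i _; exact: is_polyD.
  congr (_ + _ * _); rewrite lin_poly_big//; last first.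
    by move=> j; apply: is_poly_sum => i _; exact: is_polyD.
  apply: eq_bigr => j _; rewrite lin_poly_big//; last by move=> i; exact: is_polyD.
  by apply: eq_bigr => i _; rewrite lin_polyD.
apply: (pfJ_J lamC k_gt0); apply: pfJ_ext Z0 => nu nuC.
have dnu := cell_distinct lamC nuC.
have dw (w : 'S_n) : distinct_coords (permrow w nu) by exact: distinct_permrow.
have zE (w : 'S_n) (j : 'I_n) (mu := permrow w nu) :
    \sum_(c <- s) (sgn w * c.2) * \prod_t (Pz j c.1 ((w^-1)%g t)).[nu 0 t] =
    sgn w * (Qr x mu * ((mu 0 j - x 0 (emb j)) * pd j G mu) +
             k * (G mu * \sum_r Qrep x mu r j)).
  pose Rj := \prod_(s < n | s != j) (rpoly x (emb s)).[mu 0 s].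
  have -> : \sum_r Qrep x mu r j = Rj * ((Phi lam)^`()).[mu 0 j].
    by rewrite -Phix deriv_Phi horner_sum mulr_sumr.
  have -> : Qr x mu * ((mu 0 j - x 0 (emb j)) * pd j G mu) =
      Rj * (Phi lam).[mu 0 j] * pd j G mu.
    rewrite -Phix (PhiE _ (emb j)) hornerM hornerXsubC /Qr (bigD1 j)//= -/Rj.
    by ring.
  rewrite (pdE _ _ Gs) Gs mulr_sumr mulr_suml mulr_sumr -big_split/= mulr_sumr.
  apply: eq_bigr => c _; rewrite -mulrA; congr (_ * _).
  have -> : \prod_t (Pz j c.1 ((w^-1)%g t)).[nu 0 t] = \prod_t (Pz j c.1 t).[mu 0 t].
    rewrite (reindex_inj (@perm_inj _ w))/=; apply: eq_bigr => t _.
    by rewrite permK permrowE.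
  pose M := \prod_(t < n | t != j) mu 0 t ^+ c.1 t.
  rewrite (bigD1 j)//= /Pz eqxx.
  rewrite (eq_bigr (fun t => (rpoly x (emb t)).[mu 0 t] * mu 0 t ^+ c.1 t)); last first.
    by move=> t /negPf ->; rewrite hornerM hornerXn.
  rewrite big_split/= -/Rj -/M.
  have -> : monom c.1 mu = mu 0 j ^+ c.1 j * M by rewrite /monom (bigD1 j).
  have -> : monom (decr j c.1) mu = mu 0 j ^+ (c.1 j).-1 * M.
    rewrite /monom (bigD1 j)//= /decr eqxx; congr (_ * _).
    by apply: eq_bigr => t /negPf ->.
  rewrite hornerD hornerZ !hornerM derivXn hornerMn !hornerXn -mulr_natl.
  by ring.
rewrite /Z; under eq_bigr do under eq_bigr do rewrite zE.
rewrite /Y /alt.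
(* Euler's identity replaces the degree by sum_j mu_j d_j, and the Dunkl relation replaces V d_j by
   d_j V plus reflections. *)
have HE (w : 'S_n) (mu := permrow w nu) : H mu =
    \sum_j (mu 0 j - x 0 (emb j)) * pd j G mu -
    k * (2^-1 * \sum_j \sum_(i | i != j)
    (x 0 (emb j) - x 0 (emb i)) / (mu 0 j - mu 0 i) * (G mu - G (swapc i j mu))).
  rewrite /H -(euler_hpoly mu Ghp).
  under [X in _ - X = _]eq_bigr do rewrite (Vop_dunkl mutV _ (is_poly_monom b) (dw w)) mulrDr.
  rewrite big_split/= opprD addrA -sumrB.
  rewrite -pairs_antisym; last by move=> i j; rewrite swapcC.
  congr (_ - _); first by apply: eq_bigr => j _; rewrite mulrBl.
  by rewrite mulr_sumr; apply: eq_bigr => j _; rewrite mulrCA.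
pose D (w : 'S_n) i j : R :=
  (x 0 (emb j) - x 0 (emb i)) / (permrow w nu 0 j - permrow w nu 0 i).
pose A (w : 'S_n) : R := \sum_j (permrow w nu 0 j - x 0 (emb j)) * pd j G (permrow w nu).
have swapsum m (F : 'S_n -> 'I_m -> 'I_m -> R) :
    \sum_j \sum_(i | i != j) \sum_(w : 'S_n) F w i j =
    \sum_(w : 'S_n) \sum_j \sum_(i | i != j) F w i j.
  rewrite [RHS]exchange_big/=; apply: eq_bigr => j _.
  by rewrite [RHS]exchange_big.
have pull m (c : R) (F : 'I_m -> 'I_m -> R) :
    \sum_j \sum_(i | i != j) c * F i j = c * \sum_j \sum_(i | i != j) F i j.
  by rewrite mulr_sumr; apply: eq_bigr => j _; rewrite mulr_sumr.
have E1 : \sum_(w : 'S_n) sgn w * Qr x (permrow w nu) * H (permrow w nu) =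
    \sum_(w : 'S_n) sgn w * Qr x (permrow w nu) * A w -
    k * (2^-1 * \sum_j \sum_(i | i != j) \sum_(w : 'S_n)
      sgn w * Qr x (permrow w nu) *
        (D w i j * (G (permrow w nu) - G (swapc i j (permrow w nu))))).
  rewrite swapsum mulrA mulr_sumr -sumrB; apply: eq_bigr => w _.
  by rewrite HE pull /A /D; ring.
have E2 i j : i != j -> \sum_(w : 'S_n) sgn w * Qr x (permrow w nu) *
      (D w i j * (G (permrow w nu) - G (swapc i j (permrow w nu)))) =
    \sum_(w : 'S_n) (sgn w * G (permrow w nu)) *
      (D w i j * (Qr x (permrow w nu) - Qr x (swapc i j (permrow w nu)))).
  move=> ij; under eq_bigr do rewrite mulrBr mulrBr.
  rewrite sumrB alt_swap// -sumrB; apply: eq_bigr => w _.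
  by rewrite /D; ring.
rewrite E1 (eq_bigr _ (fun j _ => eq_bigr _ (fun i ij => E2 i j ij))) swapsum.
rewrite (eq_bigr (fun j => \sum_(i : 'I_n.+1 | i != j) \sum_(w : 'S_n)
    (sgn w * G (permrow w nu)) *
    (Qr x (permrow w nu) + Qr (swapc i j x) (permrow w nu)))); last first.
  move=> j _; apply: eq_bigr => i _; rewrite -big_split/=; apply: eq_bigr => w _.
  by ring.
rewrite swapsum mulrA !mulr_sumr -sumrB -big_split/=; apply: eq_bigr => w _.
rewrite !pull -mulr_sumr big_split/= -!mulr_sumr Qrep_sum; last exact: dw.
by rewrite -/(A w) /D; field.
Qed.

(** With a vector field in place of a degree the identity is linear in [h], so it extends from
    monomials to the non-homogeneous restrictions of monomials to a hyperplane. *)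
Lemma U_euler x (h : 'rV[R]_n -> R) : Phi x = Phi lam -> is_poly h ->
  U x (Vop mut (fun nu => \sum_j (nu 0 j - x 0 (emb j)) * pd j h nu)) +
  k / 2 * (\sum_j \sum_(i : 'I_n.+1 | i != j)
     (U x (Vop mut h) + U (swapc i j x) (Vop mut h))) = 0.
Proof.
move=> Phix [s hs].
pose P (c : ('I_n -> nat) * R) (nu : 'rV[R]_n) : R :=
  \sum_j (nu 0 j - x 0 (emb j)) * pd j (monom c.1) nu.
have Pp c : is_poly (P c).
  apply: is_poly_sum => j _; apply: is_polyM; last exact/is_poly_pd/is_poly_monom.
  by apply: is_polyD; [exact: is_poly_coord|exact: is_poly_cst].
have E1 : (fun nu : 'rV[R]_n => \sum_j (nu 0 j - x 0 (emb j)) * pd j h nu) =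
    (fun nu => \sum_(c <- s) c.2 * P c nu).
  apply/funext => nu; rewrite /P.
  under eq_bigr do rewrite (pdE _ _ hs) mulr_sumr.
  rewrite exchange_big/=; apply: eq_bigr => c _; rewrite mulr_sumr.
  by apply: eq_bigr => j _; rewrite mulrCA pd_monom.
have E2 y : U y (Vop mut h) = \sum_(c <- s) c.2 * U y (Vop mut (monom c.1)).
  rewrite -(lin_poly_sum s snd (UV_lin y) (fun c => is_poly_monom c.1)).
  by congr (U y (Vop mut _)); apply/funext.
rewrite E1 (lin_poly_sum s snd (UV_lin x) Pp).
under eq_bigr => c _.
  have -> : U x (Vop mut (P c)) = - (k / 2 * (\sum_j \sum_(i : 'I_n.+1 | i != j)
      (U x (Vop mut (monom c.1)) + U (swapc i j x) (Vop mut (monom c.1))))).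
    apply/eqP; rewrite -addr_eq0; apply/eqP.
    rewrite -[RHS](U_euler_monom c.1 Phix); congr (U x _ + _); apply/funext => nu.
    have -> : P c = (fun nu => (\sum_i c.1 i)%:R * monom c.1 nu +
        \sum_j (- x 0 (emb j)) * pd j (monom c.1) nu).
      apply/funext => mu; rewrite -(euler_hpoly mu (is_hpoly_monom c.1)) -big_split/=.
      by apply: eq_bigr => j _; rewrite mulrBl mulNr.
    have Vl := Vop_lin mutV nu.
    rewrite Vl; last 2 first.
    - exact: is_poly_monom.
    - by apply: is_poly_sum => j _; apply/is_polyZ/is_poly_pd/is_poly_monom.
    congr (_ + _).
    rewrite (lin_poly_sum (index_enum 'I_n) (fun j => - x 0 (emb j)) Vl
      (fun j => is_poly_pd j (is_poly_monom c.1))).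
    by rewrite -sumrN; apply: eq_bigr => j _; rewrite mulNr.
  over.
under [X in _ + _ * X]eq_bigr do under eq_bigr do rewrite !E2 -big_split/=.
under [X in _ + _ * X]eq_bigr do rewrite exchange_big/=.
rewrite exchange_big/= mulr_sumr -big_split/= big1// => c _.
rewrite mulrN addrC; apply/eqP; rewrite subr_eq0; apply/eqP.
rewrite [RHS]mulrCA; congr (_ * _).
rewrite mulr_sumr; apply: eq_bigr => j _; rewrite mulr_sumr.
by apply: eq_bigr => i _; rewrite mulrDr.
Qed.

End Recursion.

(** * Restriction to the hyperplane of fixed coordinate sum *)

Section Hyperplane.
Variables (R : realType) (n : nat).

Definition hplane (S : R) (nu : 'rV[R]_n) : 'rV[R]_n.+1 :=
  \row_(i < n.+1) match unlift ord_max i with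
                  | Some j => nu 0 j
                  | None => S - \sum_(l < n) nu 0 l
                  end.

Lemma flamE (f : 'rV[R]_n.+1 -> R) lam nu :
  flam f lam nu = f (hplane (\sum_(l < n.+1) lam 0 l) nu).
Proof. by []. Qed.

Lemma emb_lift (j : 'I_n) : emb j = lift ord_max j.
Proof. by apply: val_inj; exact/esym/lift_max. Qed.

Lemma hplane_emb S nu j : hplane S nu 0 (emb j) = nu 0 j.
Proof. by rewrite mxE emb_lift liftK. Qed.

Lemma hplane_max S nu : hplane S nu 0 ord_max = S - \sum_(l < n) nu 0 l.
Proof. by rewrite mxE unlift_none. Qed.

Lemma is_poly_hplane S (p : 'rV[R]_n.+1 -> R) : is_poly p ->
  is_poly (fun nu => p (hplane S nu)).
Proof.
move=> ip; apply: is_poly_comp ip => i; case: (unliftP ord_max i) => [j|] ->.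
  rewrite -emb_lift (_ : (fun nu => _) = (fun nu : 'rV[R]_n => nu 0 j)).
    exact: is_poly_coord.
  by apply/funext => nu; rewrite hplane_emb.
rewrite (_ : (fun nu => _) = (fun nu : 'rV[R]_n => S + \sum_(l < n) (- 1) * nu 0 l)).
  apply: is_polyD; first exact: is_poly_cst.
  by apply: is_poly_sum => l _; apply/is_polyZ/is_poly_coord.
by apply/funext => nu; rewrite hplane_max -sumrN; congr (_ + _); apply: eq_bigr => l _;
  rewrite mulN1r.
Qed.

Lemma pd_hplane S (a : 'I_n.+1 -> nat) j nu :
  pd j (fun nu => monom a (hplane S nu)) nu =
  (a (emb j))%:R * monom (decr (emb j) a) (hplane S nu) -
  (a ord_max)%:R * monom (decr ord_max a) (hplane S nu).
Proof.
pose dL (i : 'I_n.+1) : R := match unlift ord_max i with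
  | Some l => (l == j)%:R | None => -1 end.
have Ld i : is_derive nu (delta_mx 0 j) (fun y => hplane S y 0 i) (dL i).
  rewrite /dL; case: (unliftP ord_max i) => [l|] ->.
    rewrite -emb_lift (_ : (fun y => _) = (fun y : 'rV[R]_n => y 0 l)); last first.
      by apply/funext => y; rewrite hplane_emb.
    by apply: (is_derive_eq (is_derive_coord l nu (delta_mx 0 j))); rewrite mxE eqxx.
  rewrite (_ : (fun y => _) = cst S - (fun y : 'rV[R]_n => \sum_(l < n) y 0 l)); last first.
    by apply/funext => y; rewrite hplane_max.
  have ds := @is_derive_sum_seq R _ _ (index_enum 'I_n) (fun l (y : 'rV[R]_n) => y 0 l)
    _ nu (delta_mx 0 j) (fun l => is_derive_coord l nu (delta_mx 0 j)).
  apply: (is_derive_eq (is_deriveB (is_derive_cst S nu (delta_mx 0 j)) ds)).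
  rewrite (bigD1 j)//= mxE !eqxx big1 ?addr0 ?sub0r// => l /negPf lj.
  by rewrite mxE lj.
have [_ dE] := is_derive_monom_comp a Ld; rewrite /pd dE.
rewrite big_ord_recr/= /dL unlift_none mulN1r; congr (_ - _).
rewrite (bigD1 j)//= -/(emb j) emb_lift liftK eqxx mul1r big1 ?addr0// => l /negPf lj.
by rewrite -/(emb l) emb_lift liftK lj mul0r.
Qed.

(** Both [hplane S nu] and [x] have coordinate sum S, so the last component of their difference is
    minus the sum of the others: the field nu - x lifts to y - x in n + 1 variables, and Euler's
    identity evaluates the y part. *)
Lemma euler_hplane S (a : 'I_n.+1 -> nat) (x : 'rV[R]_n.+1) (nu : 'rV[R]_n) :
  \sum_l x 0 l = S ->
  \sum_j (nu 0 j - x 0 (emb j)) * pd j (fun nu => monom a (hplane S nu)) nu =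
  (\sum_i a i)%:R * monom a (hplane S nu) -
  \sum_j x 0 j * ((a j)%:R * monom (decr j a) (hplane S nu)).
Proof.
move=> xS; under [LHS]eq_bigr do rewrite pd_hplane.
rewrite -euler_monom !big_ord_recr/= hplane_max.
set M := _ * monom (decr ord_max a) _.
have -> : x 0 ord_max = S - \sum_(j < n) x 0 (emb j).
  by rewrite -xS big_ord_recr/= [X in _ = X - _]addrC addrK.
rewrite opprD !addrA.
have -> : \sum_(i < n) hplane S nu 0 (widen_ord (leqnSn n) i) *
   ((a (widen_ord (leqnSn n) i))%:R * monom (decr (widen_ord (leqnSn n) i) a) (hplane S nu)) =
   \sum_(i < n) nu 0 i * ((a (emb i))%:R * monom (decr (emb i) a) (hplane S nu)).
  by apply: eq_bigr => i _; rewrite -/(emb i) hplane_emb.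
rewrite !mulrBl !mulr_suml.
rewrite [LHS](_ : _ = \sum_(j < n) nu 0 j * ((a (emb j))%:R * monom (decr (emb j) a) (hplane S nu)) -
   \sum_(j < n) x 0 (emb j) * ((a (emb j))%:R * monom (decr (emb j) a) (hplane S nu)) -
   \sum_(j < n) nu 0 j * M + \sum_(j < n) x 0 (emb j) * M); last first.
  by rewrite -!sumrB -big_split/=; apply: eq_bigr => j _; ring.
ring.
Qed.

End Hyperplane.

(** * The formula for polynomials *)

Section PolynomialFormula.
Variables (R : realType) (n : nat) (k : R) (lam : 'rV[R]_n.+1).
Variable mu : 'rV[R]_n.+1 -> probability (n.+1.-tuple R) R.
Variable mut : 'rV[R]_n -> probability (n.-tuple R) R.
Hypothesis lamC : in_chamber lam.
Hypothesis k_gt0 : 0 < k.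
Hypothesis muV : is_Vk_measures k mu.
Hypothesis mutV : is_Vk_measures k mut.

Let h (a : 'I_n.+1 -> nat) (nu : 'rV[R]_n) : R :=
  monom a (hplane (\sum_(l < n.+1) lam 0 l) nu).

Let h_poly a : is_poly (h a).
Proof. exact/is_poly_hplane/is_poly_monom. Qed.

Lemma U_monom_rec (s : 'S_n.+1) a (x := permrow s lam) :
  (\sum_i a i)%:R * U k lam x (Vop mut (h a)) +
  k / 2 * (\sum_j \sum_(i : 'I_n.+1 | i != j)
     (U k lam x (Vop mut (h a)) + U k lam (swapc i j x) (Vop mut (h a)))) =
  \sum_j x 0 j * ((a j)%:R * U k lam x (Vop mut (h (decr j a)))).
Proof.
have xS : \sum_(l < n.+1) x 0 l = \sum_(l < n.+1) lam 0 l.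
  rewrite [RHS](reindex_inj (@perm_inj _ s)); apply: eq_bigr => l _.
  by rewrite /x permrowE.
have := U_euler lamC k_gt0 mutV (Phi_perm lam s) (h_poly a).
have Ul := UV_lin (mut := mut) lamC k_gt0 mutV x.
have -> : (fun nu : 'rV[R]_n => \sum_j (nu 0 j - permrow s lam 0 (emb j)) * pd j (h a) nu) =
   (fun nu => (\sum_i a i)%:R * h a nu + \sum_j (- (x 0 j * (a j)%:R)) * h (decr j a) nu).
  apply/funext => nu; rewrite (euler_hplane _ _ xS) -sumrN; congr (_ + _).
  by apply: eq_bigr => j _; rewrite mulrA mulNr.
rewrite Ul//; last by apply: is_poly_sum => j _; exact: is_polyZ.
rewrite (lin_poly_sum (index_enum 'I_n.+1) (fun j => - (x 0 j * (a j)%:R)) Ul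
  (fun j => h_poly (decr j a))).
move=> /eqP; rewrite addrAC addr_eq0 => /eqP ->.
by rewrite -sumrN; apply: eq_bigr => j _; rewrite mulNr opprK mulrA.
Qed.

Lemma U_one : U k lam lam (fun=> 1) =
  \det (\matrix_(s < n, t < n) cM k lam t (rpoly lam (emb s))).
Proof.
apply: (pfJ_J lamC k_gt0).
rewrite /determinant; apply: (@pfJ_ext _ _ _ _ (fun nu => \sum_(w : 'S_n)
    sgn w * \prod_t (rpoly lam (emb ((w^-1)%g t))).[nu 0 t])).
  move=> nu _; apply: eq_bigr => w _; rewrite mulr1; congr (_ * _).
  rewrite (reindex_inj (@perm_inj _ w))/=; apply: eq_bigr => t _.
  by rewrite permK permrowE.
rewrite [X in pfJ _ _ _ X](eq_bigr (fun w : 'S_n => sgn w *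
    \prod_(t < n) cM k lam t (rpoly lam (emb ((w^-1)%g t))))); last first.
  move=> w _; congr (_ * _); rewrite [RHS](reindex_inj (@perm_inj _ w))/=.
  by apply: eq_bigr => t _; rewrite permK mxE.
by apply: pfJ_sum => w _; apply: pfJZ; exact: pfJ_prod.
Qed.

Lemma monom_formula (a : 'I_n.+1 -> nat) :
  Vop mu (monom a) lam =
  cnk n k * sgQ R n / piA lam `^ (2 * k) * U k lam lam (Vop mut (h a)).
Proof.
set C := _ / _; have pi0 : piA lam `^ (2 * k) != 0 by rewrite gt_eqF// powR_gt0// piA_gt0.
have dlam := chamber_distinct lamC.
(* With the factor [sgn s] the integral obeys the same recursion as [Vop mu], and so does the
   difference [d]. *)
pose Uv a (s : 'S_n.+1) := C * (sgn s * U k lam (permrow s lam) (Vop mut (h a))).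
pose d a (s : 'S_n.+1) := Vop mu (monom a) (permrow s lam) - Uv a s.
have drec b s : (\sum_i b i)%:R * d b s +
     k / 2 * \sum_j \sum_(i | i != j) (d b s - d b (tperm i j * s)%g) =
     \sum_j permrow s lam 0 j * ((b j)%:R * d (decr j b) s).
  have r1 := Vop_monom_rec muV b (distinct_permrow s dlam).
  have r2 := congr1 (fun z => C * sgn s * z) (U_monom_rec s b).
  have -> : \sum_j permrow s lam 0 j * ((b j)%:R * d (decr j b) s) =
     \sum_j permrow s lam 0 j * ((b j)%:R * Vop mu (monom (decr j b)) (permrow s lam)) -
     C * sgn s * (\sum_j permrow s lam 0 j *
        ((b j)%:R * U k lam (permrow s lam) (Vop mut (h (decr j b))))).
    rewrite mulr_sumr -sumrB; apply: eq_bigr => j _; rewrite /d /Uv; ring.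
  rewrite -r1 -r2 /d /Uv.
  have -> : \sum_j \sum_(i | i != j)
      (Vop mu (monom b) (permrow s lam) - C * (sgn s * U k lam (permrow s lam) (Vop mut (h b))) -
       (Vop mu (monom b) (permrow (tperm i j * s)%g lam) -
        C * (sgn (tperm i j * s)%g * U k lam (permrow (tperm i j * s)%g lam) (Vop mut (h b))))) =
     \sum_j \sum_(i | i != j)
      (Vop mu (monom b) (permrow s lam) - Vop mu (monom b) (swapc i j (permrow s lam))) -
     C * sgn s * (\sum_j \sum_(i | i != j)
      (U k lam (permrow s lam) (Vop mut (h b)) +
       U k lam (swapc i j (permrow s lam)) (Vop mut (h b)))).
    rewrite mulr_sumr -sumrB; apply: eq_bigr => j _.
    rewrite mulr_sumr -sumrB; apply: eq_bigr => i ij.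
    by rewrite sgnM sgn_tperm// swapc_permrow; ring.
  by ring.
have m0 N : monom (fun=> 0%N) = (fun=> 1) :> ('rV[R]_N -> R).
  by apply/funext => y; rewrite /monom big1.
(* In degree 0 the recursion makes [d] constant on the orbit, so it is enough to evaluate the
   determinant at the identity permutation. *)
have d0 s : d (fun=> 0%N) s = 0.
  have -> : d (fun=> 0%N) s = d (fun=> 0%N) 1%g.
    apply: harmonic_const => {}s; have := drec (fun=> 0%N) s.
    rewrite big1// mul0r add0r [RHS]big1 => [/eqP|j _]; last by rewrite mul0r mulr0.
    by rewrite mulf_eq0 gt_eqF ?divr_gt0// => /eqP.
  rewrite /d /Uv permrow1 /sgn odd_perm1 expr0 mul1r m0 Vop_cst.
  have -> : h (fun=> 0%N) = fun=> 1 by apply/funext => y; rewrite /h m0.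
  have -> : Vop mut (fun=> 1) = fun=> 1 by apply/funext => y; exact: Vop_cst.
  rewrite U_one /C.
  have := det_cM_rpoly lamC k_gt0; set X := \det _ => XE.
  have sg2 : sgQ R n * sgQ R n = 1.
    by rewrite /sgQ -big_split/= big1// => i _; rewrite -exprMn mulrNN mulr1 expr1n.
  rewrite (_ : _ * X = X * cnk n k * sgQ R n / piA lam `^ (2 * k)); last by ring.
  by rewrite XE [_ * _ * sgQ R n]mulrAC sg2 mul1r mulfV// subrr.
have rho0 : 0 <= \sum_i `|lam 0 i| by apply: sumr_ge0.
have rhoP s j : `|permrow s lam 0 j| <= \sum_i `|lam 0 i|.
  by rewrite permrowE (bigD1 (s j))//= lerDl sumr_ge0.
have := orbit_bound k_gt0 rho0 rhoP (B := 0) _ drec a 1%g.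
rewrite mul0r normr_le0 /d /Uv permrow1 /sgn odd_perm1 expr0 mul1r subr_eq0 => H.
apply/eqP/H => s; have := d0 s; rewrite /d /Uv /sgn => ->.
by rewrite normr0.
Qed.

Lemma poly_formula p : is_poly p ->
  Vop mu p lam = cnk n k / piA lam `^ (2 * k) *
    J k lam (fun nu => sgQ R n * alt lam (Vop mut (flam p lam)) nu).
Proof.
move=> [s ps].
have hp : is_poly (fun nu => p (hplane (\sum_(l < n.+1) lam 0 l) nu)).
  by apply: is_poly_hplane; exists s.
rewrite (Vop_polyE muV ps) (lin_polyZ _ (J_lin lamC k_gt0)); last first.
  by apply: is_poly_alt; exact: (Vop_poly mutV).
rewrite -/(U k lam lam (Vop mut (flam p lam))).
have -> : U k lam lam (Vop mut (flam p lam)) =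
    \sum_(c <- s) c.2 * U k lam lam (Vop mut (h c.1)).
  rewrite -(lin_poly_sum s snd (UV_lin lamC k_gt0 mutV lam) (fun c => h_poly c.1)).
  by congr (U _ _ _ (Vop _ _)); apply/funext => nu; rewrite flamE ps.
rewrite mulr_sumr mulr_sumr; apply: eq_bigr => c _.
by rewrite monom_formula; ring.
Qed.

End PolynomialFormula.

(** * Polynomial approximation *)

Section Weierstrass.
Variables (R : realType) (N : nat).

Definition cube (M : R) (x : 'rV[R]_N) := forall i, `|x 0 i| <= M.

Lemma compact_cube M : compact (cube M).
Proof.
have := @rV_compact R N (fun=> `[- M, M]%classic) (fun=> segment_compact (a := - M) (b := M)).
rewrite (_ : [set v | _] = cube M)//; apply/seteqP; split => v /= h i; have := h i;
  by rewrite /= in_itv/= -ler_norml.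
Qed.

(** Beyond the distance [d] of uniform continuity the oscillation is at most twice a bound of |f|,
    hence at most a multiple of |y - z|^2 / d^2. A quadratic modulus turns the error of Bernstein
    approximation into a variance. *)
Lemma continuous_modulus (f : 'rV[R]_N -> R) (M e : R) : continuous f -> 0 < e ->
  exists2 C, 0 <= C & forall y z, cube M y -> cube M z ->
    `|f y - f z| <= e + C * \sum_i (y 0 i - z 0 i) ^+ 2.
Proof.
move=> cf e0; have /compact_near_coveringP cK := @compact_cube M.
have [B [_ Bf]] : bounded_set (f @` cube M).
  by apply/compact_bounded/continuous_compact; [exact: continuous_subspaceT|exact: compact_cube].
have {}Bf y : cube M y -> `|f y| <= `|B| + 1.
  by move=> yM; apply: (Bf (`|B| + 1)); [rewrite (le_lt_trans (ler_norm _))// ltrDl|exists y].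
have : \forall d \near (0 : R)^'+, cube M `<=` (fun y => forall z, ball y d z -> `|f y - f z| <= e).
  apply: cK => x _; have e2 : 0 < e / 2 by rewrite divr_gt0.
  have /nbhs_ballP[d /= d0 dP] : nbhs x (fun y => `|f x - f y| < e / 2).
    by have /cvgrPdist_lt/(_ _ e2) := cf x.
  have d2 : 0 < d / 2 by rewrite divr_gt0.
  exists (ball x (d / 2), [set t | t < d / 2]).
    split; first by apply/nbhs_ballP; exists (d / 2).
    by near=> t; near: t; exact: nbhs_right_lt.
  move=> [y t] [/= xy td] z yz.
  have xz : ball x d z.
    by rewrite (splitr d); apply: ball_triangle xy _; apply: le_ball yz; exact: ltW.
  have xy' : ball x d y by apply: le_ball xy; rewrite ler_pdivrMr// ler_peMr// ?ler1n// ltW.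
  have h1 := dP _ xz; have h2 := dP _ xy'.
  rewrite (splitr e) (_ : f y - f z = (f x - f z) - (f x - f y)); last by ring.
  by rewrite (le_trans (ler_normB _ _))// lerD// ltW.
move=> /= near_d.
have [d [d0 dP]] : exists d : R, 0 < d /\
    forall y, cube M y -> forall z, ball y d z -> `|f y - f z| <= e.
  have : \forall d \near (0 : R)^'+, 0 < d /\
    forall y, cube M y -> forall z, ball y d z -> `|f y - f z| <= e.
    by near=> d; split; [near: d; exact: nbhs_right_gt|near: d].
  by move=> /filter_ex.
have C0 : 0 <= (`|B| + 1) *+ 2 / d ^+ 2 by rewrite divr_ge0// ?mulrn_wge0 ?addr_ge0// sqr_ge0.
exists ((`|B| + 1) *+ 2 / d ^+ 2) => // y z yM zM.
have s0 : 0 <= \sum_i (y 0 i - z 0 i) ^+ 2 by apply: sumr_ge0 => i _; rewrite sqr_ge0.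
have [yz|] := pselect (ball y d z).
  by rewrite (le_trans (dP _ yM _ yz))// lerDl mulr_ge0.
move=> yz; have [i di] : exists i, d <= `|y 0 i - z 0 i|.
  apply: contrapT => h; apply: yz; split=> // i0 j; rewrite ord1.
  by rewrite /ball/= ltNge; apply/negP => dj; apply: h; exists j.
apply: (@le_trans _ _ ((`|B| + 1) *+ 2)).
  by rewrite (le_trans (ler_normB _ _))// mulr2n lerD ?Bf.
apply: ler_wpDl; first exact: ltW.
rewrite -mulrA ler_peMr ?mulrn_wge0 ?addr_ge0//.
rewrite mulrC ler_pdivlMr ?exprn_gt0// mul1r (bigD1 i)//= -[X in X <= _]addr0 lerD//.
  by rewrite -[leRHS]real_normK ?num_real// lerXn2r ?nnegrE ?normr_ge0 ?(ltW d0).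
by apply: sumr_ge0 => j _; rewrite sqr_ge0.
Unshelve. all: by end_near. Qed.

Definition stepc (j : 'I_N) (v : 'I_N -> nat) : 'I_N -> nat := fun i => (v i + (i == j))%N.

(* Each entry [j] of [s] increments the [j]-th counter with probability [x_j]; the
   expectation of [g] at the end of the walk is the tensor Bernstein polynomial of [g]. *)
Fixpoint walk (g : ('I_N -> nat) -> R) (s : seq 'I_N) (v : 'I_N -> nat) (x : 'rV[R]_N) : R :=
  if s is j :: s' then x 0 j * walk g s' (stepc j v) x + (1 - x 0 j) * walk g s' v x
  else g v.

Lemma is_poly_walk g s v : is_poly (walk g s v).
Proof.
elim: s v => [|j s IH] v /=; first exact: is_poly_cst.
apply: is_polyD; apply: is_polyM; rewrite //; first exact: is_poly_coord.
rewrite (_ : (fun x => _) = (fun x : 'rV[R]_N => 1 + (-1) * x 0 j)).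
  by apply: is_polyD; [exact: is_poly_cst|apply: is_polyZ; exact: is_poly_coord].
by apply/funext => x; rewrite mulN1r.
Qed.

Lemma walk_dist g (h : _ -> R) (c : R) s v (x : 'rV[R]_N) : (forall i, 0 <= x 0 i <= 1) ->
  (forall u, `|g u - c| <= h u) -> `|walk g s v x - c| <= walk h s v x.
Proof.
move=> x01 gh; elim: s v => [|j s IH] v //=; have /andP[xj0 xj1] := x01 j.
rewrite (_ : _ - c = x 0 j * (walk g s (stepc j v) x - c) + (1 - x 0 j) * (walk g s v x - c));
  last by ring.
have xj1' : 0 <= 1 - x 0 j by rewrite subr_ge0.
apply: le_trans (ler_normD _ _) _; rewrite !normrM (ger0_norm xj0) (ger0_norm xj1').
by apply: lerD; apply: ler_wpM2l.
Qed.

(** Squared bias plus binomial variance. The start [v] is arbitrary because each step of the walk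
    moves it. *)
Lemma walk_sq (e C : R) (c : 'I_N -> R) s v (x : 'rV[R]_N) :
  walk (fun u => e + C * \sum_i ((u i)%:R - c i) ^+ 2) s v x =
  e + C * \sum_i (((v i)%:R + (count_mem i s)%:R * x 0 i - c i) ^+ 2 +
                  (count_mem i s)%:R * (x 0 i * (1 - x 0 i))).
Proof.
elim: s v => [|j s IH] v /=.
  by congr (_ + _ * _); apply: eq_bigr => i _; rewrite !mul0r !addr0.
rewrite !IH (_ : forall A B, x 0 j * (e + C * A) + (1 - x 0 j) * (e + C * B) =
  e + C * (x 0 j * A + (1 - x 0 j) * B)); last by move=> A B; ring.
congr (_ + _ * _); rewrite !mulr_sumr -big_split/=; apply: eq_bigr => i _.
rewrite /stepc eq_sym; have [<-|ij] := eqVneq j i; rewrite ?addn0 ?add0n.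
  by rewrite -[nat_of_bool true]/1%N !natrD; ring.
by rewrite -mulrDl addrCA subrr addr0 mul1r.
Qed.

(** [walk_dist] requires its comparison at every counter, even beyond m. Clamping keeps the node in
    the cube and never increases its distance to a point of the cube. *)
Definition clampr (M t : R) : R := Num.max (- M) (Num.min M t).

Lemma clampr_norm M t : 0 <= M -> `|clampr M t| <= M.
Proof.
move=> M0; rewrite ler_norml /clampr le_max lexx/= ge_max ge_min lexx/= andbT.
by rewrite -subr_ge0 opprK addr_ge0.
Qed.

Lemma clampr_sq M t z : `|z| <= M -> (clampr M t - z) ^+ 2 <= (t - z) ^+ 2.
Proof.
rewrite ler_norml => /andP[zl zr]; rewrite /clampr.
have [tM|tM] := leP M t.
  by rewrite max_r; [|lra]; rewrite lerXn2r ?nnegrE; lra.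
by have [tM'|tM'] := leP t (- M); [rewrite -[leRHS]sqrrN -[leLHS]sqrrN lerXn2r ?nnegrE; lra|].
Qed.

Lemma weierstrass (f : 'rV[R]_N -> R) (M e : R) : continuous f -> 0 < e ->
  exists2 p, is_poly p & forall x, cube M x -> `|f x - p x| <= e.
Proof.
move=> cf e0; wlog M0 : M / 0 < M => [wl|].
  have [p ip pP] := wl (`|M| + 1) (ltr_pwDr ltr01 (normr_ge0 M)).
  exists p => // x xM; apply: pP => i; rewrite (le_trans (xM i))// (le_trans (ler_norm _))//.
  by rewrite lerDl.
have e2 : 0 < e / 2 by rewrite divr_gt0.
have [C C0 Cf] := continuous_modulus M cf e2.
(* [A / m] is C times N variances, each at most (2M/m)^2 m. *)
pose A := C * (4 * M ^+ 2 * N%:R).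
have [m [m0 mA]] : exists m : nat, 0 < m%:R :> R /\ A <= e / 2 * m%:R.
  exists (Num.truncn (A / (e / 2))).+1; split; first by rewrite ltr0n.
  by rewrite mulrC -ler_pdivrMr// ltW// truncnS_gt.
pose node (u : 'I_N -> nat) : 'rV[R]_N := \row_i clampr M (2 * M / m%:R * (u i)%:R - M).
pose s := flatten (nseq m (enum 'I_N)).
have cs i : count_mem i s = m.
  rewrite /s count_flatten map_nseq sumn_nseq count_uniq_mem ?enum_uniq// mem_enum mul1n//.
pose aff (x : 'rV[R]_N) : 'rV[R]_N := \row_i ((x 0 i + M) / (2 * M)).
exists (fun x => walk (f \o node) s (fun=> 0%N) (aff x)).
  apply: (is_poly_comp (L := aff)); last exact: is_poly_walk.
  move=> i; rewrite (_ : (fun x => _) = (fun x : 'rV[R]_N => (2 * M)^-1 * (x 0 i + M))).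
    by apply: is_polyZ; apply: is_polyD; [exact: is_poly_coord|exact: is_poly_cst].
  by apply/funext => x; rewrite mxE mulrC.
move=> x xM; rewrite distrC.
pose h (u : 'I_N -> nat) := e / 2 + C * (2 * M / m%:R) ^+ 2 *
  \sum_i ((u i)%:R - m%:R * aff x 0 i) ^+ 2.
have x01 i : 0 <= aff x 0 i <= 1.
  have := xM i; rewrite ler_norml mxE => /andP[xl xr].
  by rewrite divr_ge0/= ?ler_pdivrMr ?mul1r; lra.
have fh u : `|(f \o node) u - f x| <= h u.
  apply: (le_trans (Cf _ _ _ xM)); first by move=> i; rewrite mxE clampr_norm// ltW.
  rewrite /h lerD2l -mulrA ler_wpM2l// mulr_sumr; apply: ler_sum => i _.
  rewrite mxE (le_trans (clampr_sq _ (xM i)))// -exprMn le_eqVlt; apply/orP; left; apply/eqP.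
  by congr (_ ^+ 2); rewrite mxE; field; rewrite gt_eqF//= gt_eqF.
apply: le_trans (walk_dist _ _ x01 fh) _.
rewrite walk_sq [leRHS](splitr e) lerD2l.
apply: (@le_trans _ _ (C * (2 * M / m%:R) ^+ 2 * \sum_(i < N) m%:R)).
  apply: ler_wpM2l; first by rewrite mulr_ge0 ?sqr_ge0.
  apply: ler_sum => i _.
  have /andP[h0 h1] := x01 i.
  rewrite cs add0r subrr expr0n add0r ler_piMr//; nra.
rewrite sumr_const card_ord -[m%:R *+ N]mulr_natr (_ : _ * _ = A / m%:R).
  by rewrite ler_pdivrMr.
by rewrite /A; field; rewrite gt_eqF.
Qed.

End Weierstrass.

(** * Integrals of uniform limits of polynomials *)

Section PolynomialApproximation.
Variables (R : realType).

Definition poly_approx N (f : 'rV[R]_N -> R) := forall M e : R, 0 < e ->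
  exists2 p, is_poly p & forall x, cube M x -> `|f x - p x| <= e.

Section Integrals.
Variables (N : nat) (f : 'rV[R]_N -> R).
Hypothesis fa : poly_approx f.

Lemma poly_approx_bounded M : exists C, forall x, cube M x -> `|f x| <= C.
Proof.
have [p ip pf] := fa M ltr01; have [C pC] := poly_bounded M ip.
exists (1 + C) => x xM; rewrite -(subrK (p x) (f x)) (le_trans (ler_normD _ _))// lerD//.
  exact: pf.
exact: pC.
Qed.

Lemma measurable_poly_approx : measurable_fun setT (fun t : N.-tuple R => f (tup2rV t)).
Proof.
have /choice[p pP] : forall m : nat, exists p, is_poly p /\
    forall x, cube m%:R x -> `|f x - p x| <= m.+1%:R^-1.
  by move=> m; have [|p ip pf] := fa m%:R (e := m.+1%:R^-1); [|exists p].
have mp m : measurable_fun setT (fun t : N.-tuple R => p m (tup2rV t)).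
  exact: (measurable_is_poly (proj1 (pP m))).
apply: (measurable_fun_cvg mp).
move=> t _; apply/cvgrPdist_le => e e0.
near=> m; have [_ /(_ (tup2rV t)) pf] := pP m; apply: le_trans (pf _) _.
  move=> i; rewrite mxE; apply: (@le_trans _ _ (\sum_i `|tnth t i|)).
    by rewrite (bigD1 i)//= lerDl sumr_ge0.
  by near: m; exact: nbhs_infty_ger.
by apply: ltW; near: m; exact: near_infty_natSinv_lt (PosNum e0).
Unshelve. all: by end_near. Qed.

Lemma Rintegral_poly_dist (P : probability (N.-tuple R) R) p (M e : R) :
  P (far M) = 0%E -> is_poly p -> (forall x, cube M x -> `|f x - p x| <= e) ->
  `|Rintegral P setT (fun t => f (tup2rV t)) -
    Rintegral P setT (fun t => p (tup2rV t))| <= e.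
Proof.
move=> PM ip fp; have [C fC] := poly_approx_bounded M.
have mf := measurable_poly_approx.
rewrite -RintegralB//; last 2 first.
- exact: integrable_far PM mf fC.
- exact: integrable_poly PM ip.
apply: (Rintegral_far_le (g := fun x => f x - p x) PM) => //.
by apply: measurable_funB => //; exact: measurable_is_poly.
Qed.

End Integrals.

Lemma cube_hplane n (S M : R) (nu : 'rV[R]_n) : cube M nu ->
  cube (`|S| + n%:R * `|M| + `|M|) (hplane S nu).
Proof.
move=> nuM i; rewrite mxE; case: unliftP => [j _|_].
  by rewrite (le_trans (nuM j))// (le_trans (ler_norm _))// lerDr addr_ge0// mulr_ge0.
rewrite (le_trans (ler_normB _ _))// -[X in _ <= X]addrA lerD2l.
rewrite (le_trans (ler_norm_sum _ _ _))// (@le_trans _ _ (n%:R * `|M|)) ?lerDl//.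
rewrite mulr_natl -[X in _ *+ X](card_ord n) -sumr_const; apply: ler_sum => j _.
by rewrite (le_trans (nuM j))// ler_norm.
Qed.

Lemma poly_approx_hplane n (f : 'rV[R]_n.+1 -> R) (S : R) : poly_approx f ->
  poly_approx (fun nu => f (hplane S nu)).
Proof.
move=> fa M e e0; have [p ip pf] := fa (`|S| + n%:R * `|M| + `|M|) e e0.
exists (fun nu => p (hplane S nu)); first exact: is_poly_hplane.
by move=> nu /(cube_hplane S) /pf.
Qed.

End PolynomialApproximation.

(** * Passage from polynomials to uniform limits *)

Section Extension.
Variables (R : realType) (n : nat) (k : R) (lam : 'rV[R]_n.+1).
Variable mu : 'rV[R]_n.+1 -> probability (n.+1.-tuple R) R.
Variable mut : 'rV[R]_n -> probability (n.-tuple R) R.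
Variable f : 'rV[R]_n.+1 -> R.
Hypothesis lamC : in_chamber lam.
Hypothesis k_gt0 : 0 < k.
Hypothesis muV : is_Vk_measures k mu.
Hypothesis mutV : is_Vk_measures k mut.
Hypothesis fa : poly_approx f.
Notation leb := (@lebesgue_measure R).

Let rho := \sum_i `|lam 0 i|.
Let S := \sum_(l < n.+1) lam 0 l.
(** The radius that [cube_hplane] gives for the cube of radius [rho + 1]; [Vop_far_unif] asks for a
    radius strictly above [rho]. *)
Let M := `|S| + n%:R * `|rho + 1| + `|rho + 1|.
Let G g nu := sgQ R n * alt lam (Vop mut (flam g lam)) nu.

Let rho_ge0 : 0 <= rho. Proof. exact: sumr_ge0. Qed.

Let lam_rho i : `|lam 0 i| <= rho.
Proof. by rewrite /rho (bigD1 i)//= lerDl sumr_ge0. Qed.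

Let cell_cube w (nu : 'rV[R]_n) : cell lam nu -> cube rho (permrow w nu).
Proof.
move=> nuC i; rewrite permrowE; have /andP[lnu nuh] := nuC (w i).
have := lam_rho (inord (w i)); have := lam_rho (inord (w i).+1).
rewrite !ler_norml -/(lo lam (w i)) -/(hi lam (w i)) => /andP[l1 _] /andP[_ h2].
by rewrite (le_trans l1 (ltW lnu)) (le_trans (ltW nuh) h2).
Qed.

Let mut_far w nu : cell lam nu -> mut (permrow w nu) (far (rho + 1)) = 0%E.
Proof.
move=> nuC; apply: (Vop_far_unif k_gt0 mutV (rho := rho)).
- exact/distinct_permrow/(cell_distinct lamC).
- exact: cell_cube.
- by rewrite rho_ge0 ltrDl ltr01.
Qed.

(** For all nu in the cell and all w, the measures at [permrow w nu] live in one cube, so an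
    approximation of [f] carries over to the integrand uniformly in [nu]. The constant bounds the
    kernel, summed over all w. *)
Let integrand_dist : exists2 C, 0 <= C & forall p (e : R), is_poly p ->
  (forall x, cube M x -> `|f x - p x| <= e) ->
  forall nu, cell lam nu -> `|G f nu - G p nu| <= e * C.
Proof.
have [B QB] := poly_bounded rho (is_poly_Qr lam).
exists (\sum_(w : 'S_n) `|B|); first exact: sumr_ge0.
move=> p e ip fp nu nuC; rewrite /G -mulrBr normrM.
have -> : `|sgQ R n| = 1.
  by rewrite /sgQ normr_prod big1// => i _; rewrite normrX normrN1 expr1n.
rewrite mul1r /alt -sumrB (le_trans (ler_norm_sum _ _ _))// mulr_sumr.
apply: ler_sum => w _; rewrite -mulrBr !normrM /sgn normrX normrN1 expr1n mul1r mulrC.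
apply: ler_pM => //; last first.
  exact: le_trans (QB _ (cell_cube w nuC)) (ler_norm B).
apply: (Rintegral_poly_dist (poly_approx_hplane S fa) (mut_far w nuC)).
  exact: is_poly_hplane.
by move=> x /(cube_hplane S) /fp.
Qed.

Lemma wt_gt0 i x : (i < n)%N -> lo lam i < x < hi lam i -> 0 < wt k lam x.
Proof.
move=> ni xi; rewrite /wt powR_gt0// normr_gt0; have [sg _ sgP] := Phi_sign lamC ni.
by apply: contraTneq (sgP x xi) => ->; rewrite mulr0 ltxx.
Qed.

(** Replacing [f] by a polynomial within [e] of it on the cube moves either side by at most a fixed
    multiple of [e], and the two sides agree for polynomials. *)
Lemma approx_formula : Vop mu f lam = cnk n k / piA lam `^ (2 * k) * J k lam (G f).
Proof.
set c := _ / _; have [C C0 GC] := integrand_dist.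
pose L := \prod_(i < n) Rintegral leb `]lo lam i, hi lam i[%classic (wt k lam).
have L0 : 0 <= L by apply: prodr_ge0 => i _; apply: Rintegral_ge0 => x _; exact: powR_ge0.
have approx (e : R) : 0 < e -> exists p s, [/\ is_poly p,
    forall x, cube M x -> `|f x - p x| <= e,
    factors_int (lo lam) (hi lam) n s, J k lam (G p) = prodsum_int (lo lam) (hi lam) n s &
    forall nu, in_cell (lo lam) (hi lam) n nu ->
      `|G f (rowf n nu) * Wk k lam (rowf n nu) - prodsum n s nu| <=
        e * C * \prod_(i < n) wt k lam (nu i)].
  move=> e0; have [p ip fp] := fa M e0.
  have iG : is_poly (G p).
    by apply/is_polyZ/is_poly_alt/(Vop_poly mutV)/is_poly_hplane.
  have [v Gv] := pfJ_poly k lam iG.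
  have [s [si vs Gs]] := pfJ_prodsum lamC k_gt0 Gv.
  exists p, s; split=> //; first by rewrite (pfJ_J lamC k_gt0 Gv).
  move=> nu /Gs[nuC <-]; rewrite -mulrBl normrM; apply: ler_pM => //.
    exact: GC.
  rewrite Wk_wt// ger0_norm; last by apply: prodr_ge0 => i _; exact: powR_ge0.
  by apply: ler_prod => i _; rewrite mxE powR_ge0/=.
have Jdist (e : R) : 0 < e -> exists p, [/\ is_poly p, forall x, cube M x -> `|f x - p x| <= e &
    `|J k lam (G f) - J k lam (G p)| <= e * C * L].
  move=> e0; have [p [s [ip fp si JE fs]]] := approx _ e0; exists p; split=> //.
  rewrite JE.
  apply: (iint_approx (om := fun=> wt k lam)) si fs.
  - exact: lo_hi.
  - by move=> i x; exact: wt_gt0.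
  - move=> i ni; have := wt_integrable lamC k_gt0 1%:P ni.
    rewrite (_ : (fun x => _) = wt k lam)//.
    by apply/funext => x; rewrite hornerC mul1r.
  - move=> e' e'0; have C1 : 0 < C + 1 by rewrite ltr_wpDl.
    have [q [t [_ _ ti _ ft]]] := approx _ (divr_gt0 e'0 C1).
    exists t => // nu nuC; apply: le_trans (ft _ nuC) _; apply: ler_wpM2r.
      by apply: prodr_ge0 => i _; exact: powR_ge0.
    by rewrite mulrAC ler_pdivrMr// ler_wpM2l ?lerDl// ltW.
  - by rewrite mulr_ge0// ltW.
(* Precision e' costs e' on the left and |c| e' C L on the right; dividing [e] by this sum makes the
   total exactly [e]. *)
have D0 : 0 < 1 + `|c| * (C * L) by rewrite ltr_pwDl// !mulr_ge0.
apply/eqP; rewrite -subr_eq0 -normr_le0; apply/ler_addgt0Pr => e e0; rewrite add0r.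
have [p [ip fp Jp]] := Jdist _ (divr_gt0 e0 D0); set e' := e / _ in fp Jp.
have -> : e = e' + `|c| * (e' * C * L).
  by rewrite /e'; field; rewrite gt_eqF.
have -> : Vop mu f lam - c * J k lam (G f) =
    (Vop mu f lam - Vop mu p lam) - c * (J k lam (G f) - J k lam (G p)).
  by rewrite (poly_formula lamC k_gt0 muV mutV ip) -/c; ring.
rewrite (le_trans (ler_normB _ _))// lerD//; last by rewrite normrM ler_wpM2l.
apply: (Rintegral_poly_dist fa (M := rho + 1)) => //.
  apply: (Vop_far_unif k_gt0 muV (rho := rho)) => //.
    exact: chamber_distinct.
  by rewrite rho_ge0 ltrDl ltr01.
move=> x xr; apply: fp => i; rewrite (le_trans (xr i))// (le_trans (ler_norm _))//.
by rewrite lerDr addr_ge0// mulr_ge0.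
Qed.

End Extension.

Theorem theorem4p2 (R : realType) (n : nat) (k : R)
  (mu : 'rV[R]_n.+1 -> probability (n.+1.-tuple R) R)
  (mut : 'rV[R]_n -> probability (n.-tuple R) R)
  (f : 'rV[R]_n.+1 -> R) :
  (1 <= n)%N -> 0 < k ->
  is_Vk_measures k mu -> is_Vk_measures k mut ->
  smooth f ->
  forall lam : 'rV[R]_n.+1, in_chamber lam ->
  Vop mu f lam =
    cnk n k / powR (piA lam) (2 * k) *
    iint n (fun i => lam 0 (inord i.+1)) (fun i => lam 0 (inord i))
      (fun nu0 =>
         let nu : 'rV[R]_n := \row_(i < n) nu0 i in
         \sum_(w : 'S_n)
            sgn w * Qf lam (permrow w nu) * Vop mut (flam f lam) (permrow w nu)
            * Wk k lam nu).
Proof.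
move=> _ k_gt0 muV mutV /(_ [::])[cf _] lam lamC.
have fa : poly_approx f by move=> M e; exact: weierstrass.
rewrite (approx_formula lamC k_gt0 muV mutV fa); congr (_ * _).
rewrite /J; congr (iint _ _ _ _); apply/funext => nu0.
rewrite /alt mulr_sumr mulr_suml; apply: eq_bigr => w _.
by rewrite Qf_Qr; congr (_ * _); ring.
Qed.
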